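(* Let $M$ be a connected complex manifold of dimension $n$ such that for every $p\in M$ the isotropy subgroup $\mathrm{Aut}_p(M)=\{g\in \mathrm{Aut}(M): g(p)=p\}$ is compact in $\mathrm{Aut}(M)$. If $\mathrm{Aut}(M)$ and $\mathrm{Aut}(\Delta^n)$ are isomorphic as topological groups, then $M$ is holomorphically equivalent to $\Delta^n$.
   Context: For a connected complex manifold $M$, $\mathrm{Aut}(M)$ denotes the group of holomorphic automorphisms of $M$ (biholomorphic maps of $M$ onto itself), endowed with the compact-open topology, which makes it a topological group. $\Delta^n\subset\mathbb{C}^n$ is the unit polydisc, i.e. the direct product of $n$ copies of the unit disc $\Delta=\{z\in\mathbb{C}:|z|<1\}$. Dimension means complex dimension. An isomorphism of topological groups is a group isomorphism that is also a homeomorphism. Two complex manifolds are holomorphically equivalent if there is a biholomorphic map between them. *)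

(* Defs.v *)
From HB Require Import structures.
From mathcomp Require Import all_boot all_order all_algebra.
From mathcomp Require Import all_classical all_reals all_analysis.
From mathcomp Require Import complex.

Set Implicit Arguments.
Unset Strict Implicit.
Unset Printing Implicit Defensive.

Import Order.TTheory GRing.Theory Num.Theory.
Import numFieldNormedType.Exports.

Local Open Scope classical_set_scope.
Local Open Scope ring_scope.

(* Naming [R[i]] at type [numFieldType] makes the topology and norm that every
   numFieldType carries available on it; 'rV[Cplx R]_n then has the sup norm
   and [differentiable] between such spaces is complex differentiability. *)
Definition Cplx (R : realType) : numFieldType := R[i].

Section NearDifferentiable.
Context {K : numFieldType} {V W : normedModType K}.

Lemma near_eq_differentiable (f g : V -> W) (x : V) :
  (\forall y \near x, f y = g y) -> differentiable f x -> differentiable g x.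
Proof.
move=> fg df; have fgx := nbhs_singleton fg.
have [dfc dfE] := (diff_locallyP x f).1 df.
have gE : g \o shift x = cst (g x) + 'd f x +o_ 0 id.
  apply/eqaddoP => _/posnumP[e].
  have /eqaddoP/(_ e%:num)/(_ [gt0 of e%:num]) := dfE.
  have fg0 : \forall h \near (0 : V), f (h + x) = g (h + x).
    by move: fg; rewrite (near_shift 0) /= => fg; near=> h;
      rewrite -[x]subr0; near: h.
  apply: filterS2 fg0 => h fgh.
  by rewrite /= !fctE /= fgh fgx.
apply/diff_locallyP; have dg := diff_unique dfc gE.
by rewrite dg; split.
Unshelve. all: by end_near. Qed.

End NearDifferentiable.

(* A homeomorphism from an open subset [chart_dom] of M onto an open subset
   [chart_cod] of C^n. The maps are total functions whose values off
   [chart_dom] and [chart_cod] are irrelevant; as these sets are open,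
   pointwise continuity on them is continuity of the restrictions. *)
Record chart (R : realType) (n : nat) (M : topologicalType) := Chart {
  chart_dom : set M;
  chart_cod : set 'rV[Cplx R]_n;
  chart_to : M -> 'rV[Cplx R]_n;
  chart_from : 'rV[Cplx R]_n -> M;
  chart_open_dom : open chart_dom;
  chart_open_cod : open chart_cod;
  chart_to_cod : forall p, chart_dom p -> chart_cod (chart_to p);
  chart_from_dom : forall z, chart_cod z -> chart_dom (chart_from z);
  chart_toK : forall p, chart_dom p -> chart_from (chart_to p) = p;
  chart_fromK : forall z, chart_cod z -> chart_to (chart_from z) = z;
  chart_to_cts : forall p, chart_dom p -> {for p, continuous chart_to};
  chart_from_cts : forall z, chart_cod z -> {for z, continuous chart_from}
}.

(* The coordinate changes have open domains, so being complex differentiable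
   at each point of them is being holomorphic. Connectedness and nonemptiness
   are not part of the structure. *)
Record complexManifold (R : realType) (n : nat) := ComplexManifold {
  cm_space :> topologicalType;
  cm_hausdorff : hausdorff_space cm_space;
  cm_second_countable : @second_countable cm_space;
  cm_atlas : set (chart R n cm_space);
  cm_cover : forall p, exists2 c, cm_atlas c & chart_dom c p;
  cm_compatible : forall c d, cm_atlas c -> cm_atlas d ->
    forall p, chart_dom c p -> chart_dom d p ->
    differentiable (chart_to d \o chart_from c) (chart_to c p)
}.

Definition holomorphic (R : realType) (m n : nat) (M : complexManifold R m)
    (N : complexManifold R n) (f : M -> N) : Prop :=
  continuous f /\
  forall c d, cm_atlas c -> cm_atlas d ->
  forall p, chart_dom c p -> chart_dom d (f p) ->
    differentiable (chart_to d \o f \o chart_from c) (chart_to c p).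

Definition biholomorphic (R : realType) (m n : nat) (M : complexManifold R m)
    (N : complexManifold R n) (f : M -> N) : Prop :=
  holomorphic f /\
  exists g : N -> M, [/\ holomorphic g, cancel f g & cancel g f].

Definition holomorphically_equivalent (R : realType) (m n : nat)
    (M : complexManifold R m) (N : complexManifold R n) : Prop :=
  exists f : M -> N, biholomorphic f.

Section HolomorphicTheory.
Context {R : realType}.

Lemma holomorphic_id n (M : complexManifold R n) :
  holomorphic (fun p : M => p).
Proof.
split; first by move=> p.
by move=> c d Ac Ad p cp dp; exact: cm_compatible.
Qed.

Lemma holomorphic_comp m n k (M : complexManifold R m)
    (N : complexManifold R n) (P : complexManifold R k)
    (f : M -> N) (g : N -> P) :
  holomorphic f -> holomorphic g -> holomorphic (g \o f).
Proof.
move=> [fc fh] [gc gh]; split.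
  by move=> p; apply: continuous_comp; [exact: fc | exact: gc].
move=> c e Ac Ae p cp ep.
have [d Ad dfp] := cm_cover (f p).
have cpE : chart_from c (chart_to c p) = p by exact: chart_toK.
apply: (@near_eq_differentiable _ _ _
  ((chart_to e \o g \o chart_from d) \o (chart_to d \o f \o chart_from c))).
  have /continuous_comp := @chart_from_cts _ _ _ c _ (chart_to_cod cp).
  move=> /(_ _ f (fc _)) fcts.
  have : nbhs (f (chart_from c (chart_to c p))) (chart_dom d).
    rewrite cpE; exact: (open_nbhs_nbhs (conj (chart_open_dom d) dfp)).
  move=> /fcts dz; near=> z; rewrite /= chart_toK //; near: z; exact: dz.
apply: differentiable_comp; first exact: fh.
by rewrite /= cpE; exact: gh.
Unshelve. all: by end_near. Qed.

End HolomorphicTheory.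

(* {compact-open, M -> M} is the type of all maps M -> M, so the topology of
   [Aut M] is the one induced on the subset of biholomorphic maps. *)
Definition Aut_set (R : realType) (n : nat) (M : complexManifold R n) :
    set {compact-open, M -> M} :=
  [set f | @biholomorphic R n n M M f].
Arguments Aut_set {R n} M.

Definition Aut (R : realType) (n : nat) (M : complexManifold R n) : Type :=
  set_type (Aut_set M).

HB.instance Definition _ (R : realType) (n : nat) (M : complexManifold R n) :=
  Topological.copy (Aut M) (set_type (Aut_set M)).

Section AutGroup.
Context {R : realType} {n : nat} {M : complexManifold R n}.

Definition Aut_fun (g : Aut M) : M -> M := set_val g.

Definition Aut_mk (f : M -> M) (fP : biholomorphic f) : Aut M :=
  exist _ (f : {compact-open, M -> M}) (mem_set fP).

Lemma Aut_funP (g : Aut M) : biholomorphic (Aut_fun g).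
Proof. exact: set_valP. Qed.

Lemma Aut_fun_inj : injective Aut_fun.
Proof. exact: val_inj. Qed.

Lemma Aut_mkE (f : M -> M) (fP : biholomorphic f) : Aut_fun (Aut_mk fP) = f.
Proof. by []. Qed.

Lemma biholomorphic_id : biholomorphic (fun p : M => p).
Proof.
split; first exact: holomorphic_id.
by exists (fun p => p); split=> //; exact: holomorphic_id.
Qed.

Lemma biholomorphic_comp (f g : M -> M) :
  biholomorphic f -> biholomorphic g -> biholomorphic (f \o g).
Proof.
move=> [fh [f' [f'h fK f'K]]] [gh [g' [g'h gK g'K]]].
split; first exact: holomorphic_comp.
exists (g' \o f'); split; first exact: holomorphic_comp.
- by move=> p /=; rewrite fK gK.
- by move=> p /=; rewrite g'K f'K.
Qed.

Lemma Aut_inv_subproof (g : Aut M) : exists h : Aut M,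
  cancel (Aut_fun g) (Aut_fun h) /\ cancel (Aut_fun h) (Aut_fun g).
Proof.
have [gh [h [hh gK hK]]] := Aut_funP g.
have hP : biholomorphic h by split=> //; exists (Aut_fun g); split.
by exists (Aut_mk hP); rewrite Aut_mkE.
Qed.

Definition Aut_one : Aut M := Aut_mk biholomorphic_id.
Definition Aut_mul (g h : Aut M) : Aut M :=
  Aut_mk (biholomorphic_comp (Aut_funP g) (Aut_funP h)).
Definition Aut_inv (g : Aut M) : Aut M := sval (cid (Aut_inv_subproof g)).

Lemma Aut_mulA : associative Aut_mul.
Proof. by move=> f g h; apply: Aut_fun_inj. Qed.

Lemma Aut_mul1g : left_id Aut_one Aut_mul.
Proof. by move=> f; apply: Aut_fun_inj. Qed.

Lemma Aut_mulg1 : right_id Aut_one Aut_mul.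
Proof. by move=> f; apply: Aut_fun_inj. Qed.

Lemma Aut_mulVg : left_inverse Aut_one Aut_inv Aut_mul.
Proof.
move=> f; apply: Aut_fun_inj; apply/funext => p.
by rewrite /Aut_inv; case: cid => g /= [fK gK]; exact: fK.
Qed.

Lemma Aut_mulgV : right_inverse Aut_one Aut_inv Aut_mul.
Proof.
move=> f; apply: Aut_fun_inj; apply/funext => p.
by rewrite /Aut_inv; case: cid => g /= [fK gK]; exact: gK.
Qed.

(* The group law is composition: (g * h) p = g (h p). *)
HB.instance Definition _ := isGroup.Build (Aut M)
  Aut_mulA Aut_mul1g Aut_mulg1 Aut_mulVg Aut_mulgV.

Definition isotropy (p : M) : set (Aut M) := [set g | Aut_fun g p = p].

End AutGroup.

Definition Aut_isomorphic (R : realType) (m n : nat) (M : complexManifold R m)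
    (N : complexManifold R n) : Prop :=
  exists (phi : Aut M -> Aut N) (psi : Aut N -> Aut M),
    [/\ {morph phi : g h / (g * h)%g}, cancel phi psi, cancel psi phi,
        continuous phi & continuous psi].

Section Polydisc.
Variables (R : realType) (n : nat).
Local Notation C := (Cplx R).

Definition polydisc_set : set 'rV[C]_n := [set z | forall i, `|z ord0 i| < 1].

Lemma polydisc_setE : polydisc_set = ball (0 : 'rV[C]_n) 1.
Proof.
apply/seteqP; split => z.
  move=> zP; split; first exact: ltr01.
  by move=> i j; rewrite (ord1 i) mxE /ball /= sub0r normrN; exact: zP.
move=> [_ zP] i; have := zP ord0 i.
by rewrite mxE /ball /= sub0r normrN.
Qed.

Lemma polydisc_open : open polydisc_set.
Proof. by rewrite polydisc_setE; apply: ball_open; exact: ltr01. Qed.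

Lemma polydisc_set0 : polydisc_set 0.
Proof. by move=> i; rewrite mxE normr0 ltr01. Qed.

Let D : topologicalType := set_type polydisc_set.

Let emb (p : D) : 'rV[C]_n := set_val p.
Let retr (z : 'rV[C]_n) : D :=
  insubd (exist _ 0 (mem_set polydisc_set0) : set_type polydisc_set) z.

Let embP p : polydisc_set (emb p).
Proof. exact: set_valP. Qed.

Let embK p : setT p -> retr (emb p) = p.
Proof. by move=> _; exact: valKd. Qed.

Let retrK z : polydisc_set z -> emb (retr z) = z.
Proof. by move=> zP; rewrite /emb /retr set_valE insubdK // mem_set. Qed.

Let emb_cts : continuous emb.
Proof. exact: initial_continuous. Qed.

Let retr_cts z : polydisc_set z -> {for z, continuous retr}.
Proof.
move=> zP U nU; change (nbhs (retr z) U) in nU.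
move: nU; rewrite nbhsE => -[V [[W oW WV] Vz] VU].
have Wz : W z by move: Vz; rewrite -WV /= -/(emb _) retrK.
have : nbhs z (W `&` polydisc_set).
  by apply: open_nbhs_nbhs; split=> //; apply: openI => //; exact: polydisc_open.
apply: filterS => y [Wy yP]; apply: VU; rewrite -WV /=.
by rewrite -/(emb _) retrK.
Qed.

Definition polydisc_chart : chart R n D :=
  Chart openT polydisc_open (fun p _ => embP p) (fun _ _ => I)
    embK retrK (fun p _ => @emb_cts p) retr_cts.

Lemma polydisc_hausdorff : hausdorff_space D.
Proof.
move=> p q pq; apply: val_inj.
apply: (@norm_hausdorff C 'rV[C]_n) => A B pA qB.
have [r [Ar Br]] := pq _ _ (@emb_cts _ _ pA) (@emb_cts _ _ qB).
by exists (emb r).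
Qed.

Let ratpt (q : 'rV[rat * rat]_n) : 'rV[C]_n :=
  \row_j (Complex (ratr (q ord0 j).1) (ratr (q ord0 j).2) : R[i]).

Let ratpt_dense (x : 'rV[C]_n) (e : R) : 0 < e ->
  exists q, ball (ratpt q) (e%:C%C : C) x.
Proof.
move=> e0.
have dns (y : R) : exists q : rat, `|y - ratr q| < e / 2.
  have : y - e / 2 < y + e / 2.
    by rewrite ltrBlDr -addrA -splitr ltrDl.
  move=> /rat_in_itvoo[q]; rewrite in_itv /= => /andP[q1 q2].
  by exists q; rewrite ltr_distlC; apply/andP; split.
have /choice[q qP] (y : R[i]) : exists q : rat * rat,
    `|complex.Re y - ratr q.1| < e / 2 /\ `|complex.Im y - ratr q.2| < e / 2.
  have [a ?] := dns (complex.Re y); have [b ?] := dns (complex.Im y).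
  by exists (a, b).
exists (\row_j q (x ord0 j)); split; first by rewrite ltcR.
move=> i j; rewrite (ord1 i) !mxE; apply: ball_sym; rewrite /ball /=.
have [] := qP (x ord0 j).
case: (x ord0 j) => a b /=; case: (q _) => r s /= ar bs.
have -> : (Complex a b - Complex (ratr r) (ratr s) : R[i]) =
  (a - ratr r)%:C%C + Complex 0 1 * (b - ratr s)%:C%C.
  apply/eqP; rewrite eq_complex /=.
  by rewrite !(mul0r, mul1r, mulr0, addr0, add0r, subr0, sub0r, oppr0) !eqxx.
apply: (le_lt_trans (ler_normD _ _)); rewrite normrM.
have nR (t : R) : `|t%:C%C : R[i]| = `|t|%:C%C.
  by rewrite normc_def /= expr0n addr0 sqrtr_sqr.
have -> : `|Complex 0 1 : R[i]| = 1.
  by rewrite normc_def /= expr0n add0r expr1n sqrtr1.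
by rewrite mul1r !nR -rmorphD /= ltcR [ltRHS]splitr ltrD.
Qed.

Lemma polydisc_second_countable : @second_countable D.
Proof.
pose F (qk : 'rV[rat * rat]_n * nat) : set D :=
  emb @^-1` ball (ratpt qk.1) ((qk.2.+1%:R^-1 : R)%:C%C : C).
exists (range F).
  exact: (sub_countable (card_image_le _ _) (countableP _)).
split.
  move=> _ [[q k] _ <-]; apply: open_comp; first by move=> p _; exact: emb_cts.
  by apply: ball_open; rewrite ltcR invr_gt0.
move=> x U; rewrite nbhsE => -[V [[W oW WV] Vx] VU].
have : nbhs (emb x) W.
  by apply: open_nbhs_nbhs; split => //; rewrite -WV in Vx.
move=> /nbhs_ballP[e /= e0 eW].
have [eI eR] : complex.Im (e : R[i]) = 0 /\ 0 < complex.Re (e : R[i]).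
  by move: e0; rewrite ltcE /= => /andP[/eqP -> ->].
have [k ke] : exists k, (k.+1%:R^-1 : R) < complex.Re (e : R[i]) / 2.
  have e20 : 0 < complex.Re (e : R[i]) / 2 by rewrite divr_gt0.
  have [k _ /(_ _ (leqnn _)) kP] := near_infty_natSinv_lt (PosNum e20).
  by exists k.
have [q qP] : exists q, ball (ratpt q) ((k.+1%:R^-1 : R)%:C%C : C) (emb x).
  by apply: ratpt_dense; rewrite invr_gt0.
exists (F (q, k)).
  by split => //; exists (q, k).
move=> y yP; apply: VU; rewrite -WV; apply: eW.
have := ball_triangle (ball_sym qP) yP.
apply: le_ball; rewrite -rmorphD /=.
have -> : e = (complex.Re (e : R[i]))%:C%C by case: (e) eI => a b /= ->.
by rewrite lecR [leRHS]splitr; apply: lerD; exact: ltW.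
Qed.

Lemma polydisc_cover (p : D) :
  exists2 c, [set polydisc_chart] c & chart_dom c p.
Proof. by exists polydisc_chart. Qed.

Lemma polydisc_compatible (c d : chart R n D) :
  [set polydisc_chart] c -> [set polydisc_chart] d ->
  forall p, chart_dom c p -> chart_dom d p ->
  differentiable (chart_to d \o chart_from c) (chart_to c p).
Proof.
move=> -> -> p _ _; apply: (@near_eq_differentiable _ _ _ id) => //.
have : nbhs (emb p) polydisc_set.
  by apply: open_nbhs_nbhs; split; [exact: polydisc_open | exact: embP].
by apply: filterS => z zP /=; rewrite retrK.
Qed.

Definition polydisc : complexManifold R n :=
  ComplexManifold polydisc_hausdorff polydisc_second_countable
    polydisc_cover polydisc_compatible.

End Polydisc.

(* Main.v *)
(* SU(1,1)^n acts on the polydisc and hence, through the isomorphism, on M. An element fixing a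
   point of M has bounded powers, as isotropy groups are compact, so each of its components is
   elliptic or +-1. Therefore AN^n, which is simply transitive on the polydisc, acts freely on M.
   By Cauchy's estimate automorphisms near the identity displace points almost additively, so
   one-parameter groups are differentiable, and so is the orbit map of AN^n at the origin, with an
   injective real derivative. The dimensions being equal, orbits are open, and by connectedness
   AN^n is simply transitive on M. Elliptic elements in an isotropy group then produce a point p
   fixed by the torus of rotations, and g 0 |-> g p is an equivariant homeomorphism from the
   polydisc onto M. Its derivative at 0 intertwines the coordinate rotations with complex linear
   maps, hence becomes complex linear after conjugating some of the coordinates of the polydisc;
   by equivariance the homeomorphism is then biholomorphic. *)

Require Import Defs.
From HB Require Import structures.
From mathcomp Require Import all_boot all_order all_algebra.
From mathcomp Require Import all_classical all_reals all_analysis.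
From mathcomp Require Import complex ring lra.

Set Implicit Arguments.
Unset Strict Implicit.
Unset Printing Implicit Defensive.

Import Order.TTheory GRing.Theory Num.Theory.
Import numFieldNormedType.Exports.

Local Open Scope classical_set_scope.
Local Open Scope ring_scope.

(** * Complex norms and Goursat's theorem *)

(** [Aut M] comes without a smooth structure, so Lie-theoretic arguments are replaced by estimates
    in a chart. Closeness to the identity in the compact-open topology controls first derivatives
    through Cauchy's estimate; hence [g x - x] is almost constant near a point. Orbits are shown to
    be open by minimizing a distance: an injective derivative of the orbit map at the base point
    alone allows a step that would reduce it.

    Compactness of isotropy groups enters once: the isomorphism sends such a group to automorphisms
    of the polydisc that keep the origin in a compact subset, which bounds the matrix entries of all
    powers. AN^n is singled out because it contains no elliptic elements and no component -1, so
    that freeness on [M] is immediate. The signs come from the kernel of SU(1,1) acting on the disc.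

    Conjugating coordinates is forced: complex conjugation of one coordinate normalizes SU(1,1)^n,
    so the group alone does not distinguish a disc factor from its conjugate. *)

Section RealNorm.
Context {R : realType}.
Local Notation C := (Cplx R).

(* Norms over [R[i]] are complex numbers; [rn] is the norm as an element of [R]. *)
Definition rn {V : normedModType C} (v : V) : R := complex.Re (`|v| : R[i]).

Lemma rnE {V : normedModType C} (v : V) : `|v| = (rn v)%:C%C :> R[i].
Proof. by rewrite /rn RRe_real //; exact: normr_real. Qed.

Lemma rn_ge0 {V : normedModType C} (v : V) : 0 <= rn v.
Proof. by rewrite -lecR -rnE; exact: normr_ge0. Qed.

Lemma rn0 {V : normedModType C} : rn (0 : V) = 0.
Proof. by rewrite /rn normr0. Qed.

Lemma rn_eq0 {V : normedModType C} (v : V) : rn v = 0 -> v = 0.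
Proof. by move=> v0; apply/eqP; rewrite -normr_eq0; apply/eqP; rewrite [LHS]rnE v0. Qed.

Lemma rn_gt0 {V : normedModType C} (v : V) : v != 0 -> 0 < rn v.
Proof.
move=> v0; rewrite lt_neqAle rn_ge0 andbT; apply: contra v0 => /eqP/esym/rn_eq0 ->.
exact: eqxx.
Qed.

Lemma rnN {V : normedModType C} (v : V) : rn (- v) = rn v.
Proof. by rewrite /rn normrN. Qed.

Lemma rn_sub {V : normedModType C} (v w : V) : rn (v - w) = rn (w - v).
Proof. by rewrite /rn distrC. Qed.

Lemma rnD {V : normedModType C} (v w : V) : rn (v + w) <= rn v + rn w.
Proof. by rewrite -lecR rmorphD /= -!rnE; exact: ler_normD. Qed.

Lemma rnB {V : normedModType C} (v w : V) : rn (v - w) <= rn v + rn w.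
Proof. by rewrite -(rnN w); exact: rnD. Qed.

Lemma rnZ {V : normedModType C} (a : C) (v : V) : rn (a *: v) = rn a * rn v.
Proof.
have : (rn (a *: v))%:C%C = (rn a * rn v)%:C%C :> R[i].
  by rewrite rmorphM /= -!rnE; exact: normrZ.
by move=> /complexI.
Qed.

Lemma rnM (a b : C) : rn (a * b) = rn a * rn b.
Proof. exact: (@rnZ C). Qed.

Lemma rn1 : rn (1 : C) = 1. Proof. by rewrite /rn normr1. Qed.

Lemma rnV (a : C) : rn (a^-1) = (rn a)^-1.
Proof.
have [->|a0] := eqVneq a 0; first by rewrite invr0 rn0 invr0.
have a1 : rn a * rn a^-1 = 1 by rewrite -rnM mulfV // rn1.
apply: (@mulfI _ (rn a)); first by rewrite gt_eqF // rn_gt0.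
by rewrite a1 mulfV // gt_eqF // rn_gt0.
Qed.

Lemma rnX (a : C) k : rn (a ^+ k) = rn a ^+ k.
Proof. by elim: k => [|k IH]; rewrite ?expr0 ?rn1 // !exprS rnM IH. Qed.

Lemma rn_sqr (a : C) : rn a ^+ 2 = complex.Re a ^+ 2 + complex.Im a ^+ 2.
Proof. by apply: complexI; rewrite /= rmorphXn /= -rnE add_Re2_Im2. Qed.

Lemma rn_real (t : R) : rn (t%:C%C : C) = `|t|.
Proof. by rewrite /rn normc_def /= expr0n addr0 sqrtr_sqr. Qed.

Lemma cReB (a b : C) : complex.Re (a - b : C) = complex.Re a - complex.Re b.
Proof. by case: a b => ? ? [? ?]. Qed.

Lemma cImB (a b : C) : complex.Im (a - b : C) = complex.Im a - complex.Im b.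
Proof. by case: a b => ? ? [? ?]. Qed.

Lemma cReM (a b : C) : complex.Re (a * b : C) =
  complex.Re a * complex.Re b - complex.Im a * complex.Im b.
Proof. by case: a b => ? ? [? ?]. Qed.

Lemma cImM (a b : C) : complex.Im (a * b : C) =
  complex.Re a * complex.Im b + complex.Im a * complex.Re b.
Proof. by case: a b => ? ? [? ?]. Qed.

Lemma rn_conj (a : C) : rn ((a : R[i])^* : C) = rn a.
Proof. by rewrite /rn norm_conjC. Qed.

Lemma rn_Re (a : C) : `|complex.Re a| <= rn a.
Proof. by rewrite -lecR -rnE; exact: normc_ge_Re. Qed.

Lemma rn_Im (a : C) : `|complex.Im a| <= rn a.
Proof.
rewrite -(@ler_pXn2r _ 2) ?nnegrE ?rn_ge0 //.
by rewrite rn_sqr real_normK ?num_real // lerDr sqr_ge0.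
Qed.

Lemma rn_le_ReIm (a : C) : rn a <= `|complex.Re a| + `|complex.Im a|.
Proof.
rewrite -(@ler_pXn2r _ 2) ?nnegrE ?rn_ge0 ?addr_ge0 //.
rewrite rn_sqr sqrrD !real_normK ?num_real // -addrA lerD2l lerDr.
by rewrite mulrn_wge0 // mulr_ge0.
Qed.

Lemma rn_dist {V : normedModType C} (v w : V) : rn v - rn w <= rn (v - w).
Proof. by rewrite lerBlDr -{1}(subrK w v); exact: rnD. Qed.

Lemma nbhs_rnP {V : normedModType C} (x : V) (U : set V) :
  nbhs x U <-> exists2 e : R, 0 < e & forall y, rn (y - x) < e -> U y.
Proof.
split=> [/nbhs_ballP[e /= e0 eU]|[e e0 eU]].
  have eE : (complex.Re (e : R[i]))%:C%C = e.
    by rewrite RRe_real // gtr0_real.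
  exists (complex.Re (e : R[i])); first by rewrite -ltcR eE.
  move=> y yx; apply: eU; rewrite -ball_normE /ball_ /= -eE distrC.
  by rewrite [X in X < _]rnE ltcR.
apply/nbhs_ballP; exists (e%:C%C) => /=; first by rewrite ltcR.
move=> y; rewrite -ball_normE /ball_ /= distrC [X in X < _]rnE ltcR; exact: eU.
Qed.

Lemma differentiable_rnP {V W : normedModType C} (f : V -> W) (x : V) :
  differentiable f x -> exists A : {linear V -> W},
    (exists2 k, 0 < k & forall h, rn (A h) <= k * rn h) /\
    forall e, 0 < e -> exists2 d, 0 < d & forall h, rn h < d ->
      rn (f (x + h) - f x - A h) <= e * rn h.
Proof.
move=> /diff_locallyP[dc dE]; exists ('d f x); split.
  have /nbhs_rnP[d d0 dP] : nbhs (0 : V) ('d f x @^-1` [set y | rn y < 1]).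
    apply: dc; rewrite linear0; apply/nbhs_rnP; exists 1; first exact: ltr01.
    by move=> y; rewrite subr0.
  exists (2 / d) => [|h]; first by rewrite divr_gt0.
  have [->|h0] := eqVneq h 0; first by rewrite linear0 !rn0 mulr0.
  (* Rescaling [h] to norm [d / 2] brings it into the ball where the derivative takes values of norm
     below 1. *)
  have hp := rn_gt0 h0; pose t : R := d / 2 / rn h.
  have t0 : 0 < t by rewrite !divr_gt0.
  have := dP ((t%:C%C : C) *: h); rewrite /= subr0 linearZ !rnZ rn_real gtr0_norm //.
  rewrite {1}/t divfK ?gt_eqF // => H.
  have {H} : t * rn ('d f x h) < 1 by apply: H; lra.
  rewrite -ltr_pdivlMl // mulr1 => /ltW H; apply: le_trans H _.
  by rewrite /t !invf_div mulrC.
move=> e e0; have /eqaddoP/(_ (e%:C%C : C)) := dE.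
have e0' : 0 < (e%:C%C : C) by rewrite ltcR.
move=> /(_ e0') /nbhs_rnP[d d0 dP]; exists d => // h hd.
have := dP h; rewrite subr0 => /(_ hd) H.
rewrite -lecR rmorphM /= -!rnE; move: H; rewrite /shift !fctE /= (addrC h) opprD addrA.
exact.
Qed.

Lemma rn_differentiable {V W : normedModType C} (f : V -> W) (x : V)
    (A : {linear V -> W}) (k : R) : (forall h, rn (A h) <= k * rn h) ->
  (forall e, 0 < e -> exists2 d, 0 < d & forall h, rn h < d ->
      rn (f (x + h) - f x - A h) <= e * rn h) ->
  differentiable f x.
Proof.
move=> Ak dA; have Ac : continuous A.
  move=> y U /nbhs_rnP[e e0 eU]; apply/nbhs_rnP.
  have k0 : 0 < `|k| + 1 by rewrite ltr_wpDl.
  exists (e / (`|k| + 1)); first exact: divr_gt0.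
  move=> z zy; apply: eU; rewrite -linearB; apply: le_lt_trans (Ak _) _.
  rewrite ltr_pdivlMr // mulrC in zy; apply: le_lt_trans zy.
  by rewrite ler_wpM2r ?rn_ge0 // (le_trans (ler_norm k)) // lerDl.
have fE : f \o shift x = cst (f x) + A +o_ 0 id.
  apply/eqaddoP => e e0.
  have eE : (complex.Re (e : R[i]))%:C%C = e by rewrite RRe_real // gtr0_real.
  have e0' : 0 < complex.Re (e : R[i]) by rewrite -ltcR eE.
  have [d d0 dP] := dA _ e0'; apply/nbhs_rnP; exists d => // h.
  rewrite subr0 => /dP; rewrite !fctE /= opprD addrA (addrC h) => H.
  by rewrite ![`|_|]rnE -[X in _ <= X * _]eE -rmorphM lecR.
by have dg := diff_unique Ac fE; apply/diff_locallyP; rewrite dg.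
Qed.

Lemma rn_rV_lt n (v : 'rV[C]_n) (r : R) : 0 < r ->
  rn v < r <-> forall i, rn (v ord0 i) < r.
Proof.
move=> r0; have r0' : 0 < (r%:C%C : C) by rewrite ltcR.
have nE (V : normedModType C) (w : V) : (`|w| < (r%:C%C : C)) = (rn w < r).
  by rewrite [X in X < _]rnE ltcR.
rewrite -nE -[v in `|v|]opprK normrN -[- v]sub0r; split=> [vr i|H].
  have : ball (0 : 'rV[C]_n) (r%:C%C : C) v by rewrite -ball_normE.
  move=> [_ /(_ ord0 i)]; rewrite mxE -ball_normE /ball_ /= sub0r normrN.
  by rewrite nE.
suff : ball (0 : 'rV[C]_n) (r%:C%C : C) v by rewrite -ball_normE.
split => // i j; rewrite (ord1 i) mxE -ball_normE /ball_ /= sub0r normrN.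
by rewrite nE.
Qed.

Lemma rn_rV_le n (v : 'rV[C]_n) (r : R) : 0 <= r ->
  rn v <= r <-> forall i, rn (v ord0 i) <= r.
Proof.
move=> r0; split=> [H i|H]; apply/ler_addgt0Pl => e e0; apply/ltW.
  by apply: (iffLR (rn_rV_lt _ _)); [lra | move: H; lra].
by apply/rn_rV_lt => [|i]; [lra | move: (H i); lra].
Qed.

Lemma rn_coord n (v : 'rV[C]_n) i : rn (v ord0 i) <= rn v.
Proof. by move: i; apply/rn_rV_le => //; exact: rn_ge0. Qed.

End RealNorm.

(** * Integrals of continuous functions over real segments *)

Section SegmentIntegral.
Context {R : realType}.
Local Notation mu := (@lebesgue_measure R).

Definition RI (f : R -> R) (a b : R) : R := \int[mu]_(x in `[a, b]) f x.

(** Continuity is two-sided even at the endpoints; the integrands below have it, being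
    differentiable at every point of the closed rectangle. *)
Definition ctson (f : R -> R) (a b : R) :=
  forall x, a <= x <= b -> {for x, continuous f}.

Lemma ctson_integrable f a b : ctson f a b -> mu.-integrable `[a, b] (EFin \o f).
Proof.
move=> fc; apply: continuous_compact_integrable; first exact: segment_compact.
apply: continuous_in_subspaceT => x; rewrite inE /= in_itv /= => xab.
exact: fc.
Qed.

Lemma RI_split f a b c : a <= b -> b <= c -> ctson f a c ->
  RI f a c = RI f a b + RI f b c.
Proof.
move=> ab bc fc; have := @Rintegral_itvB R f (BLeft a) (BRight c) b.
rewrite !bnd_simp => /(_ (ctson_integrable fc) ab bc) H.
rewrite /RI -(Rintegral_itv_obnd_cbnd (r := b)) -?H; first by rewrite addrC subrK.
apply: integrableS (ctson_integrable fc) => //.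
by apply: subset_itv; rewrite bnd_simp.
Qed.

Lemma RI_sub f g a b : ctson f a b -> ctson g a b ->
  RI (fun x => f x - g x) a b = RI f a b - RI g a b.
Proof. by move=> fc gc; apply: RintegralB => //; exact: ctson_integrable. Qed.

Lemma RI_cst k a b : a <= b -> RI (fun=> k) a b = k * (b - a).
Proof.
move=> ab; rewrite /RI Rintegral_cst //= lebesgue_measure_itv /= lte_fin.
case: ltP => [//|ba]; have -> : a = b by apply/eqP; rewrite eq_le ab ba.
by rewrite subrr mulr0.
Qed.

Lemma RI_near f k e a b : a <= b -> ctson f a b ->
  (forall x, a <= x <= b -> `|f x - k| <= e) ->
  `|RI f a b - k * (b - a)| <= e * (b - a).
Proof.
move=> ab fc fk.
have ic (z : R) : mu.-integrable `[a, b] (EFin \o (fun=> z)).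
  by apply: ctson_integrable => x _; exact: cst_continuous.
have lo : RI (fun=> k - e) a b <= RI f a b.
  apply: le_Rintegral => //; first exact: ctson_integrable.
  move=> x; rewrite /= in_itv /= => /fk; rewrite ler_norml => /andP[]; lra.
have hi : RI f a b <= RI (fun=> k + e) a b.
  apply: le_Rintegral => //; first exact: ctson_integrable.
  move=> x; rewrite /= in_itv /= => /fk; rewrite ler_norml => /andP[]; lra.
rewrite !RI_cst // in lo hi; rewrite ler_norml; apply/andP; split.
  by move: lo; rewrite mulrBl; lra.
by move: hi; rewrite mulrDl; lra.
Qed.

Lemma for_continuousP (f : R -> R) x :
  (forall e, 0 < e -> exists2 d, 0 < d & forall t, `|t| < d -> `|f (x + t) - f x| <= e) ->
  {for x, continuous f}.
Proof.
move=> H U /nbhs_ballP[e /= e0 eU]; have [|d d0 dP] := H (e / 2).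
  by rewrite divr_gt0.
apply/nbhs_ballP; exists d => // y; rewrite /ball /= distrC => yx.
apply: eU; rewrite /ball /= distrC; have := dP _ yx; rewrite [x + _]addrC subrK; lra.
Qed.

End SegmentIntegral.

(** * Boundary integrals over rectangles *)

Section Goursat.
Context {R : realType}.
Variables (u v : R -> R -> R).

(* [u + i v] has complex derivative [p + i q] at [s + i y]. *)
Definition CRdiff (s y : R) := exists p q : R, forall e, 0 < e ->
  exists2 d, 0 < d & forall x z, `|x| < d -> `|z| < d ->
   `|u (s + x) (y + z) - u s y - (p * x - q * z)| <= e * (`|x| + `|z|) /\
   `|v (s + x) (y + z) - v s y - (q * x + p * z)| <= e * (`|x| + `|z|).

(* Real part of the integral of (u + i v) dw along the boundary of the rectangle. *)
Definition rect_int (a b c d : R) : R :=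
  (RI (u^~ c) a b - RI (u^~ d) a b) - (RI (v b) c d - RI (v a) c d).

Lemma CRdiff_continuous s y : CRdiff s y ->
  [/\ {for s, continuous (u^~ y)}, {for s, continuous (v^~ y)},
     {for y, continuous (u s)} & {for y, continuous (v s)}].
Proof.
move=> [p [q H]]; have [d d0 dP] := H 1 ltr01.
have bound (x M : R) (e : R) : 0 < e -> 0 <= M -> `|x| < e / (M + 1) -> M * `|x| <= e.
  move=> e0 M0; rewrite ltr_pdivlMr; last lra.
  by have := normr_ge0 x; lra.
have pq : 0 <= `|p| + `|q| + 1 by rewrite !addr_ge0.
split; apply: for_continuousP => e e0; (exists (Num.min d (e / (`|p| + `|q| + 1 + 1))));
  rewrite ?lt_min ?d0 ?divr_gt0 ?ltr_wpDl // => t; rewrite lt_min => /andP[td te0]; have te := bound t _ e e0 pq te0; clear te0.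
- have [+ _] := dP t 0 td ltac:(by rewrite normr0); rewrite addr0 normr0 => H1.
  apply: le_trans te; have -> : u (s + t) y - u s y =
    (u (s + t) y - u s y - (p * t - q * 0)) + p * t by lra.
  apply: le_trans (ler_normD _ _) _; rewrite normrM.
  have := mulr_ge0 (normr_ge0 q) (normr_ge0 t); lra.
- have [_ +] := dP t 0 td ltac:(by rewrite normr0); rewrite addr0 normr0 => H1.
  apply: le_trans te; have -> : v (s + t) y - v s y =
    (v (s + t) y - v s y - (q * t + p * 0)) + q * t by lra.
  apply: le_trans (ler_normD _ _) _; rewrite normrM.
  have := mulr_ge0 (normr_ge0 p) (normr_ge0 t); lra.
- have [+ _] := dP 0 t ltac:(by rewrite normr0) td; rewrite addr0 normr0 => H1.
  apply: le_trans te; have -> : u s (y + t) - u s y =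
    (u s (y + t) - u s y - (p * 0 - q * t)) + - (q * t) by lra.
  apply: le_trans (ler_normD _ _) _; rewrite normrN normrM.
  have := mulr_ge0 (normr_ge0 p) (normr_ge0 t); lra.
- have [_ +] := dP 0 t ltac:(by rewrite normr0) td; rewrite addr0 normr0 => H1.
  apply: le_trans te; have -> : v s (y + t) - v s y =
    (v s (y + t) - v s y - (q * 0 + p * t)) + p * t by lra.
  apply: le_trans (ler_normD _ _) _; rewrite normrM.
  have := mulr_ge0 (normr_ge0 q) (normr_ge0 t); lra.
Qed.

Definition CRon a b c d := forall s y, a <= s <= b -> c <= y <= d -> CRdiff s y.

Lemma CRon_ctson a b c d : CRon a b c d ->
  (forall y, c <= y <= d -> ctson (u^~ y) a b) /\
  (forall s, a <= s <= b -> ctson (v s) c d).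
Proof.
move=> H; split=> [y yc s sa|s sa y yc]; by have [] := CRdiff_continuous (H s y sa yc).
Qed.

Lemma CRon_sub a b c d a' b' c' d' : a <= a' -> b' <= b -> c <= c' -> d' <= d ->
  CRon a b c d -> CRon a' b' c' d'.
Proof.
move=> aa bb cc dd H s y /andP[? ?] /andP[? ?]; apply: H; apply/andP; split; lra.
Qed.

Lemma rect_int_splitl a m b c d : a <= m -> m <= b -> c <= d -> CRon a b c d ->
  rect_int a b c d = rect_int a m c d + rect_int m b c d.
Proof.
move=> am mb cd /CRon_ctson[Hu Hv]; rewrite /rect_int.
rewrite (RI_split am mb) ?(@RI_split _ (u^~ d) a m b) //; last 2 first.
- by apply: Hu; rewrite cd lexx.
- by apply: Hu; rewrite cd lexx.
lra.
Qed.

Lemma rect_int_splitr a b c m d : a <= b -> c <= m -> m <= d -> CRon a b c d ->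
  rect_int a b c d = rect_int a b c m + rect_int a b m d.
Proof.
move=> ab cm md /CRon_ctson[Hu Hv]; rewrite /rect_int.
rewrite (@RI_split _ (v b) c m d) ?(@RI_split _ (v a) c m d) //; last 2 first.
- by apply: Hv; rewrite ab lexx.
- by apply: Hv; rewrite ab lexx.
lra.
Qed.

(** Opposite sides are paired. For the affine part of [u + i v] the two differences are the
    constants [q (d - c)] and [q (b - a)], whose integrals cancel; only the error term
    contributes. *)
Lemma rect_int_local s y e : CRdiff s y -> 0 < e -> exists2 r, 0 < r &
  forall a b c d, CRon a b c d -> a <= s <= b -> c <= y <= d ->
    (b - a) + (d - c) < r ->
    `|rect_int a b c d| <= e * ((b - a) + (d - c)) ^+ 2.
Proof.
move=> [p [q H]] e0; have [|r r0 rP] := H (e / 2); first by rewrite divr_gt0.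
exists r => // a b c d cr /andP[as_ sb] /andP[cy yd] lr.
have [Hu Hv] := CRon_ctson cr.
set l := (b - a) + (d - c) in lr *.
have key s' y' : a <= s' <= b -> c <= y' <= d ->
   `|u s' y' - u s y - (p * (s' - s) - q * (y' - y))| <= e / 2 * l /\
   `|v s' y' - v s y - (q * (s' - s) + p * (y' - y))| <= e / 2 * l.
  move=> /andP[s1 s2] /andP[y1 y2].
  have n1 : `|s' - s| <= b - a by
    clear -as_ sb s1 s2; rewrite ler_norml; apply/andP; split; lra.
  have n2 : `|y' - y| <= d - c by
    clear -cy yd y1 y2; rewrite ler_norml; apply/andP; split; lra.
  have [||] := rP (s' - s) (y' - y); [clear -n1 n2 lr as_ sb cy yd; rewrite /l in lr; lra..|].
  rewrite ![_ + (_ - _)]addrC !subrK => h1 h2.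
  have e2 : 0 <= e / 2 by rewrite divr_ge0 // ltW.
  by split; [apply: le_trans h1 _|apply: le_trans h2 _]; rewrite ler_wpM2l // lerD.
have ab : a <= b by lra.
have cd : c <= d by lra.
have cc : c <= c <= d by rewrite lexx.
have dd : c <= d <= d by rewrite lexx andbT.
have aa : a <= a <= b by rewrite lexx.
have bb : a <= b <= b by rewrite lexx andbT.
have E1 : `|RI (fun x => u x c - u x d) a b - (q * (d - c)) * (b - a)| <= (e * l) * (b - a).
  apply: RI_near => //.
    move=> x xa; apply: continuousB; [exact: (Hu c) | exact: (Hu d)].
  move=> x xa; have [k1 _] := key x c xa cc; have [k2 _] := key x d xa dd.
  move: k1 k2; rewrite !ler_norml => /andP[k1 k2] /andP[k3 k4].
  by clear -k1 k2 k3 k4; apply/andP; split; lra.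
have E2 : `|RI (fun x => v b x - v a x) c d - (q * (b - a)) * (d - c)| <= (e * l) * (d - c).
  apply: RI_near => //.
    move=> x xa; apply: continuousB; [exact: (Hv b) | exact: (Hv a)].
  move=> x xa; have [_ k1] := key b x bb xa; have [_ k2] := key a x aa xa.
  move: k1 k2; rewrite !ler_norml => /andP[k1 k2] /andP[k3 k4].
  by clear -k1 k2 k3 k4; apply/andP; split; lra.
rewrite RI_sub in E1; [|exact: Hu|exact: Hu].
rewrite RI_sub in E2; [|exact: Hv|exact: Hv].
rewrite /rect_int; move: E1 E2; rewrite !ler_norml => /andP[k1 k2] /andP[k3 k4].
have lE : e * l ^+ 2 = e * l * (b - a) + e * l * (d - c).
  by rewrite -mulrDr expr2 mulrA.
by rewrite lE; clear -k1 k2 k3 k4; apply/andP; split; lra.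
Qed.

End Goursat.

Section GoursatTheorem.
Context {R : realType}.

(** The intervals from [x k] to [x k + L / 2^k] are nested, and the supremum of the left ends lies
    in all of them. *)
Lemma nested_halves (L : R) (x : nat -> R) : 0 <= L ->
  (forall k, x k <= x k.+1 <= x k + L * 2^-1 ^+ k.+1) ->
  exists X, forall k, x k <= X <= x k + L * 2^-1 ^+ k.
Proof.
move=> L0 H.
have up k : x k.+1 + L * 2^-1 ^+ k.+1 <= x k + L * 2^-1 ^+ k.
  by have /andP[_] := H k; rewrite exprS; lra.
have lo k m : x k <= x (k + m)%N.
  elim: m => [|m IH]; first by rewrite addn0.
  by rewrite addnS (le_trans IH) //; have /andP[] := H (k + m)%N.
have hi k m : x (k + m)%N + L * 2^-1 ^+ (k + m) <= x k + L * 2^-1 ^+ k.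
  by elim: m => [|m IH]; rewrite ?addn0 // addnS (le_trans (up _)).
have Lk k : 0 <= L * 2^-1 ^+ k by rewrite mulr_ge0 // exprn_ge0.
have ub k m : x m <= x k + L * 2^-1 ^+ k.
  case: (leqP k m) => [/subnKC <-|/ltnW /subnKC <-].
    by apply: le_trans (hi k (m - k)%N); rewrite lerDl.
  by apply: le_trans (lo m (k - m)%N) _; rewrite lerDl.
exists (sup (range x)) => k; apply/andP; split.
  apply: sup_upper_bound; last by exists k.
  by split; [exists (x 0%N), 0%N | exists (x 0%N + L * 2^-1 ^+ 0) => _ [m _ <-]].
by apply: ge_sup => [|_ [m _ <-]]; [exists (x 0%N), 0%N|].
Qed.

Lemma half_small (M e : R) : 0 < e -> exists k, M * 2^-1 ^+ k < e.
Proof.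
move=> e0; have [M0|M0] := leP M 0.
  exists 0%N; rewrite expr0; lra.
have : (fun k => (2^-1 : R) ^+ k) @ \oo --> (0 : R).
  by apply: cvg_expr; rewrite ger0_norm; lra.
move=> /cvgrPdist_lt /(_ (e / M)) /(_ (divr_gt0 e0 M0)) [k _ /(_ k (leqnn k))].
rewrite /= sub0r normrN ger0_norm ?exprn_ge0 // => H.
by exists k; rewrite mulrC -ltr_pdivlMr.
Qed.

Lemma quarter_bound (t a b c d : R) : t + t + t + t <= `|a + b + (c + d)| ->
  [\/ t <= `|a|, t <= `|b|, t <= `|c| | t <= `|d| ].
Proof.
move=> H; have [h1|h1] := leP t `|a|; first by constructor 1.
have [h2|h2] := leP t `|b|; first by constructor 2.
have [h3|h3] := leP t `|c|; first by constructor 3.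
have [h4|h4] := leP t `|d|; first by constructor 4.
exfalso; have := ler_normD (a + b) (c + d); have := ler_normD a b.
by have := ler_normD c d; lra.
Qed.

Lemma goursat (u v : R -> R -> R) a b c d : a <= b -> c <= d ->
  CRon u v a b c d -> rect_int u v a b c d = 0.
Proof.
move=> ab cd cr; apply/eqP; rewrite -normr_eq0; apply/negPn/negP => I0.
set eta := `|_| in I0; have eta0 : 0 < eta by rewrite lt_neqAle eq_sym I0 /eta /=.
set L := b - a; set M := d - c.
have L0 : 0 <= L by rewrite subr_ge0.
have M0 : 0 <= M by rewrite subr_ge0.
pose Rk (k : nat) (z : R * R) := rect_int u v z.1 (z.1 + L * 2^-1 ^+ k)
                                    z.2 (z.2 + M * 2^-1 ^+ k).
(* [z] is the lower left corner of a subrectangle of generation [k] that carries at least its share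
   [eta / 4^k] of the integral. *)
pose bad (k : nat) (z : R * R) := [/\ a <= z.1, z.1 + L * 2^-1 ^+ k <= b,
   c <= z.2, z.2 + M * 2^-1 ^+ k <= d & eta * 4^-1 ^+ k <= `|Rk k z|].
have step (kz : nat * (R * R)) : exists z' : R * R, bad kz.1 kz.2 ->
   [/\ bad kz.1.+1 z', kz.2.1 <= z'.1 <= kz.2.1 + L * 2^-1 ^+ kz.1.+1 &
      kz.2.2 <= z'.2 <= kz.2.2 + M * 2^-1 ^+ kz.1.+1].
  case: kz => k [x y] /=.
  have [B|] := pselect (bad k (x, y)); last by exists (0, 0).
  case: B => /= xa xb yc yd; rewrite /Rk /=.
  set l := L * 2^-1 ^+ k.+1; set m := M * 2^-1 ^+ k.+1.
  have l0 : 0 <= l by rewrite mulr_ge0 // exprn_ge0.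
  have m0 : 0 <= m by rewrite mulr_ge0 // exprn_ge0.
  have lE : L * 2^-1 ^+ k = l + l by rewrite /l exprS; lra.
  have mE : M * 2^-1 ^+ k = m + m by rewrite /m exprS; lra.
  rewrite lE in xb *; rewrite mE in yd *.
  have crs x' y' l' m' : x <= x' -> x' + l' <= x + (l + l) -> y <= y' ->
      y' + m' <= y + (m + m) -> CRon u v x' (x' + l') y' (y' + m').
    move=> h1 h2 h3 h4; apply: CRon_sub cr; [exact: le_trans h1|exact: le_trans xb|
      exact: le_trans h3|exact: le_trans yd].
  have [xx yy] : x <= x + l /\ y <= y + m by rewrite !lerDl.
  have [xx2 yy2] : x + l <= x + (l + l) /\ y + m <= y + (m + m).
    by rewrite !addrA !lerDl.
  have [xx3 yy3] := (le_trans xx xx2, le_trans yy yy2).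
  rewrite (@rect_int_splitl _ _ _ x (x + l)) //; last exact: crs.
  rewrite (@rect_int_splitr _ _ _ x _ y (y + m)) //; last exact: crs.
  have -> : x + (l + l) = (x + l) + l by rewrite addrA.
  have -> : y + (m + m) = (y + m) + m by rewrite addrA.
  rewrite (@rect_int_splitr _ _ _ (x + l) _ y (y + m)) ?lerDl //; last first.
    by have := crs (x + l) y l (m + m); rewrite -!addrA; apply.
  set I1 := rect_int _ _ _ _ _ _; set I2 := rect_int _ _ _ _ _ _.
  set I3 := rect_int _ _ _ _ _ _; set I4 := rect_int _ _ _ _ _ _.
  move=> HI; pose t := eta * 4^-1 ^+ k.+1.
  have tE : eta * 4^-1 ^+ k = t + t + t + t by rewrite /t exprS; lra.
  rewrite tE in HI; rewrite /bad /Rk /= -/l -/m -/t.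
  have {}HI : [\/ t <= `|I1|, t <= `|I2|, t <= `|I3| | t <= `|I4| ].
    exact: quarter_bound.
  have [xl xll ym ymm] : [/\ x + l <= b, x + l + l <= b, y + m <= d & y + m + m <= d].
    by clear -xb yd l0 m0; split; lra.
  have [xal ycm] : a <= x + l /\ c <= y + m by split; [exact: le_trans xx|exact: le_trans yy].
  case: HI => HI; [exists (x, y)|exists (x, y + m)|exists (x + l, y)|exists (x + l, y + m)];
    by move=> _; split=> //=; rewrite ?lexx ?xx ?yy.
have [f fP] := choice step.
pose z := fix z k := if k is k'.+1 then f (k', z k') else (a, c).
have zbad k : bad k (z k).
  elim: k => [|k IH]; last by have [] := fP (k, z k) IH.
  rewrite /bad /Rk /= !expr0 !mulr1 (addrC a) (addrC c) !subrK.
  by split.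
have [X XP] : exists X, forall k, (z k).1 <= X <= (z k).1 + L * 2^-1 ^+ k.
  by apply: nested_halves => // k; have [] := fP (k, z k) (zbad k).
have [Y YP] : exists Y, forall k, (z k).2 <= Y <= (z k).2 + M * 2^-1 ^+ k.
  by apply: nested_halves => // k; have [] := fP (k, z k) (zbad k).
have XYcr : CRdiff u v X Y.
  apply: cr; [have := XP 0%N|have := YP 0%N]; rewrite /= expr0 mulr1.
    by rewrite (addrC a) subrK.
  by rewrite (addrC c) subrK.
have LM0 : 0 <= (L + M) ^+ 2 by rewrite sqr_ge0.
(* With this precision the local bound on a rectangle of generation [k] is below [eta / 4^k], so the
   rectangle is not bad. The [+ 1] covers [L = M = 0]. *)
have e0 : 0 < eta / ((L + M) ^+ 2 + 1) / 2 by rewrite !divr_gt0 // ltr_wpDl.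
have [r r0 rP] := rect_int_local XYcr e0.
have [k kr] := half_small (L + M) r0.
have [z1 z2 z3 z4 z5] := zbad k.
have := rP (z k).1 ((z k).1 + L * 2^-1 ^+ k) (z k).2 ((z k).2 + M * 2^-1 ^+ k).
move=> /(_ (CRon_sub z1 z2 z3 z4 cr) (XP k) (YP k)).
have pqp (p q : R) : p + q - p = q by rewrite addrAC subrr add0r.
rewrite !pqp -mulrDl => /(_ kr) H.
have := le_trans z5 H; rewrite exprMn -exprM mulnC exprM.
have -> : (2^-1 ^+ 2 : R) = 4^-1 by rewrite expr2; lra.
rewrite mulrA; have k0 : 0 < (4^-1 : R) ^+ k by rewrite exprn_gt0.
rewrite ler_pM2r // => {}H.
move: H; rewrite mulrAC ler_pdivlMr // mulrAC ler_pdivlMr; last by rewrite ltr_wpDl.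
by nra.
Qed.

End GoursatTheorem.

Section RealDerivative.
Context {R : realType}.

Lemma is_derive_approx (f : R -> R) (x d : R) : is_derive x 1 f d ->
  forall e, 0 < e -> exists2 r, 0 < r & forall h, `|h| < r ->
    `|f (x + h) - f x - d * h| <= e * `|h|.
Proof.
move=> df e e0; have [dv <-] := df.
have /cvgrPdist_le /(_ _ e0) /= := dv.
rewrite near_withinE near_simpl => /nbhs_ballP[r /= r0 rP].
exists r => // h hr; have [->|h0] := eqVneq h 0.
  by rewrite addr0 subrr sub0r mulr0 normrN normr0 mulr0.
have := rP h; rewrite /ball /= sub0r normrN => /(_ hr h0).
rewrite -['D_1 f x - _]opprK opprB normrN -[h%:A]/(h * 1) mulr1 (addrC h) => H.
have -> : f (x + h) - f x - 'D_1 f x * h =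
  (h^-1 *: (f (x + h) - f x) - 'D_1 f x) * h.
  by rewrite mulrBl -[_ *: _]/(_ * _) [h^-1 * _]mulrC divfK.
by rewrite normrM ler_wpM2r.
Qed.

Lemma approx_is_derive (f : R -> R) (x d : R) :
  (forall e, 0 < e -> exists2 r, 0 < r & forall h, `|h| < r ->
    `|f (x + h) - f x - d * h| <= e * `|h|) -> is_derive x 1 f d.
Proof.
move=> H.
have : h^-1 *: (f (h *: 1 + x) - f x) @[h --> (0:R)^'] --> d.
  apply/cvgrPdist_le => e e0; have [r r0 rP] := H _ e0.
  rewrite near_withinE near_simpl; apply/nbhs_ballP; exists r => //= h.
  rewrite /ball /= sub0r normrN => hr h0; have := rP h hr.
  rewrite -[h%:A]/(h * 1) mulr1 (addrC h) => {}H.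
  have hp : 0 < `|h| by rewrite normr_gt0.
  rewrite -(ler_pM2r hp) -normrM mulrBl -[_ *: _]/(_ * _) [h^-1 * _]mulrC divfK //.
  by rewrite -normrN opprB.
move=> cv; split; first by apply/cvg_ex; exists d.
exact: (cvg_lim (@Rhausdorff R) cv).
Qed.

End RealDerivative.

(** * The complex exponential, and complex differentiability in one variable *)

Section ComplexExp.
Context {R : realType}.
Local Notation C := (Cplx R).

Definition cexp (w : C) : C :=
  Complex (expR (complex.Re w) * cos (complex.Im w))
          (expR (complex.Re w) * sin (complex.Im w)).

Lemma cexpD (w h : C) : cexp (w + h) = cexp w * cexp h.
Proof.
case: w h => a b [c d]; rewrite /cexp /= expRD cosD sinD.
by apply/eqP; rewrite eq_complex /=; apply/andP; split; apply/eqP; ring.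
Qed.

Lemma cexp0 : cexp 0 = 1.
Proof.
by apply/eqP; rewrite /cexp /= expR0 cos0 sin0 eq_complex /= !mul1r !eqxx.
Qed.

Lemma rn_cexp w : rn (cexp w) = expR (complex.Re w).
Proof.
apply/eqP; rewrite -(@eqrXn2 _ 2) ?rn_ge0 ?expR_ge0 //.
by rewrite rn_sqr /= !exprMn -mulrDr cos2Dsin2 mulr1.
Qed.

Lemma cexp_approx e : 0 < e -> exists2 r, 0 < r & forall h : C, rn h < r ->
  rn (cexp h - 1 - h) <= e * rn h.
Proof.
(* The errors below add up to at most [9 k l], with [l] the norm of the argument; [l < k <= 1] keeps
   [expR x] below 3. *)
move=> e0; have [k k0 [k1 ke]] : exists2 k, 0 < k & k <= 1 /\ k <= e / 12.
  exists (Num.min 1 (e / 12)); first by rewrite lt_min ltr01 divr_gt0.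
  by rewrite !ge_min !lexx orbT.
have [r1 r10 P1] := is_derive_approx (is_derive_expR (0 : R)) k0.
have [r2 r20 P2] := is_derive_approx (is_derive_cos (0 : R)) k0.
have [r3 r30 P3] := is_derive_approx (is_derive_sin (0 : R)) k0.
exists (Num.min (Num.min r1 r2) (Num.min r3 k)); first by rewrite !lt_min r10 r20 r30 k0.
move=> [x y]; rewrite !lt_min => /andP[/andP[h1 h2] /andP[h3 h4]].
have := rn_Re (Complex x y : C); have := rn_Im (Complex x y : C) => /=.
set l := rn _ in h1 h2 h3 h4 *; move=> yl xl.
have := P1 x (le_lt_trans xl h1); have := P2 y (le_lt_trans yl h2).
have := P3 y (le_lt_trans yl h3).
rewrite !add0r expR0 cos0 sin0 oppr0 !mul0r !mul1r !subr0 !addr0 => H3 H2 H1.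
have E1 : `|expR x - 1| <= 2 * l.
  have -> : expR x - 1 = (expR x - 1 - x) + x by rewrite subrK.
  apply: le_trans (ler_normD _ _) _.
  have : k * `|x| <= 1 * l by rewrite ler_pM // ltW.
  lra.
have E2 : expR x <= 3.
  by move: E1; rewrite ler_norml => /andP[_]; lra.
have E0 := expR_ge0 x.
have kx : k * `|x| <= k * l by rewrite ler_wpM2l // ltW.
have ky : k * `|y| <= k * l by rewrite ler_wpM2l // ltW.
apply: le_trans (rn_le_ReIm _) _; rewrite /=.
have -> : expR x * cos y - 1 - x = expR x * (cos y - 1) + (expR x - 1 - x) by ring.
have -> : expR x * sin y - 0 - y = expR x * (sin y - y) + (expR x - 1) * y by ring.
have F1 : `|expR x * (cos y - 1)| <= 3 * (k * l).
  by rewrite normrM (ger0_norm E0) ler_pM //; apply: le_trans H2 ky.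
have F2 : `|expR x * (sin y - y)| <= 3 * (k * l).
  by rewrite normrM (ger0_norm E0) ler_pM //; apply: le_trans H3 ky.
have F3 : `|(expR x - 1) * y| <= 2 * (k * l).
  rewrite normrM mulrA ler_pM //; apply: le_trans E1 _.
  by rewrite ler_wpM2l // ltW.
have l0 : 0 <= l by exact: rn_ge0.
have kl : k * l <= e / 12 * l by rewrite ler_wpM2r.
have := ler_normD (expR x * (cos y - 1)) (expR x - 1 - x).
have := ler_normD (expR x * (sin y - y)) ((expR x - 1) * y).
have kl0 : 0 <= k * l by rewrite mulr_ge0 // ltW.
clear -F1 F2 F3 kl H1 kx kl0; lra.
Qed.

Definition mulc (c h : C) : C := h * c.

Lemma mulc_linear (c : C) : linear (mulc c).
Proof.
by move=> a x y; rewrite /mulc mulrDl -[a *: x]/(a * x) -[a *: _]/(a * _) mulrA.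
Qed.

HB.instance Definition _ (c : C) :=
  GRing.isLinear.Build C C C *:%R (mulc c) (mulc_linear c).

Lemma approx_differentiable (g : C -> C) (z d : C) :
  (forall e, 0 < e -> exists2 r, 0 < r & forall h, rn h < r ->
    rn (g (z + h) - g z - h * d) <= e * rn h) -> differentiable g z.
Proof.
move=> H; apply: (@rn_differentiable _ _ _ _ _ (mulc d) (rn d)) => // h.
by rewrite /mulc rnM mulrC.
Qed.

Lemma differentiable_approx (g : C -> C) (z : C) : differentiable g z ->
  exists d : C, forall e, 0 < e -> exists2 r, 0 < r & forall h, rn h < r ->
    rn (g (z + h) - g z - h * d) <= e * rn h.
Proof.
move=> /differentiable_rnP[A [_ H]]; exists (A 1) => e /H[r r0 rP].
exists r => // h /rP; suff -> : A h = h * A 1 by [].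
by rewrite -[h in LHS]mulr1 -[h * 1]/(h *: 1) linearZ.
Qed.

Lemma cexp_differentiable (z : C) : differentiable cexp z.
Proof.
apply: (@approx_differentiable _ _ (cexp z)) => e e0.
have z0 : 0 < rn (cexp z) by rewrite rn_cexp expR_gt0.
have [r r0 rP] := cexp_approx (divr_gt0 e0 z0).
exists r => // h /rP; rewrite cexpD.
have -> : cexp z * cexp h - cexp z - h * cexp z = cexp z * (cexp h - 1 - h) by ring.
rewrite rnM => H; apply: le_trans (ler_wpM2l (ltW z0) H) _.
by rewrite mulrA mulrCA divff ?mulr1 // gt_eqF.
Qed.

Lemma differentiable_CRdiff (H : C -> C) (s y : R) :
  differentiable H (Complex s y : C) ->
  CRdiff (fun s y => complex.Re (H (Complex s y)))
         (fun s y => complex.Im (H (Complex s y))) s y.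
Proof.
move=> /differentiable_approx[d dP]; exists (complex.Re d), (complex.Im d) => e e0.
have [r r0 rP] := dP e e0; exists (r / 2); first by rewrite divr_gt0.
move=> x z xr zr; have := rn_le_ReIm (Complex x z : C) => /= xz.
have hr : rn (Complex x z : C) < r by apply: le_lt_trans xz _; lra.
have HC := rP _ hr.
have -> : Complex (s + x) (y + z) = (Complex s y : C) + Complex x z by [].
have le : rn (H ((Complex s y : C) + Complex x z) - H (Complex s y) - Complex x z * d)
   <= e * (`|x| + `|z|) by apply: le_trans HC _; rewrite ler_wpM2l // ltW.
rewrite [complex.Re d * x]mulrC [complex.Im d * z]mulrC.
rewrite [complex.Im d * x]mulrC [complex.Re d * z]mulrC.
split; apply: le_trans le; [apply: le_trans (rn_Re _)|apply: le_trans (rn_Im _)].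
  by rewrite !cReB cReM.
by rewrite !cImB cImM.
Qed.

End ComplexExp.

(** * Cauchy's estimate *)

Section CauchyEstimate.
Context {R : realType}.
Local Notation C := (Cplx R).

(* The function [k (g (exp w) - g 0) exp (-w)] is holomorphic and 2 pi i-periodic, so
   by Goursat its mean over vertical periods does not depend on [Re w]; compare
   [Re w -> -oo] with [Re w = ln (r / 2)]. *)
Lemma cauchy_estimate (g : C -> C) (r E : R) (d : C) : 0 < r -> 0 <= E ->
  (forall z, rn z < r -> differentiable g z) ->
  (forall z, rn z < r -> rn (g z) <= E) ->
  (forall e, 0 < e -> exists2 t, 0 < t & forall h, rn h < t ->
    rn (g h - g 0 - h * d) <= e * rn h) ->
  rn d <= 4 * E / r.
Proof.
move=> r0 E0 dg gE dP.
(* Vertical sides enter [rect_int] only through the imaginary part, so [k] turns [d] onto the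
   imaginary axis: it is [i] times the conjugate of [d]. *)
have [k rk kd] : exists2 k : C, rn k = rn d & complex.Im (k * d : C) = rn d ^+ 2.
  exists ('i%C * (d : R[i])^*).
    rewrite rnM rn_conj; suff -> : rn ('i%C : C) = 1 by rewrite mul1r.
    by rewrite /rn normc_def /= expr0n add0r expr1n sqrtr1.
  by case: (d) (rn_sqr d) => a b -> /=; ring.
pose H (w : C) : C := k * ((g (cexp w) - g 0) * cexp (- w)).
have Hk w : rn (H w) = rn d * (rn (g (cexp w) - g 0) / expR (complex.Re w)).
  by rewrite !rnM rk rn_cexp; case: w => a b /=; rewrite expRN.
(* The line [Re w = s1] lies over the circle of radius [r / 2], where [|g - g 0| <= 2 E] produces
   the bound [4 E / r]. *)
pose s1 := ln (r / 2).
have es1 : expR s1 = r / 2 by rewrite lnK // posrE divr_gt0.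
have small s y : s <= s1 -> rn (cexp (Complex s y)) < r.
  by move=> ss; rewrite rn_cexp /=; rewrite -ler_expR in ss; lra.
have crH s0 : s0 <= s1 -> CRon (fun s y => complex.Re (H (Complex s y)))
         (fun s y => complex.Im (H (Complex s y))) s0 s1 0 (2 * pi).
  move=> s01 s y /andP[_ ss] _; apply: differentiable_CRdiff.
  apply: differentiableM; first exact: differentiable_cst.
  apply: differentiableM.
    apply: differentiableB => //; apply: differentiable_comp.
      exact: cexp_differentiable.
    by apply: dg; exact: small.
  apply: (@differentiable_comp _ _ _ _ -%R cexp); last exact: cexp_differentiable.
  by apply: (@differentiableN _ _ _ id).
have exP s : cexp (Complex s (2 * pi) : C) = cexp (Complex s 0).
  by rewrite /cexp /= mulr_natl cos2pi sin2pi cos0 sin0.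
have exNP s : cexp (- (Complex s (2 * pi) : C)) = cexp (- (Complex s 0 : C)).
  by rewrite /cexp /= mulr_natl cosN sinN cos2pi sin2pi oppr0 cos0 sin0 ?oppr0.
have pi0 : 0 < 2 * pi :> R by rewrite mulr_gt0 // pi_gt0.
(* The horizontal sides cancel by periodicity, so Goursat equates the two vertical ones. *)
have per s0 : s0 <= s1 ->
  RI (fun y => complex.Im (H (Complex s0 y))) 0 (2 * pi) =
  RI (fun y => complex.Im (H (Complex s1 y))) 0 (2 * pi).
  move=> s01; have := goursat s01 (ltW pi0) (crH _ s01); rewrite /rect_int.
  have -> : (fun s : R => complex.Re (H (Complex s (2 * pi)))) =
            (fun s => complex.Re (H (Complex s 0))).
    by apply/funext => s; rewrite /H exP exNP.
  rewrite [X in X - _]subrr sub0r => /eqP; rewrite oppr_eq0 subr_eq0 => /eqP h.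
  exact: esym h.
have cts s : s <= s1 -> ctson (fun y => complex.Im (H (Complex s y))) 0 (2 * pi).
  by move=> ss; have [_] := CRon_ctson (crH _ ss); apply; rewrite lexx ss.
have B1 : `|RI (fun y => complex.Im (H (Complex s1 y))) 0 (2 * pi)|
    <= rn d * (4 * E / r) * (2 * pi).
  have := @RI_near R (fun y => complex.Im (H (Complex s1 y))) 0 (rn d * (4 * E / r))
    0 (2 * pi) (ltW pi0) (cts s1 (lexx _)).
  rewrite mul0r !subr0; apply => y _; rewrite subr0.
  apply: le_trans (rn_Im _) _; rewrite Hk /= es1 ler_wpM2l ?rn_ge0 //.
  rewrite invf_div mulrA ler_pM2r ?invr_gt0 //.
  have := rnB (g (cexp (Complex s1 y))) (g 0).
  have := gE _ (small s1 y (lexx _)); have := gE 0; rewrite rn0 => /(_ r0).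
  lra.
(* Far to the left [H] is within [|d| e] of [k d], whose imaginary part is [|d|^2]. Dividing by
   [|d|] at the end leaves the estimate up to [e]. *)
have B2 e : 0 < e -> rn d ^+ 2 <= rn d * (4 * E / r + e).
  move=> e0; have [t t0 tP] := dP e e0.
  pose s0 := Num.min s1 (ln (t / 2)).
  have s01 : s0 <= s1 by rewrite ge_min lexx.
  have et : expR s0 < t.
    have : s0 <= ln (t / 2) by rewrite ge_min lexx orbT.
    by rewrite -ler_expR lnK ?posrE ?divr_gt0 //; lra.
  have : `|RI (fun y => complex.Im (H (Complex s0 y))) 0 (2 * pi) - rn d ^+ 2 * (2 * pi - 0)|
      <= (rn d * e) * (2 * pi - 0).
    apply: RI_near; [exact: ltW|exact: cts|] => y _.
    rewrite -kd -cImB; apply: le_trans (rn_Im _) _.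
    have z0 := expR_gt0 s0.
    have -> : H (Complex s0 y) - k * d = k *
      ((g (cexp (Complex s0 y)) - g 0 - cexp (Complex s0 y) * d) * cexp (- (Complex s0 y : C))).
      have xx : cexp (Complex s0 y : C) * cexp (- (Complex s0 y : C)) = 1.
        by rewrite -cexpD subrr cexp0.
      rewrite /H -mulrBr; congr (_ * _).
      move: xx; set p := cexp (Complex s0 y); set q := cexp (- _); set a := g p - g 0.
      move=> pq.
      have -> : (a - p * d) * q = a * q - d * (p * q) by ring.
      by rewrite pq mulr1.
    rewrite !rnM rk rn_cexp /= expRN ler_wpM2l ?rn_ge0 // ler_pdivrMr //.
    have := tP (cexp (Complex s0 y)); rewrite rn_cexp /=; exact.
  rewrite (per _ s01) subr0; move: B1; set J := RI _ _ _.
  rewrite !ler_norml => /andP[_ j1] /andP[j2 _].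
  rewrite -(ler_pM2r pi0); lra.
have [->|d0] := eqVneq d 0; first by rewrite rn0 divr_ge0 ?mulr_ge0 // ltW.
apply/ler_addgt0Pr => e e0; rewrite -(ler_pM2l (rn_gt0 d0)) -expr2.
exact: B2.
Qed.

(** Around each point of the segment from [x] to [y], [f] restricted to the complex line of
    direction [w = y - x] is holomorphic on a disc of radius [r / (2 |w|)], so Cauchy bounds its
    derivative by [8 E |w| / r]. The mean value theorem is real-valued, hence is applied to
    [Re (k f)] with [k] the conjugate of [f y - f x]. *)
Lemma holomorphic_lipschitz (V : normedModType C) (f : V -> C) (x0 : V) (r E : R) :
  0 < r -> 0 <= E ->
  (forall x, rn (x - x0) < r -> differentiable f x) ->
  (forall x, rn (x - x0) < r -> rn (f x) <= E) ->
  forall x y, rn (x - x0) < r / 2 -> rn (y - x0) < r / 2 ->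
  rn (f y - f x) <= 8 * E / r * rn (y - x).
Proof.
move=> r0 E0 df fE x y xr yr.
have [->|xy] := eqVneq x y; first by rewrite !subrr !rn0 mulr0.
set w := y - x; have w0 : 0 < rn w by rewrite rn_gt0 // subr_eq0 eq_sym.
set D := f y - f x.
have [D0|D0] := eqVneq D 0; first by rewrite D0 rn0 !mulr_ge0 ?invr_ge0 ?rn_ge0 // ltW.
pose z (t : R) : V := x + (t%:C%C : C) *: w.
have zr t : 0 <= t <= 1 -> rn (z t - x0) < r / 2.
  move=> /andP[t0 t1].
  have -> : z t - x0 = ((1 - t)%:C%C : C) *: (x - x0) + (t%:C%C : C) *: (y - x0).
    have -> : z t - x0 = (x - x0) + (t%:C%C : C) *: w by rewrite /z addrAC.
    have -> : w = (y - x0) - (x - x0) by rewrite opprB addrA subrK.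
    by rewrite rmorphB rmorph1 scalerBl scale1r scalerBr addrA addrAC.
  apply: le_lt_trans (rnD _ _) _; rewrite !rnZ !rn_real !ger0_norm ?subr_ge0 //.
  have [->|t0'] := eqVneq t 0; first by rewrite subr0 mul1r mul0r addr0.
  have tp : 0 < t by rewrite lt_neqAle eq_sym t0'.
  have := ler_wpM2l (_ : 0 <= 1 - t) (ltW xr); rewrite subr_ge0 => /(_ t1).
  have := yr; rewrite -(ltr_pM2l tp); lra.
have der t : 0 <= t <= 1 -> exists2 c : C, rn c <= 8 * E / r * rn w &
   forall e, 0 < e -> exists2 l, 0 < l & forall h : C, rn h < l ->
     rn (f (z t + h *: w) - f (z t) - h * c) <= e * rn h.
  move=> t01; have zt := zr t t01.
  have [A [[ka ka0 Ak] AP]] : exists A : {linear V -> C}, _ :=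
    differentiable_rnP (df (z t) ltac:(lra)).
  have cP e : 0 < e -> exists2 l, 0 < l & forall h : C, rn h < l ->
     rn (f (z t + h *: w) - f (z t) - h * A w) <= e * rn h.
    move=> e0; have [l l0 lP] := AP (e / rn w) (divr_gt0 e0 w0).
    exists (l / rn w); first exact: divr_gt0.
    move=> h; rewrite ltr_pdivlMr // -rnZ => /lP.
    have -> : h * A w = A (h *: w) by rewrite linearZ.
    move=> H; apply: le_trans H _.
    by rewrite rnZ [rn h * _]mulrC mulrA divfK ?gt_eqF.
  exists (A w) => //.
  have -> : 8 * E / r * rn w = 4 * E / (r / 2 / rn w).
    by rewrite !invf_div; field; rewrite gt_eqF.
  have inside (h : C) : rn h < r / 2 / rn w -> rn (z t + h *: w - x0) < r.
    rewrite ltr_pdivlMr // -rnZ => hr; rewrite addrAC.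
    apply: le_lt_trans (rnD _ _) _; lra.
  apply: (@cauchy_estimate (fun h => f (z t + h *: w))) => //.
  - by rewrite !divr_gt0.
  - move=> h hr; change (differentiable (f \o (fun h : C => z t + h *: w)) h).
    apply: differentiable_comp; last by apply: df; exact: inside.
    by apply: differentiableD; [exact: differentiable_cst|exact: differentiableZl].
  - by move=> h hr; apply: fE; exact: inside.
  - by move=> e /cP[l l0 lP]; exists l => // h /lP; rewrite scale0r addr0.
have [k kD kDD] : exists2 k : C, rn k = rn D & complex.Re (k * D : C) = rn D ^+ 2.
  exists (D : R[i])^*; first exact: rn_conj.
  by case: (D) (rn_sqr D) => a b -> /=; ring.
pose phi t := complex.Re (k * f (z t)).
have /choice[c cP] (t : R) : exists c : C, 0 <= t <= 1 ->
  rn c <= 8 * E / r * rn w /\ is_derive t 1 phi (complex.Re (k * c)).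
  have [t01|] := boolP (0 <= t <= 1); last by exists 0.
  have [c c1 c2] := der t t01; exists c => _; split => //.
  apply: approx_is_derive => e e0; have kD0 : 0 < rn k by rewrite kD rn_gt0.
  have [l l0 lP] := c2 (e / rn k) (divr_gt0 e0 kD0); exists l => // h hl.
  have := lP (h%:C%C : C); rewrite rn_real => /(_ hl) H.
  have -> : complex.Re (k * c) * h = complex.Re (k * ((h%:C%C : C) * c)).
    by case: (k) (c) => ? ? [? ?] /=; ring.
  rewrite /phi -!cReB -!mulrBr; apply: le_trans (rn_Re _) _; rewrite rnM.
  have -> : z (t + h) = z t + (h%:C%C : C) *: w.
    by rewrite /z rmorphD /= scalerDl addrA.
  by rewrite -ler_pdivlMl // mulrA [_^-1 * e]mulrC.
have [|||t t01 tE] := @MVT _ phi (fun t => complex.Re (k * c t)) 0 1.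
- exact: ltr01.
- by move=> t; rewrite in_itv /= => /andP[/ltW ? /ltW ?]; apply: (cP t _).2; apply/andP.
- apply: continuous_in_subspaceT => t; rewrite inE /= in_itv /= => t01.
  have [_ [dv _]] := cP t t01.
  by apply: differentiable_continuous; apply/derivable1_diffP.
have [cE _] := cP t ltac:(by move: t01; rewrite in_itv /= => /andP[/ltW -> /ltW ->]).
have DD : phi 1 - phi 0 = rn D ^+ 2.
  rewrite /phi -cReB -mulrBr /z rmorph0 rmorph1 scale0r addr0 scale1r.
  have -> : x + w = y by rewrite /w addrC subrK.
  by rewrite -/D.
have : rn D ^+ 2 <= rn D * rn (c t).
  rewrite -DD tE subr0 mulr1 -kD -rnM; exact: le_trans (ler_norm _) (rn_Re _).
by rewrite expr2 ler_pM2l ?rn_gt0 // => /le_trans; apply.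
Qed.

End CauchyEstimate.

(** * Charts and evaluation of automorphisms *)

Section ComplexSpace.
Context {R : realType}.
Local Notation C := (Cplx R).

Lemma holomorphic_lipschitz_rV (V : normedModType C) m (f : V -> 'rV[C]_m) (x0 : V)
    (r E : R) : 0 < r -> 0 <= E ->
  (forall x, rn (x - x0) < r -> differentiable f x) ->
  (forall x, rn (x - x0) < r -> rn (f x) <= E) ->
  forall x y, rn (x - x0) < r / 2 -> rn (y - x0) < r / 2 ->
  rn (f y - f x) <= 8 * E / r * rn (y - x).
Proof.
move=> r0 E0 df fE x y xr yr; apply/rn_rV_le => [|i].
  by rewrite !mulr_ge0 ?invr_ge0 ?rn_ge0 // ltW.
rewrite !mxE; apply: (@holomorphic_lipschitz _ _ (fun x => f x ord0 i) x0) => //.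
- move=> z zr; change (differentiable ((fun v : 'rV[C]_m => v ord0 i) \o f) z).
  by apply: differentiable_comp; [exact: df|exact: differentiable_coord].
- by move=> z zr; apply: le_trans (rn_coord _ _) (fE _ zr).
Qed.

Lemma rn_continuous (V : normedModType C) : continuous (rn : V -> R).
Proof.
move=> v U /nbhs_ballP[e /= e0 eU]; apply/nbhs_rnP; exists e => // w wv.
apply: eU; rewrite /ball /= ltr_norml; apply/andP; split.
  by have := rn_dist w v; lra.
by have := rn_dist v w; rewrite rn_sub; lra.
Qed.

Lemma complex_continuous : continuous (fun p : R * R => Complex p.1 p.2 : C).
Proof.
move=> [a b] U /nbhs_rnP[e e0 eU]; exists (ball a (e / 2), ball b (e / 2)).
  by split; apply: nbhsx_ballx; rewrite divr_gt0.
move=> [c d] /= [ac bd]; apply: eU; apply: le_lt_trans (rn_le_ReIm _) _.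
by move: ac bd; rewrite /ball /= (distrC c) (distrC d); lra.
Qed.

Lemma closed_ball_compact n (z0 : 'rV[C]_n) (r : R) :
  compact [set z | rn (z - z0) <= r].
Proof.
pose M := rn z0 + r.
pose B : set C := (fun p : R * R => Complex p.1 p.2 : C) @` (`[- M, M] `*` `[- M, M]).
have Bc : compact B.
  apply: continuous_compact; first exact/continuous_subspaceT/complex_continuous.
  by apply: compact_setX; exact: segment_compact.
apply: (subclosed_compact _ (@rV_compact C n (fun=> B) (fun=> Bc))).
  apply: (@preimage_closed _ _ (fun z : 'rV[C]_n => rn (z - z0)) [set x : R | x <= r]);
    last exact: closed_le.
  move=> z _; change (continuous_at z ((@rn R 'rV[C]_n) \o (fun z => z - z0))).
  apply: continuous_comp; last exact: rn_continuous.
  by apply: continuousB; [exact: id|exact: cst_continuous].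
move=> z /= zr i; have zM : rn (z ord0 i) <= M.
  apply: le_trans (rn_coord _ _) _; have := rn_dist z z0; rewrite /M; lra.
exists (complex.Re (z ord0 i), complex.Im (z ord0 i)); last by case: (z ord0 i).
split; rewrite /= in_itv /= -ler_norml; apply: le_trans zM; [exact: rn_Re|exact: rn_Im].
Qed.

End ComplexSpace.

Section Manifold.
Context {R : realType} {n : nat} (M : complexManifold R n).
Local Notation C := (Cplx R).

Lemma chart_ball (c : chart R n M) p : chart_dom c p ->
  exists2 r : R, 0 < r & forall z, rn (z - chart_to c p) <= r -> chart_cod c z.
Proof.
move=> cp; have : nbhs (chart_to c p) (chart_cod c).
  by apply: open_nbhs_nbhs; split; [exact: chart_open_cod|exact: chart_to_cod].
move=> /nbhs_rnP[e e0 eU]; exists (e / 2); first by rewrite divr_gt0.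
by move=> z zr; apply: eU; lra.
Qed.

Lemma chart_nbhs (c : chart R n M) p (U : set M) : chart_dom c p ->
  nbhs p U <-> exists2 e : R, 0 < e & forall z, rn (z - chart_to c p) < e ->
    chart_cod c z /\ U (chart_from c z).
Proof.
move=> cp; have cod : nbhs (chart_to c p) (chart_cod c).
  by apply: open_nbhs_nbhs; split; [exact: chart_open_cod|exact: chart_to_cod].
split=> [pU|[e e0 eU]].
  have := @chart_from_cts _ _ _ c _ (chart_to_cod cp) U.
  rewrite /= chart_toK // => /(_ pU) /(filterI cod) /nbhs_rnP[e e0 eU].
  by exists e => // z /eU.
have : nbhs p (chart_dom c).
  by apply: open_nbhs_nbhs; split; [exact: chart_open_dom|].
have : nbhs p (chart_to c @^-1` [set z | rn (z - chart_to c p) < e]).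
  by apply: (@chart_to_cts _ _ _ c p cp); apply/nbhs_rnP; exists e.
apply: filterS2 => q /eU[_ Uq] qd; by rewrite chart_toK in Uq.
Qed.

(** Local compactness is what turns continuity into the compact-open topology into joint continuity
    of evaluation. *)
Lemma manifold_locally_compact : locally_compact [set: M].
Proof.
move=> p _; have [c Ac cp] := cm_cover p; have [r r0 rP] := chart_ball cp.
pose K := [set z | rn (z - chart_to c p) <= r].
have Kc : compact (chart_from c @` K).
  apply: continuous_compact; last exact: closed_ball_compact.
  apply: continuous_in_subspaceT => z; rewrite inE => /rP zc.
  exact: chart_from_cts.
exists (chart_from c @` K); last by split; [|exact: compact_closed (@cm_hausdorff _ _ M) Kc].
rewrite withinET; apply/(chart_nbhs _ cp); exists r => // z zr.
by split; [apply: rP; exact: ltW|exists z => //; exact: ltW].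
Qed.

Lemma Aut_eval_continuous (X : topologicalType) (g : X -> Aut M) : continuous g ->
  continuous (fun xp : X * M => Aut_fun (g xp.1) xp.2).
Proof.
move=> gc; rewrite (_ : (fun _ => _) = uncurry (fun x => Aut_fun (g x))); last first.
  by apply/funext => -[].
apply: (@continuous_uncurry X M M (fun x => Aut_fun (g x))).
- exact: manifold_locally_compact.
- exact: cm_hausdorff.
- move=> x; apply: (@continuous_comp X (Aut M) {compact-open, M -> M} g set_val).
    exact: gc.
  exact: initial_continuous.
- by move=> x; have [[]] := Aut_funP (g x).
Qed.

End Manifold.

(** * Almost additive curves *)

Lemma half_gt0 (R : realType) (e : R) : 0 < e -> 0 < e / 2.
Proof. by move=> e0; rewrite divr_gt0. Qed.

Section ApproximatelyAdditive.
Context {R : realType}.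
Local Notation C := (Cplx R).

Lemma real_right_limit (phi : R -> R) :
  (forall e, 0 < e -> exists a, exists2 d, 0 < d &
     forall t, 0 < t < d -> `|phi t - a| <= e) ->
  exists l, forall e, 0 < e -> exists2 d, 0 < d &
     forall t, 0 < t < d -> `|phi t - l| <= e.
Proof.
move=> H; have cv : cvg (phi @ 0^'+).
  apply/cauchy_cvgP/cauchy_exP => e e0; have [a [d d0 dP]] := H (e / 2) (half_gt0 e0).
  exists a; suff : \forall t \near 0^'+, ball a e (phi t) by [].
  near=> t; rewrite /ball /= distrC.
  suff : `|phi t - a| <= e / 2 by lra.
  apply: dP; apply/andP; split; near: t; first exact: nbhs_right_gt.
  exact: nbhs_right_lt.
exists (lim (phi @ 0^'+)) => e e0.
have /cvgrPdist_le /(_ e e0) : phi t @[t --> 0^'+] --> lim (phi @ 0^'+) by [].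
rewrite near_withinE near_simpl => /nbhs_ballP[d /= d0 dP]; exists d => // t /andP[t0 td].
by rewrite distrC; apply: dP => //; rewrite /ball /= sub0r normrN gtr0_norm.
Unshelve. all: by end_near. Qed.

Lemma rV_right_limit n (q : R -> 'rV[C]_n) :
  (forall e, 0 < e -> exists a, exists2 d, 0 < d &
     forall t, 0 < t < d -> rn (q t - a) <= e) ->
  exists l, forall e, 0 < e -> exists2 d, 0 < d &
     forall t, 0 < t < d -> rn (q t - l) <= e.
Proof.
move=> H.
have /choice[l lP] (j : 'I_n) : exists l : C, forall e, 0 < e -> exists2 d, 0 < d &
     forall t, 0 < t < d -> rn (q t ord0 j - l) <= e.
  have [a aP] : exists l, forall e, 0 < e -> exists2 d, 0 < d &
     forall t, 0 < t < d -> `|complex.Re (q t ord0 j) - l| <= e.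
    apply: real_right_limit => e /H[a [d d0 dP]].
    exists (complex.Re (a ord0 j)), d => // t /dP; apply: le_trans.
    by rewrite -cReB; apply: le_trans (rn_Re _) _; have := rn_coord (q t - a) j; rewrite !mxE.
  have [b bP] : exists l, forall e, 0 < e -> exists2 d, 0 < d &
     forall t, 0 < t < d -> `|complex.Im (q t ord0 j) - l| <= e.
    apply: real_right_limit => e /H[b [d d0 dP]].
    exists (complex.Im (b ord0 j)), d => // t /dP; apply: le_trans.
    by rewrite -cImB; apply: le_trans (rn_Im _) _; have := rn_coord (q t - b) j; rewrite !mxE.
  exists (Complex a b : C) => e e0.
  have [d1 d10 P1] := aP (e / 2) (half_gt0 e0).
  have [d2 d20 P2] := bP (e / 2) (half_gt0 e0).
  exists (Num.min d1 d2); first by rewrite lt_min d10.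
  move=> t; rewrite lt_min => /and3P[t0 t1 t2].
  apply: le_trans (rn_le_ReIm _) _; rewrite cReB cImB /=.
  have := P1 t; have := P2 t; rewrite t0 t1 t2 => /(_ isT) + /(_ isT); lra.
exists (\row_j l j) => e e0; have e3 : 0 < e / 3 by rewrite divr_gt0.
have [a [d d0 dP]] := H _ e3; exists d => // t td.
have la : rn (a - \row_j l j) <= 2 * (e / 3).
  apply/rn_rV_le => [|j]; first by lra.
  have [d' d'0 dP'] := lP j _ e3; pose s := Num.min d d' / 2.
  have s0 : 0 < s by rewrite divr_gt0 // lt_min d0.
  have sm : s < Num.min d d' by rewrite /s; move: s0; rewrite /s; lra.
  move: sm; rewrite lt_min => /andP[sd sd'].
  have := dP s; rewrite s0 sd => /(_ isT) /(le_trans (rn_coord _ j)).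
  have := dP' s; rewrite s0 sd' => /(_ isT); rewrite !mxE => h1 h2.
  have -> : a ord0 j - l j = (q s ord0 j - l j) - (q s ord0 j - a ord0 j) by ring.
  by apply: le_trans (rnB _ _) _; lra.
rewrite -(subrKA a); apply: le_trans (rnD _ _) _; have := dP t td; lra.
Qed.

(** [L t] stands for the displacement, read in a chart, of a point at time [t] of a one-parameter
    group. [L_add] is what the group law becomes there: the error is relative to the second
    displacement. *)
Variables (n : nat) (L : R -> 'rV[C]_n).
Hypothesis L0 : L 0 = 0.
Hypothesis L_small : forall e, 0 < e ->
  exists2 d, 0 < d & forall t, `|t| < d -> rn (L t) <= e.
Hypothesis L_add : forall eta, 0 < eta -> exists2 d, 0 < d &
  forall s t, `|s| < d -> `|t| < d -> rn (L (s + t) - L s - L t) <= eta * rn (L t).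

Let real_scale (a : R) (v : 'rV[C]_n) := (a%:C%C : C) *: v.

Let rn_real_scale a v : rn (real_scale a v) = `|a| * rn v.
Proof. by rewrite rnZ rn_real. Qed.

Lemma approx_multiple eta d (N : nat) t : 0 < eta ->
  (forall s t, `|s| < d -> `|t| < d -> rn (L (s + t) - L s - L t) <= eta * rn (L t)) ->
  0 < t -> N%:R * t < d -> rn (L (N%:R * t) - real_scale N%:R (L t)) <= N%:R * (eta * rn (L t)).
Proof.
move=> eta0 H t0; elim: N => [|N IH] Nd.
  by rewrite !mul0r L0 /real_scale rmorph0 scale0r subrr rn0.
rewrite -natr1 in Nd *; rewrite !mulrDl !mul1r in Nd *.
have N0 : 0 <= N%:R * t by rewrite mulr_ge0 // ltW.
have := IH ltac:(lra); have := H (N%:R * t) t; rewrite (ger0_norm N0) (gtr0_norm t0).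
move=> /(_ ltac:(lra) ltac:(lra)) h1 h2.
have -> : L (N%:R * t + t) - real_scale (N%:R + 1) (L t) =
  (L (N%:R * t + t) - L (N%:R * t) - L t) + (L (N%:R * t) - real_scale N%:R (L t)).
  by apply/rowP => j; rewrite /real_scale rmorphD rmorph1 !mxE; ring.
apply: le_trans (rnD _ _) _; lra.
Qed.

(* Compares [L e] with [N L t] for the largest multiple [N t] of [t] below [e]. *)
Lemma approx_fill eta d e t : 0 < eta ->
  (forall s t, `|s| < d -> `|t| < d -> rn (L (s + t) - L s - L t) <= eta * rn (L t)) ->
  0 < t -> t < e -> e < d -> exists N : nat, exists2 u, 0 <= u < t &
    e = N%:R * t + u /\
    rn (L e - real_scale N%:R (L t)) <= N%:R * (eta * rn (L t)) + (1 + eta) * rn (L u).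
Proof.
move=> eta0 H t0 te ed; have et0 : 0 <= e / t by rewrite divr_ge0 // ltW // (lt_trans t0).
have := truncn_itv et0; set N := Num.truncn _; rewrite ler_pdivlMr // ltr_pdivrMr //.
rewrite -natr1 mulrDl mul1r => /andP[N1 N2].
exists N, (e - N%:R * t); first by apply/andP; split; lra.
have N0 : 0 <= N%:R * t by rewrite mulr_ge0 // ltW.
split; first by rewrite addrC subrK.
have h1 := @approx_multiple eta d N t eta0 H t0 ltac:(lra).
have := H (N%:R * t) (e - N%:R * t); rewrite !ger0_norm ?subr_ge0 //.
move=> /(_ ltac:(lra) ltac:(lra)); rewrite [_ + (e - _)]addrC subrK => h2.
have -> : L e - real_scale N%:R (L t) = (L e - L (N%:R * t) - L (e - N%:R * t)) +
   L (e - N%:R * t) + (L (N%:R * t) - real_scale N%:R (L t)) by rewrite subrK addrA subrK.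
apply: le_trans (rnD _ _) _; have := rnD (L e - L (N%:R * t) - L (e - N%:R * t)) (L (e - N%:R * t)).
clear -h1 h2; lra.
Qed.

(** With [eta = 1/2] half of [N |L t|] is absorbed, so [N |L t|] is at most a constant, while
    [N t >= e / 2] makes [1 / N] comparable to [t]. *)
Lemma approx_additive_lipschitz : exists K, exists2 d, 0 < d &
  forall t, 0 <= t < d -> rn (L t) <= K * t.
Proof.
have [d d0 dP] := L_add (eta := 1 / 2) ltac:(lra).
have [d1 d10 dP1] := L_small (e := 1) ltac:(lra).
pose e := d / 2; have e0 : 0 < e by rewrite divr_gt0.
have ed : e < d by rewrite /e; lra.
exists (4 * (rn (L e) + 2) / e), (Num.min d1 (e / 2)); first by rewrite lt_min d10 divr_gt0.
move=> t; rewrite lt_min => /and3P[t0 td1 te].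
have [->|t0'] := eqVneq t 0; first by rewrite L0 rn0 mulr0.
have tp : 0 < t by rewrite lt_neqAle eq_sym t0'.
have [N [u /andP[u0 ut] [eE eL]]] := @approx_fill (1 / 2) d e t ltac:(lra) dP tp ltac:(lra) ed.
have Lu : rn (L u) <= 1 by apply: dP1; rewrite ger0_norm //; lra.
have NL : rn (real_scale N%:R (L t)) <= rn (L e) + rn (L e - real_scale N%:R (L t)).
  have := rn_dist (real_scale N%:R (L t)) (L e); rewrite rn_sub; clear; lra.
rewrite rn_real_scale ger0_norm // in NL.
have l0 := rn_ge0 (L t).
rewrite mulrAC ler_pdivlMr //.
have : N%:R * rn (L t) <= 2 * (rn (L e) + 2) by clear -NL eL Lu l0; lra.
have : e <= 2 * (N%:R * t) by clear -eE ut te; lra.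
move=> h1 h2; have h3 : rn (L t) * e <= rn (L t) * (2 * (N%:R * t)) by rewrite ler_wpM2l.
have h4 : t * (N%:R * rn (L t)) <= t * (2 * (rn (L e) + 2)) by rewrite ler_wpM2l.
clear -h3 h4; lra.
Qed.

(** Fix a small [s]. For [t] much smaller, writing [s = N t + u] compares [L t / t] with [L s / s],
    so the difference quotients satisfy the Cauchy criterion as [t] tends to 0 from the right. *)
Lemma approx_additive_derivable : exists v, forall e, 0 < e -> exists2 d, 0 < d &
  forall t, `|t| < d -> rn (L t - (t%:C%C : C) *: v) <= e * `|t|.
Proof.
have [K [d0 d00 KP]] := approx_additive_lipschitz.
have K0 : 0 <= K.
  have := KP (d0 / 2) ltac:(lra); have := rn_ge0 (L (d0 / 2)) => h1 h2.
  have {h1 h2} : 0 <= K * (d0 / 2) by lra.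
  by rewrite pmulr_lge0 // divr_gt0.
have K1 : 0 < K + 1 by lra.
have [v vP] : exists l, forall e, 0 < e -> exists2 d, 0 < d &
     forall t, 0 < t < d -> rn (real_scale t^-1 (L t) - l) <= e.
  apply: rV_right_limit => e e0; have [eta eta0 [eta1 etae]] :
      exists2 eta, 0 < eta & eta <= 1 /\ 2 * (K + 1) * eta <= e.
    exists (Num.min 1 (e / (2 * (K + 1)))).
      by rewrite lt_min ltr01 divr_gt0 // mulr_gt0.
    split; first by rewrite ge_min lexx.
    by rewrite mulrC -ler_pdivlMr ?mulr_gt0 // ge_min lexx orbT.
  have [d dd dP] := L_add eta0.
  have [s s0 [sd0 sd]] : exists2 s, 0 < s & s < d0 /\ s < d.
    have m0 : 0 < Num.min d0 d by rewrite lt_min d00.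
    exists (Num.min d0 d / 2); first exact: half_gt0.
    by apply/andP; rewrite -lt_min; lra.
  (* The remainder contributes three terms of size [K t], together at most [eta K s] for
     [t <= eta s / 3]. *)
  exists (real_scale s^-1 (L s)), (Num.min s (eta * s / 3)).
    by rewrite lt_min s0 !divr_gt0 ?mulr_gt0.
  move=> t; rewrite lt_min => /and3P[t0 ts tet].
  have [N [u /andP[u0 ut] [sE sL]]] := approx_fill eta0 dP t0 ts sd.
  have Lu : rn (L u) <= K * t.
    have := KP u ltac:(lra) => /le_trans; apply; rewrite ler_wpM2l //; exact: ltW.
  have Lt : rn (L t) <= K * t by apply: KP; lra.
  have Kt : 0 <= K * t by rewrite mulr_ge0 // ltW.
  have tN : t != 0 by rewrite gt_eqF.
  have sN : s != 0 by rewrite gt_eqF.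
  rewrite -(ler_pM2l s0) -{1}(gtr0_norm s0) -rn_real_scale.
  have -> : real_scale s (real_scale t^-1 (L t) - real_scale s^-1 (L s)) =
     real_scale (u / t) (L t) - (L s - real_scale N%:R (L t)).
    rewrite /real_scale scalerBr !scalerA -!rmorphM mulfV // rmorph1 scale1r.
    rewrite opprB addrA -scalerDl -rmorphD.
    by congr (_%:C%C *: _ - _); rewrite {1}sE mulrDl -mulrA mulfV // mulr1 addrC.
  apply: le_trans (rnB _ _) _; rewrite rn_real_scale ger0_norm ?divr_ge0 // ?ltW //.
  have ul : u / t * rn (L t) <= 1 * (K * t).
    rewrite ler_pM ?rn_ge0 //; first by rewrite divr_ge0 // ltW.
    by rewrite ler_pdivrMr // mul1r ltW.
  have Nb : N%:R * (eta * rn (L t)) <= eta * K * s.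
    have -> : N%:R * (eta * rn (L t)) = eta * (N%:R * rn (L t)) by ring.
    rewrite -mulrA ler_wpM2l //; first exact: ltW.
    have : N%:R * rn (L t) <= N%:R * (K * t) by rewrite ler_wpM2l.
    move=> /le_trans; apply; have -> : N%:R * (K * t) = K * (N%:R * t) by ring.
    by rewrite ler_wpM2l // sE lerDl.
  have ub : (1 + eta) * rn (L u) <= 2 * (K * t).
    have eta2 : 0 <= 1 + eta by rewrite addr_ge0 // ltW.
    by rewrite ler_pM ?rn_ge0 // -[2]/(1 + 1) lerD2l.
  have Kts : K * t <= K * (eta * s / 3) by rewrite ler_wpM2l // ltW.
  have se : s * (2 * (K + 1) * eta) <= s * e by rewrite ler_wpM2l // ltW.
  have es : 0 < eta * s by rewrite mulr_gt0.
  clear -sL ul Nb ub Kts se es; lra.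
exists v => e e0.
have [d1 d10 P1] := vP (e / 2) (half_gt0 e0).
have [d2 d20 P2] := L_add (divr_gt0 (half_gt0 e0) K1).
exists (Num.min d0 (Num.min d1 d2)); first by rewrite !lt_min d00 d10.
have pos t : 0 < t < d1 -> rn (L t - real_scale t v) <= e / 2 * t.
  move=> /[dup] /P1 h /andP[t0 _]; rewrite mulrC -ler_pdivrMl //.
  rewrite -{1}(gtr0_norm (_ : 0 < t^-1)) ?invr_gt0 // -rn_real_scale.
  rewrite /real_scale scalerBr !scalerA -rmorphM mulVf ?gt_eqF // rmorph1 scale1r.
  exact: h.
move=> t; rewrite !lt_min => /and3P[td0 td1 td2].
have [t0|t0|<-] := ltgtP 0 t; last first.
- by rewrite L0 rmorph0 scale0r subrr rn0 normr0 mulr0.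
(* Since [L 0 = 0], almost additivity puts [L t] close to [- L (- t)], which reduces to positive
   times. *)
- rewrite ltr0_norm // in td0 td1 td2 *; set s := - t in td0 td1 td2 *.
  have tE : t = - s by rewrite opprK.
  have s0 : 0 < s by rewrite oppr_gt0.
  have := P2 t s; rewrite ltr0_norm // gtr0_norm // => /(_ td2 td2).
  rewrite {1}tE addNr L0 sub0r => h.
  have := pos s; rewrite s0 td1 => /(_ isT) h1.
  have h2 := KP s; rewrite (ltW s0) td0 in h2; have {}h2 := h2 isT.
  have -> : L t - (t%:C%C : C) *: v = - (- L t - L s) - (L s - real_scale s v).
    by apply/rowP => j; rewrite tE /real_scale rmorphN !mxE; ring.
  have h3 : e / 2 / (K + 1) * rn (L s) <= e / 2 * s.
    rewrite mulrAC ler_pdivrMr // -[leRHS]mulrA ler_wpM2l //; first by rewrite divr_ge0 // ltW.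
    by apply: le_trans h2 _; rewrite [leRHS]mulrC ler_wpM2r ?ltW // ltrDl.
  apply: le_trans (rnB _ _) _; rewrite rnN; clear -h h1 h3; lra.
- rewrite gtr0_norm // in td0 td1 td2 *.
  have := pos t; rewrite t0 td1 => /(_ isT) /le_trans; apply.
  by rewrite ler_wpM2r ?ltW //; lra.
Qed.

End ApproximatelyAdditive.

(** * SU(1,1) acting on the disc *)

Section SU11.
Context {R : realType}.
Local Notation C := (Cplx R).

Definition cj (a : C) : C := (a : R[i])^*.

Lemma cjE a : cj a = Complex (complex.Re a) (- complex.Im a).
Proof. by case: a. Qed.
Lemma cjD a b : cj (a + b) = cj a + cj b. Proof. exact: rmorphD. Qed.
Lemma cjN a : cj (- a) = - cj a. Proof. exact: rmorphN. Qed.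
Lemma cjB a b : cj (a - b) = cj a - cj b. Proof. exact: rmorphB. Qed.
Lemma cjM a b : cj (a * b) = cj a * cj b. Proof. exact: rmorphM. Qed.
Lemma cjV a : cj (a^-1) = (cj a)^-1. Proof. exact: fmorphV. Qed.
Lemma cj1 : cj 1 = 1. Proof. exact: rmorph1. Qed.
Lemma cj0 : cj 0 = 0. Proof. exact: rmorph0. Qed.
Lemma cjK : involutive cj. Proof. exact: conjCK. Qed.
Lemma rn_cj a : rn (cj a) = rn a. Proof. exact: rn_conj. Qed.
Lemma cj_real (t : R) : cj (t%:C%C) = t%:C%C.
Proof. by rewrite cjE /= oppr0. Qed.
Lemma mul_cj a : a * cj a = (rn a ^+ 2)%:C%C.
Proof. by rewrite rn_sqr; case: a => x y; apply/eqP; rewrite eq_complex /=; apply/andP; split; apply/eqP; ring. Qed.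
Lemma cj_eq0 a : (cj a == 0) = (a == 0). Proof. exact: conjC_eq0. Qed.

(* [SU a b _] is the matrix of SU(1,1) with rows [(a, b)] and [(cj b, cj a)]. *)
Record su := SU { sa : C; sb : C; su_det : sa * cj sa - sb * cj sb = 1 }.

Lemma su_eq x y : sa x = sa y -> sb x = sb y -> x = y.
Proof.
case: x y => a b d [a' b' d'] /= aa bb; subst a' b'.
by rewrite (eq_irrelevance d d').
Qed.

Lemma suone_subproof : (1 : C) * cj 1 - 0 * cj 0 = 1.
Proof. by rewrite cj1 mul0r subr0 mulr1. Qed.
Definition suone := SU suone_subproof.

Lemma sumul_subproof x y :
  (sa x * sa y + sb x * cj (sb y)) * cj (sa x * sa y + sb x * cj (sb y)) -
  (sa x * sb y + sb x * cj (sa y)) * cj (sa x * sb y + sb x * cj (sa y)) = 1.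
Proof.
case: x y => a b /= d1 [c e /= d2]; rewrite !cjD !cjM !cjK.
transitivity ((a * cj a - b * cj b) * (c * cj c - e * cj e)); first by ring.
by rewrite d1 d2 mulr1.
Qed.
Definition sumul x y := SU (sumul_subproof x y).

Lemma suinv_subproof x : cj (sa x) * cj (cj (sa x)) - - sb x * cj (- sb x) = 1.
Proof. by rewrite cjK cjN mulrNN mulrC su_det. Qed.
Definition suinv x := SU (suinv_subproof x).

Lemma sumulA x y z : sumul x (sumul y z) = sumul (sumul x y) z.
Proof. by apply: su_eq => /=; rewrite !cjD !cjM !cjK; ring. Qed.
Lemma sumul1 x : sumul x suone = x.
Proof. by apply: su_eq => /=; rewrite ?cj0 ?cj1; ring. Qed.
Lemma su1mul x : sumul suone x = x.
Proof. by apply: su_eq => /=; ring. Qed.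
Lemma sumulV x : sumul x (suinv x) = suone.
Proof.
apply: su_eq => /=; rewrite ?cjN ?cjK; last by ring.
by rewrite mulrN su_det.
Qed.
Lemma suVmul x : sumul (suinv x) x = suone.
Proof.
apply: su_eq => /=; last by ring.
by rewrite mulNr [cj _ * _]mulrC su_det.
Qed.

(* A total constructor; junk value [suone] when the determinant is not [1]. *)
Definition mksu (a b : C) : su :=
  if pselect (a * cj a - b * cj b = 1) is left d then SU d else suone.

Lemma mksuE a b : a * cj a - b * cj b = 1 -> sa (mksu a b) = a /\ sb (mksu a b) = b.
Proof. by move=> d; rewrite /mksu; case: pselect. Qed.

Lemma su_rn x : rn (sa x) ^+ 2 = 1 + rn (sb x) ^+ 2.
Proof.
apply: complexI; rewrite rmorphD rmorph1 /= -!mul_cj.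
by rewrite -(su_det x) subrK.
Qed.

Lemma su_rn_lt x : rn (sb x) < rn (sa x).
Proof.
by rewrite -(@ltr_pXn2r _ 2) ?nnegrE ?rn_ge0 // su_rn ltrDr.
Qed.

Lemma su_a_neq0 x : sa x != 0.
Proof.
apply/eqP => a0; have := su_rn_lt x; rewrite a0 rn0.
by have := rn_ge0 (sb x); lra.
Qed.

Definition mobden x (z : C) : C := cj (sb x) * z + cj (sa x).
Definition mob x (z : C) : C := (sa x * z + sb x) / mobden x z.

Lemma mobden_neq0 x z : rn z < 1 -> mobden x z != 0.
Proof.
move=> z1; apply/eqP => /eqP; rewrite addr_eq0 => /eqP H.
have := su_rn_lt x; rewrite -[rn (sa x)]rn_cj -[rn (cj (sa x))]rnN -H rnM rn_cj.
have := rn_ge0 (sb x); have := rn_ge0 z => z0 b0.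
have : rn (sb x) * rn z <= rn (sb x) * 1 by rewrite ler_wpM2l // ltW.
lra.
Qed.

Lemma mob_lt1 x z : rn z < 1 -> rn (mob x z) < 1.
Proof.
move=> z1; have d0 := mobden_neq0 x z1; have dp := rn_gt0 d0.
rewrite /mob rnM rnV ltr_pdivrMr // mul1r.
rewrite -(@ltr_pXn2r _ 2) ?nnegrE ?rn_ge0 // -subr_gt0.
have -> : rn (mobden x z) ^+ 2 - rn (sa x * z + sb x) ^+ 2 = 1 - rn z ^+ 2.
  apply: complexI; rewrite !rmorphB rmorph1 /= -!mul_cj.
  rewrite /mobden !cjD !cjM !cjK.
  transitivity ((sa x * cj (sa x) - sb x * cj (sb x)) * (1 - z * cj z)); first by ring.
  by rewrite su_det mul1r.
by rewrite subr_gt0 expr_lt1 // rn_ge0.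
Qed.

Lemma mob1 z : mob suone z = z.
Proof. by rewrite /mob /mobden /= cj0 cj1 mul0r add0r divr1 mul1r addr0. Qed.

Lemma mobM x y z : rn z < 1 -> mob (sumul x y) z = mob x (mob y z).
Proof.
move=> z1; have d1 := mobden_neq0 y z1; have d2 := mobden_neq0 (sumul x y) z1.
have d3 := mobden_neq0 x (mob_lt1 y z1).
have key : mob y z * mobden y z = sa y * z + sb y by rewrite divfK.
rewrite {1}/mob; move: (mob y z) key d3 => m key d3.
have E : mobden (sumul x y) z = mobden x m * mobden y z.
  transitivity (cj (sb x) * (m * mobden y z) + cj (sa x) * mobden y z).
    by rewrite key /mobden /= !cjD !cjM !cjK; ring.
  by rewrite mulrA -mulrDl.
have E2 : sa (sumul x y) * z + sb (sumul x y) = (sa x * m + sb x) * mobden y z.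
  transitivity (sa x * (m * mobden y z) + sb x * mobden y z).
    by rewrite key /mobden /=; ring.
  by rewrite mulrA -mulrDl.
by rewrite E E2 -mulf_div divff // mulr1.
Qed.

(* The image of the origin under [mob x]. *)
Definition w0 x : C := sb x / cj (sa x).

Lemma mob_0 x : mob x 0 = w0 x.
Proof. by rewrite /mob /mobden !mulr0 !add0r. Qed.

Lemma w0_lt1 x : rn (w0 x) < 1.
Proof. by rewrite -mob_0; apply: mob_lt1; rewrite rn0 ltr01. Qed.

Lemma w0M x y : w0 (sumul x y) = mob x (w0 y).
Proof. by rewrite -!mob_0 mobM // rn0 ltr01. Qed.

Fixpoint supow x k := if k is k'.+1 then sumul (supow x k') x else suone.

(* Cayley-Hamilton: [x ^ k = p x - q] with [(p, q) -> (2 Re a p - q, p)], and [|p|] grows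
   at least linearly unless [x] is elliptic. *)
Lemma supow_formula x k : exists p q : R,
  [/\ sa (supow x k) = p%:C%C * sa x - q%:C%C, sb (supow x k) = p%:C%C * sb x &
      1 <= complex.Re (sa x) ^+ 2 ->
      k%:R <= `|p| /\ (1 + `|q| <= `|p| \/ p = 0 /\ `|q| = 1)].
Proof.
elim: k => [|k [p [q [IHa IHb IHp]]]] /=.
  exists 0, (-1); rewrite rmorph0 !mul0r rmorphN rmorph1 opprK add0r; split => // _.
  by rewrite normr0 normrN normr1; split => //; right.
exists (2 * complex.Re (sa x) * p - q), p.
have Re2 : (2 * complex.Re (sa x) * p - q)%:C%C =
    (sa x + cj (sa x)) * p%:C%C - q%:C%C :> C.
  by rewrite cjE; case: (sa x) => s t; apply/eqP; rewrite eq_complex /=;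
     apply/andP; split; apply/eqP; ring.
rewrite IHa IHb Re2; split.
- have := su_det x; set a := sa x; set b := sb x => d.
  transitivity (p%:C%C * a * a - q%:C%C * a + p%:C%C * (a * cj a - (a * cj a - b * cj b))).
    by ring.
  by rewrite d; ring.
- by ring.
- move=> T2; have [h1 h2] := IHp T2.
  have {}T1 : 1 <= `|complex.Re (sa x)|.
    by rewrite -(@ler_pXn2r _ 2) ?nnegrE // expr1n real_normK ?num_real.
  have H := lerB_dist (2 * complex.Re (sa x) * p) q.
  have E : `|2 * complex.Re (sa x) * p| = 2 * (`|complex.Re (sa x)| * `|p|).
    by rewrite !normrM ger0_norm // mulrA.
  have P0 := normr_ge0 p; have P1 : 1 * `|p| <= `|complex.Re (sa x)| * `|p|.
    by rewrite ler_wpM2r.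
  rewrite -natr1; case: h2 => [h2|[p0 q1]]; first by split; [lra|left; lra].
  rewrite p0 mulr0 sub0r normrN q1 normr0 addr0; rewrite p0 normr0 in h1.
  by split; [lra|left].
Qed.

(** The kernel of the action of SU(1,1) on the disc. *)
Definition pm_one x := sb x = 0 /\ (sa x = 1 \/ sa x = -1).

Lemma Re_ge1_diag x : 1 <= complex.Re (sa x) ^+ 2 -> sb x = 0 -> pm_one x.
Proof.
move=> T1 b0; split => //; have := su_rn x; rewrite b0 rn0 expr0n addr0 rn_sqr.
case: (sa x) T1 => s t /= s1 st.
have t0 : t = 0.
  by apply/eqP; rewrite -sqrf_eq0 eq_le sqr_ge0 andbT; lra.
have : (s - 1) * (s + 1) = 0 by rewrite t0 in st; lra.
move=> /eqP; rewrite mulf_eq0 subr_eq0 addr_eq0 t0 => /orP[/eqP ->|/eqP ->].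
  by left.
by right; apply/eqP; rewrite eq_complex /= oppr0 !eqxx.
Qed.

(** A bound [r < 1] on [|b| / |a|] bounds [|b|], because [|a|^2 = 1 + |b|^2]. Unless [x] is
    elliptic, the off-diagonal entry of its [k]-th power is at least [k |sb x|] in norm, which
    forces [sb x = 0]. *)
Lemma bounded_powers x r : r < 1 -> (forall k, rn (w0 (supow x k)) <= r) ->
  pm_one x \/ complex.Re (sa x) ^+ 2 < 1.
Proof.
move=> r1 H; have [T1|] := leP 1 (complex.Re (sa x) ^+ 2); last by right.
left; apply: Re_ge1_diag => //; apply/eqP/negPn/negP => /rn_gt0 b0.
have r0 : 0 <= r by apply: le_trans (H 0%N); exact: rn_ge0.
have bd k : rn (sb (supow x k)) <= (1 - r)^-1.
  have := H k; rewrite /w0 rnM rnV rn_cj ler_pdivrMr ?rn_gt0 ?su_a_neq0 // => h.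
  have := su_rn (supow x k); set B := rn _ in h *; set A := rn _ in h * => AB.
  have A0 : 0 <= A by exact: rn_ge0.
  have B0 : 0 <= B by exact: rn_ge0.
  have AB1 : A <= 1 + B.
    rewrite -(@ler_pXn2r _ 2) ?nnegrE ?addr_ge0 // AB sqrrD expr1n mul1r.
    by rewrite lerD2r lerDl mulrn_wge0.
  have rA : r * A <= r * (1 + B) by rewrite ler_wpM2l.
  rewrite -[_^-1]mul1r ler_pdivlMr ?subr_gt0 //; lra.
have [k kP] : exists k : nat, (1 - r)^-1 / rn (sb x) < k%:R.
  exists (Num.truncn ((1 - r)^-1 / rn (sb x))).+1.
  by rewrite truncnS_gt.
have [p [q [_ pb /(_ T1)[kp _]]]] := supow_formula x k.
have := bd k; rewrite pb rnM rn_real leNgt => /negP; apply.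
rewrite -ltr_pdivrMr //; exact: lt_le_trans kP kp.
Qed.

End SU11.

(** * The subgroup AN, its coordinates, and elliptic elements *)

Section SU11Subgroups.
Context {R : realType}.
Local Notation C := (Cplx R).
Implicit Types (x y : su (R := R)) (w z : C).

Lemma cplx_eq (a b : C) : complex.Re a = complex.Re b -> complex.Im a = complex.Im b -> a = b.
Proof. by case: a b => ? ? [? ?] /= -> ->. Qed.

(* [x] fixes the boundary point [1] iff [sa x + sb x] is real; positivity excludes [-1].
   The resulting group AN acts simply transitively on the disc. *)
Definition isAN x := exists2 l : R, 0 < l & sa x + sb x = l%:C%C.

Lemma AN_one : isAN suone.
Proof. by exists 1 => //=; rewrite addr0. Qed.

Lemma AN_mul x y : isAN x -> isAN y -> isAN (sumul x y).
Proof.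
move=> [l l0 lE] [m m0 mE]; exists (l * m); first exact: mulr_gt0.
rewrite rmorphM /= -lE.
have mE' : cj (sb y) + cj (sa y) = m%:C%C by rewrite -cjD addrC mE cj_real.
transitivity (sa x * (sa y + sb y) + sb x * (cj (sb y) + cj (sa y))); first by ring.
by rewrite mE mE' mulrDl.
Qed.

Lemma AN_inv x : isAN x -> isAN (suinv x).
Proof.
move=> [l l0 lE]; exists l^-1; first by rewrite invr_gt0.
have l1 : (l%:C%C : C) != 0 by rewrite -lE; apply/eqP => H; move: H l0;
  rewrite lE => /complexI ->; rewrite ltxx.
apply: (mulIf l1); rewrite fmorphV mulVf //=.
have lE' : cj (sa x) + cj (sb x) = l%:C%C by rewrite -cjD lE cj_real.
rewrite mulrBl -{1}lE -{1}lE'.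
by rewrite -(su_det x); ring.
Qed.

Lemma w0_b x : sb x = w0 x * cj (sa x).
Proof. by rewrite /w0 divfK // cj_eq0 su_a_neq0. Qed.

(** The quotient [x^-1 y] fixes the origin, so its off-diagonal entry vanishes and its diagonal
    entry is a positive number of modulus 1. *)
Lemma AN_w0_inj x y : isAN x -> isAN y -> w0 x = w0 y -> x = y.
Proof.
move=> AX AY W; have : isAN (sumul (suinv x) y) by apply: AN_mul => //; exact: AN_inv.
have b0 : sb (sumul (suinv x) y) = 0.
  rewrite /= !w0_b W; ring.
move=> [l l0]; rewrite b0 addr0 => aE.
have a1 : sa (sumul (suinv x) y) = 1.
  have := su_det (sumul (suinv x) y); rewrite b0 aE mul0r subr0 cj_real -rmorphM /=.
  move=> /(@complexI _ _ 1) /eqP; rewrite -expr2 sqrf_eq1 => /orP[/eqP -> //|/eqP l1].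
  by exfalso; move: l0; rewrite l1; lra.
have E : sumul (suinv x) y = suone by apply: su_eq.
by rewrite -[y]su1mul -(sumulV x) -sumulA E sumul1.
Qed.

(** As [sa x + sb x] is real, the imaginary parts cancel in [|a|^2 = 1 + |b|^2], leaving
    [(Re a)^2 = 1 + (Re b)^2]. *)
Lemma AN_not_elliptic x : isAN x -> 1 <= complex.Re (sa x) ^+ 2.
Proof.
move=> [l l0 lE]; have := su_rn x; rewrite !rn_sqr.
have : complex.Im (sa x) = - complex.Im (sb x).
  have : complex.Im (sa x + sb x : C) = 0 by rewrite lE.
  by case: (sa x) (sb x) => ? ? [? ?] /=; lra.
by move=> ->; rewrite sqrrN; have := sqr_ge0 (complex.Re (sb x)); lra.
Qed.

Lemma AN_pm_one x : isAN x -> pm_one x -> x = suone.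
Proof.
move=> [l l0]; rewrite /pm_one => + [b0 [a1|a1]]; first by move=> _; apply: su_eq.
rewrite b0 a1 addr0 => /(congr1 (@complex.Re R)) /= h.
by exfalso; move: l0; rewrite -h; lra.
Qed.

(** The conditions [b = w cj a] and [a + b > 0] hold for [a = 1 - w], since
    [(1 - w) + w (1 - cj w) = 1 - |w|^2]; this positive factor normalizes the determinant. *)
Definition an_scale (w : C) : R := (Num.sqrt (1 - rn w ^+ 2) * rn (1 - w))^-1.

Definition an (w : C) : su :=
  mksu ((an_scale w)%:C%C * (1 - w)) (w * ((an_scale w)%:C%C * (1 - cj w))).

Lemma disc_facts w : rn w < 1 -> 0 < 1 - rn w ^+ 2 /\ 0 < rn (1 - w).
Proof.
move=> w1; split; first by rewrite subr_gt0 expr_lt1 // rn_ge0.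
by apply: rn_gt0; rewrite subr_eq0; apply: contraTneq w1 => <-; rewrite rn1 ltxx.
Qed.

Lemma an_scale_gt0 w : rn w < 1 -> 0 < an_scale w.
Proof. by move=> /disc_facts[h1 h2]; rewrite invr_gt0 mulr_gt0 // sqrtr_gt0. Qed.

Lemma an_scale_sqr w : rn w < 1 ->
  an_scale w ^+ 2 * (rn (1 - w) ^+ 2 * (1 - rn w ^+ 2)) = 1.
Proof.
move=> /disc_facts[h1 h2]; rewrite /an_scale exprVn exprMn sqr_sqrtr ?ltW //.
by rewrite [_ * rn _ ^+ 2]mulrC mulVf // mulf_neq0 // ?sqrf_eq0 gt_eqF.
Qed.

Lemma anE w : rn w < 1 ->
  sa (an w) = (an_scale w)%:C%C * (1 - w) /\
  sb (an w) = w * ((an_scale w)%:C%C * (1 - cj w)).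
Proof.
move=> w1; apply: mksuE; rewrite !cjM !cjB !cj1 cjK !cj_real.
transitivity ((an_scale w ^+ 2 * (rn (1 - w) ^+ 2 * (1 - rn w ^+ 2)))%:C%C : C).
  have E (t A B : R) : (t ^+ 2 * (A * (1 - B)))%:C%C =
      t%:C%C * t%:C%C * (A%:C%C * (1 - B%:C%C)) :> C by apply: cplx_eq => /=; ring.
  by rewrite E -!mul_cj cjB cj1; ring.
by rewrite an_scale_sqr.
Qed.

Lemma w0_an w : rn w < 1 -> w0 (an w) = w.
Proof.
move=> w1; have [aE bE] := anE w1; have := su_a_neq0 (an w).
rewrite /w0 bE -cj_eq0 aE cjM cjB cj1 cj_real => h.
by rewrite mulfK.
Qed.

Lemma an_AN w : rn w < 1 -> isAN (an w).
Proof.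
move=> w1; have [aE bE] := anE w1; have [h1 h2] := disc_facts w1.
exists (an_scale w * (1 - rn w ^+ 2)).
  by rewrite mulr_gt0 // an_scale_gt0.
by rewrite aE bE rmorphM rmorphB rmorph1 /= -mul_cj; ring.
Qed.

Lemma an_w0 x : isAN x -> an (w0 x) = x.
Proof.
by move=> AX; apply: AN_w0_inj => //; [apply: an_AN|rewrite w0_an //]; exact: w0_lt1.
Qed.

Lemma an0 : an 0 = suone.
Proof. by have := an_w0 AN_one; rewrite {1}/w0 /= mul0r. Qed.

(* In the half-plane model with [1] at infinity, [Tm u] is the translation by [u] and [Sm s]
   the dilation by [exp s]; [an w = Tm (an_u w) Sm (an_s w)]. *)
Definition Tm (u : R) : su := mksu (Complex 1 (u / 2)) (Complex 0 (- (u / 2))).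

Lemma TmE u : sa (Tm u) = Complex 1 (u / 2) /\ sb (Tm u) = Complex 0 (- (u / 2)).
Proof. by apply: mksuE; rewrite !cjE; apply: cplx_eq => /=; ring. Qed.

Definition Sm (s : R) : su :=
  mksu (((expR (s / 2) + expR (- (s / 2))) / 2)%:C%C)
       (((expR (s / 2) - expR (- (s / 2))) / 2)%:C%C).

Lemma SmE s : sa (Sm s) = (((expR (s / 2) + expR (- (s / 2))) / 2)%:C%C) /\
   sb (Sm s) = (((expR (s / 2) - expR (- (s / 2))) / 2)%:C%C).
Proof.
apply: mksuE; rewrite !cj_real; have := expRxMexpNx_1 (s / 2).
set e := expR (s / 2); set f := expR _ => ef; apply: cplx_eq => /=; last by ring.
by transitivity (e * f); [field|].
Qed.

Lemma TmD u v : Tm (u + v) = sumul (Tm u) (Tm v).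
Proof.
have [a1 b1] := TmE (u + v); have [a2 b2] := TmE u; have [a3 b3] := TmE v.
by apply: su_eq; rewrite /= ?a1 ?b1 ?a2 ?b2 ?a3 ?b3 !cjE; apply: cplx_eq => /=; field.
Qed.

Lemma SmD s t : Sm (s + t) = sumul (Sm s) (Sm t).
Proof.
have [a1 b1] := SmE (s + t); have [a2 b2] := SmE s; have [a3 b3] := SmE t.
have h : (s + t) / 2 = s / 2 + t / 2 by field.
rewrite h opprD !expRD in a1 b1.
apply: su_eq; rewrite /= ?a1 ?b1 ?a2 ?b2 ?a3 ?b3 ?cj_real.
  by apply: cplx_eq => /=; field.
by apply: cplx_eq => /=; field.
Qed.

Lemma Sm_Tm s u : sumul (Sm s) (Tm u) = sumul (Tm (expR s * u)) (Sm s).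
Proof.
have [a1 b1] := TmE (expR s * u); have [a2 b2] := TmE u; have [a3 b3] := SmE s.
have E : expR s = expR (s / 2) ^+ 2 by rewrite -expRM_natr; congr expR; field.
have := expRxMexpNx_1 (s / 2); rewrite E.
rewrite E in a1 b1.
set e := expR (s / 2); set f := expR _ => ef.
apply: su_eq; rewrite /= ?a1 ?b1 ?a2 ?b2 ?a3 ?b3 ?cjE -/e -/f.
  by apply: cplx_eq => /=; field : ef.
by apply: cplx_eq => /=; field : ef.
Qed.

Lemma Tm0 : Tm 0 = suone.
Proof. by have [a b] := TmE 0; apply: su_eq; rewrite ?a ?b mul0r ?oppr0. Qed.

Lemma Sm0 : Sm 0 = suone.
Proof.
have [a b] := SmE 0; apply: su_eq; rewrite ?a ?b mul0r oppr0 expR0.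
  by apply: cplx_eq => //=; field.
by apply: cplx_eq => //=; field.
Qed.

Lemma Tm_AN u : isAN (Tm u).
Proof. by have [a b] := TmE u; exists 1; rewrite // a b; apply: cplx_eq => /=; ring. Qed.

Lemma Sm_AN s : isAN (Sm s).
Proof.
have [a b] := SmE s; exists (expR (s / 2)); first exact: expR_gt0.
by rewrite a b; apply: cplx_eq => /=; field.
Qed.

(** On the disc, the Cayley transform [(1 + w) / (1 - w)] has real part [exp (an_s w)] and imaginary
    part [- an_u w]. *)
Definition an_s (w : C) : R := ln ((1 - rn w ^+ 2) / rn (1 - w) ^+ 2).
Definition an_u (w : C) : R := - (2 * complex.Im w) / rn (1 - w) ^+ 2.

Lemma an_decomp w : rn w < 1 -> an w = sumul (Tm (an_u w)) (Sm (an_s w)).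
Proof.
move=> w1; have [N0 m0] := disc_facts w1; have t0 := an_scale_gt0 w1.
have tE := an_scale_sqr w1.
have [a1 b1] := anE w1; have [a2 b2] := TmE (an_u w); have [a3 b3] := SmE (an_s w).
set t := an_scale w in t0 tE a1 b1; set N := 1 - rn w ^+ 2 in N0 tE.
set m := rn (1 - w) ^+ 2 in tE; have {}m0 : 0 < m by rewrite exprn_gt0.
have tN0 : 0 < t * N by rewrite mulr_gt0.
have eE : expR (an_s w / 2) = t * N.
  apply/eqP; rewrite -(@eqrXn2 _ 2) ?expR_ge0 ?(ltW tN0) // -expRM_natr.
  rewrite divfK ?pnatr_eq0 // lnK ?posrE ?(divr_gt0 N0 m0) // -/N -/m; apply/eqP.
  apply: (@mulIf _ m); first by rewrite gt_eqF.
  by rewrite divfK ?gt_eqF // exprMn -[LHS]mulr1 -tE; ring.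
have fE : expR (- (an_s w / 2)) = t * m.
  rewrite expRN eE; apply: (@mulIf _ (t * N)); first by rewrite mulf_neq0 // gt_eqF.
  by rewrite mulVf ?mulf_neq0 ?gt_eqF // -tE; ring.
have uE : an_u w / 2 * (t * m) = - (t * complex.Im w).
  by rewrite /an_u -/m; field; rewrite gt_eqF.
have NE : N = 1 - (complex.Re w ^+ 2 + complex.Im w ^+ 2) by rewrite /N rn_sqr.
have mE : m = (1 - complex.Re w) ^+ 2 + complex.Im w ^+ 2.
  by rewrite /m rn_sqr; case: (w) => x y /=; ring.
rewrite eE fE in a3 b3.
apply: su_eq; rewrite /= ?a1 ?b1 ?a2 ?b2 ?a3 ?b3 ?cjE.
  apply: cplx_eq; rewrite ?cReM ?cImM ?cReB ?cImB /=.
    transitivity (t * (N + m) / 2); last by field.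
    by rewrite NE mE; case: (w) => x y /=; field.
  transitivity (an_u w / 2 * (t * m)); last by field.
  by rewrite uE; case: (w) => x y /=; field.
apply: cplx_eq; rewrite ?cReM ?cImM ?cReB ?cImB /=.
  transitivity (t * (N - m) / 2); last by field.
  by rewrite NE mE; case: (w) => x y /=; field.
transitivity (- (an_u w / 2 * (t * m))); last by field.
by rewrite uE; case: (w) => x y /=; field.
Qed.

(** The substitution [q = i b / e] turns the fixed point equation into the real quadratic
    [e^2 - 2 y e + |b|^2 = 0] with [y = Im a], whose roots are [y + D] and [y - D] for
    [D^2 = 1 - (Re a)^2 > 0]. Their product is [|b|^2], so the root of larger absolute value gives
    [|q| < 1]. *)
Lemma elliptic_fixpoint x : complex.Re (sa x) ^+ 2 < 1 ->
  exists2 q : C, rn q < 1 & mob x q = q.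
Proof.
move=> T1; have := su_rn x; rewrite !rn_sqr.
set tau := complex.Re (sa x) in T1 *; set y := complex.Im (sa x) => E.
pose D := Num.sqrt (1 - tau ^+ 2).
have D0 : 0 < D by rewrite sqrtr_gt0 subr_gt0.
have D2 : D ^+ 2 = 1 - tau ^+ 2 by rewrite sqr_sqrtr // ltW // subr_gt0.
have [e e2 e0] : exists2 e : R, e ^+ 2 - 2 * y * e + rn (sb x) ^+ 2 = 0 & rn (sb x) < `|e|.
  have bn : rn (sb x) ^+ 2 = y ^+ 2 - D ^+ 2 by rewrite rn_sqr; lra.
  have lt_y d : `|d| = `|y| + D -> rn (sb x) < `|d|.
    move=> ->; have yD : 0 <= `|y| + D by rewrite addr_ge0 // ltW.
    rewrite -(@ltr_pXn2r _ 2) ?nnegrE ?rn_ge0 ?yD // bn.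
    rewrite sqrrD real_normK ?num_real //.
    have := sqr_ge0 D; have : 0 <= `|y| * D by rewrite mulr_ge0 // ltW.
    have : 0 < D ^+ 2 by rewrite exprn_gt0.
    lra.
  have [y0|y0] := leP 0 y.
    exists (y + D); first by rewrite bn; ring.
    by apply: lt_y; rewrite !ger0_norm // addr_ge0 // ltW.
  exists (y - D); first by rewrite bn; ring.
  by apply: lt_y; rewrite !ltr0_norm //; lra.
have eN : e != 0 by rewrite -normr_gt0; apply: le_lt_trans e0; exact: rn_ge0.
have eC : (e%:C%C : C) != 0 by apply/eqP => /complexI /eqP; rewrite (negbTE eN).
pose q : C := Complex 0 1 * sb x / e%:C%C.
have i1 : rn (Complex 0 1 : C) = 1.
  by rewrite /rn normc_def /= expr0n add0r expr1n sqrtr1.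
have q1 : rn q < 1.
  rewrite /q !rnM rnV i1 mul1r rn_real ltr_pdivrMr ?mul1r //.
  by rewrite normr_gt0.
exists q => //; apply: (mulIf (mobden_neq0 x q1)).
rewrite /mob divfK ?mobden_neq0 // /mobden.
have i2 : (Complex 0 1 : C) * Complex 0 1 = -1 by apply: cplx_eq => /=; ring.
have aE : sa x - cj (sa x) = 2 * Complex 0 1 * y%:C%C.
  by rewrite cjE; apply: cplx_eq; rewrite ?cReB ?cImB /= -/tau -/y; ring.
have bE : sb x * cj (sb x) = - (e%:C%C ^+ 2 - 2 * y%:C%C * e%:C%C).
  rewrite mul_cj; apply/eqP; rewrite -addr_eq0 addrC; apply/eqP.
  by rewrite -[RHS](congr1 (fun t : R => t%:C%C : C) e2); apply: cplx_eq => /=; ring.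
apply/eqP; rewrite -subr_eq0; apply/eqP.
transitivity (q * (sa x - cj (sa x)) + sb x - cj (sb x) * q * q); first by ring.
rewrite aE; transitivity (sb x / e%:C%C ^+ 2 * (Complex 0 1 * Complex 0 1) *
  (2 * y%:C%C * e%:C%C - sb x * cj (sb x)) + sb x).
  by rewrite /q; field.
rewrite bE i2.
by field.
Qed.

Definition commutator x y := sumul (sumul x y) (sumul (suinv x) (suinv y)).

(* Two elliptic elements with distinct fixed points have a hyperbolic commutator. *)
Lemma commutator_rotation x y : sb x = 0 -> sa x ^+ 2 != 1 ->
  pm_one (commutator x y) \/ complex.Re (sa (commutator x y)) ^+ 2 < 1 -> sb y = 0.
Proof.
move=> b0 a2 H; apply/eqP/negPn/negP => d0.
have aa : sa x * cj (sa x) = 1 by have := su_det x; rewrite b0 mul0r subr0.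
(* The real part is [1 + |sb y|^2 (1 - s)] with [s] the real part of [sa x ^+ 2]. As [s < 1], it
   exceeds 1 unless [sb y = 0]. *)
have E : sa (commutator x y) = (1 + rn (sb y) ^+ 2)%:C%C - sa x ^+ 2 * (rn (sb y) ^+ 2)%:C%C.
  rewrite -su_rn -!mul_cj /commutator /= b0 !cjD !cjM ?cjN ?cjK cj0.
  transitivity (sa x * cj (sa x) * (sa y * cj (sa y)) - sa x ^+ 2 * (sb y * cj (sb y))).
    by ring.
  by rewrite aa mul1r.
have n1 : rn (sa x ^+ 2) = 1.
  have : rn (sa x) ^+ 2 = 1 by rewrite su_rn b0 rn0 expr0n addr0.
  by rewrite rnX.
have : complex.Re (sa x ^+ 2 : C) < 1.
  have h := rn_Re (sa x ^+ 2); rewrite n1 ler_norml in h; move/andP: h => [_ h].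
  rewrite lt_neqAle h andbT; apply: contra a2 => /eqP R1.
  have := rn_sqr (sa x ^+ 2); rewrite n1 R1 => h2.
  apply/eqP; apply: cplx_eq => //=; apply/eqP; rewrite -sqrf_eq0.
  by apply/eqP; move: h2; set q := complex.Im _; lra.
set s := complex.Re _ => s1.
have ReE : complex.Re (sa (commutator x y)) = 1 + rn (sb y) ^+ 2 * (1 - s).
  by rewrite E cReB cReM /= -/s; ring.
have p0 : 0 < rn (sb y) ^+ 2 * (1 - s).
  by rewrite mulr_gt0 ?exprn_gt0 ?rn_gt0 // subr_gt0.
case: H => [[_ [H|H]]|H].
- by move: ReE; rewrite H /=; lra.
- by move: ReE; rewrite H /=; lra.
- by move: H; rewrite ReE sqrrD; have := sqr_ge0 (rn (sb y) ^+ 2 * (1 - s)); lra.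
Qed.

End SU11Subgroups.

(** * SU(1,1)^n acting on the polydisc *)

Section RowVectors.
Context {R : realType}.
Local Notation C := (Cplx R).

Lemma row_continuous n (X : topologicalType) (f : X -> 'rV[C]_n) (x : X) :
  (forall j, {for x, continuous (fun y => f y ord0 j)}) -> {for x, continuous f}.
Proof.
move=> H U /nbhs_rnP[e e0 eU].
have : \forall y \near x, forall j, rn (f y ord0 j - f x ord0 j) < e.
  apply: filter_forall => j; apply: (H j [set w | rn (w - f x ord0 j) < e]).
  by apply/nbhs_rnP; exists e.
apply: filterS => y Hy; apply: eU; apply/rn_rV_lt => // j; rewrite !mxE; exact: Hy.
Qed.

Lemma row_differentiable n (V : normedModType C) (f : V -> 'rV[C]_n) (x : V) :
  (forall j, differentiable (fun y => f y ord0 j) x) -> differentiable f x.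
Proof.
move=> H.
have -> : f = \sum_j (fun y => f y ord0 j *: (delta_mx ord0 j : 'rV[C]_n)).
  by apply/funext => y; rewrite fct_sumE; exact: row_sum_delta.
by apply: differentiable_sum => j; apply: differentiableZl; exact: H.
Qed.

Lemma cj_continuous : continuous (@cj R).
Proof.
move=> a U /nbhs_rnP[e e0 eU]; apply/nbhs_rnP; exists e => // b ba.
by apply: eU; rewrite -cjB rn_cj.
Qed.

Lemma mob_continuous (X : topologicalType) (g : X -> su (R := R)) (z : X -> C) (x : X) :
  {for x, continuous (fun y => sa (g y))} -> {for x, continuous (fun y => sb (g y))} ->
  {for x, continuous z} -> rn (z x) < 1 -> {for x, continuous (fun y => mob (g y) (z y))}.
Proof.
move=> ca cb cz z1.
have cc (f : X -> C) : {for x, continuous f} -> {for x, continuous (fun y => cj (f y))}.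
  by move=> cf; apply: (continuous_comp cf); exact: cj_continuous.
have c1 := continuousD (continuousM ca cz) cb.
have c2 := continuousD (continuousM (cc _ cb) cz) (cc _ ca).
have c3 := continuousV (mobden_neq0 (g x) z1 : _ x != 0) c2.
exact: (continuousM c1 c3).
Qed.

Lemma mob_differentiable (g : su (R := R)) (z : C) : rn z < 1 -> differentiable (mob g) z.
Proof.
move=> z1; have d0 := mobden_neq0 g z1.
have di : differentiable (@id C) z by [].
have dc (c : C) : differentiable (fun _ : C => c) z by exact: differentiable_cst.
have d1 := differentiableD (differentiableM (dc (sa g)) di) (dc (sb g)).
have d2 := differentiableD (differentiableM (dc (cj (sb g))) di) (dc (cj (sa g))).
exact: (differentiableM d1 (differentiableV d2 d0)).
Qed.

End RowVectors.

Section PolydiscAutomorphisms.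
Context {R : realType} {n : nat}.
Local Notation C := (Cplx R).
Local Notation D := (polydisc R n).
Local Notation G := ('I_n -> su (R := R)).

Definition pemb (p : D) : 'rV[C]_n := chart_to (polydisc_chart R n) p.
Definition pret (z : 'rV[C]_n) : D := chart_from (polydisc_chart R n) z.

Lemma polydisc_rnP (z : 'rV[C]_n) : polydisc_set z <-> forall j, rn (z ord0 j) < 1.
Proof.
have E (a : C) : (`|a| < 1) = (rn a < 1) by rewrite [X in X < _]rnE ltcR.
by split=> H j; have := H j; rewrite E.
Qed.

Lemma pemb_lt1 p j : rn (pemb p ord0 j) < 1.
Proof. by move: j; apply/polydisc_rnP; exact: (@chart_to_cod _ _ _ (polydisc_chart R n)). Qed.

Lemma pembK : cancel pemb pret.
Proof. by move=> p; exact: (@chart_toK _ _ _ (polydisc_chart R n)). Qed.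

Lemma pretK (z : 'rV[C]_n) : (forall j, rn (z ord0 j) < 1) -> pemb (pret z) = z.
Proof. by move=> /polydisc_rnP; exact: (@chart_fromK _ _ _ (polydisc_chart R n)). Qed.

Lemma pemb_continuous : continuous pemb.
Proof. by move=> p; exact: (@chart_to_cts _ _ _ (polydisc_chart R n)). Qed.

Lemma pret_continuous (z : 'rV[C]_n) : (forall j, rn (z ord0 j) < 1) -> {for z, continuous pret}.
Proof. by move=> /polydisc_rnP; exact: (@chart_from_cts _ _ _ (polydisc_chart R n)). Qed.

Lemma pemb_coord_continuous j : continuous (fun p => pemb p ord0 j).
Proof.
move=> p; change (continuous_at p ((fun z : 'rV[C]_n => z ord0 j) \o pemb)).
by apply: continuous_comp; [exact: pemb_continuous|exact: coord_continuous].
Qed.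

Definition gone : G := fun=> suone.
Definition gmul (g h : G) : G := fun j => sumul (g j) (h j).
Definition ginv (g : G) : G := fun j => suinv (g j).

Lemma gmulA g h k : gmul g (gmul h k) = gmul (gmul g h) k.
Proof. by apply/funext => j; exact: sumulA. Qed.
Lemma gmul1 g : gmul g gone = g. Proof. by apply/funext => j; exact: sumul1. Qed.
Lemma g1mul g : gmul gone g = g. Proof. by apply/funext => j; exact: su1mul. Qed.
Lemma gmulV g : gmul g (ginv g) = gone. Proof. by apply/funext => j; exact: sumulV. Qed.
Lemma gVmul g : gmul (ginv g) g = gone. Proof. by apply/funext => j; exact: suVmul. Qed.

Definition mobG (g : G) (p : D) : D := pret (\row_j mob (g j) (pemb p ord0 j)).

Lemma pemb_mobG g p j : pemb (mobG g p) ord0 j = mob (g j) (pemb p ord0 j).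
Proof.
rewrite /mobG pretK ?mxE // => i; rewrite mxE; apply: mob_lt1; exact: pemb_lt1.
Qed.

Lemma mobGM g h p : mobG (gmul g h) p = mobG g (mobG h p).
Proof.
apply: (can_inj pembK); apply/rowP => j.
by rewrite !pemb_mobG mobM // pemb_lt1.
Qed.

Lemma mobG1 p : mobG gone p = p.
Proof. by apply: (can_inj pembK); apply/rowP => j; rewrite pemb_mobG mob1. Qed.

(** Continuity of a family is expressed through matrix entries, as [su] carries no topology. *)
Definition gcont (X : topologicalType) (g : X -> G) := forall j,
  continuous (fun x => sa (g x j)) /\ continuous (fun x => sb (g x j)).

Lemma mobG_continuous2 (X : topologicalType) (g : X -> G) : gcont g ->
  continuous (fun xp : X * D => mobG (g xp.1) xp.2).
Proof.
move=> gc [x p]; apply: (@continuous_comp _ _ _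
  (fun xp : X * D => \row_j mob (g xp.1 j) (pemb xp.2 ord0 j)) pret).
  apply: row_continuous => j.
  rewrite (_ : (fun _ => _) = fun xp : X * D => mob (g xp.1 j) (pemb xp.2 ord0 j)); last first.
    by apply/funext => y; rewrite mxE.
  have [ca cb] := gc j.
  apply: mob_continuous; last exact: pemb_lt1.
  - by apply: (@continuous_comp _ _ _ fst (fun x => sa (g x j))); [exact: cvg_fst|exact: ca].
  - by apply: (@continuous_comp _ _ _ fst (fun x => sb (g x j))); [exact: cvg_fst|exact: cb].
  - apply: (@continuous_comp _ _ _ snd (fun p => pemb p ord0 j)); first exact: cvg_snd.
    exact: pemb_coord_continuous.
by apply: pret_continuous => j; rewrite mxE; apply: mob_lt1; exact: pemb_lt1.
Qed.

Lemma mobG_continuous g : continuous (mobG g).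
Proof.
have gc : gcont (fun _ : bool => g) by move=> j; split=> x; exact: cst_continuous.
move=> p; have := @mobG_continuous2 _ _ gc (true, p) => H.
apply: (@continuous_comp _ _ _ (fun p : D => (true, p)) (fun xp => mobG g xp.2)) => //.
by move=> U [[V W] [Vt Wp] VWU]; apply: filterS Wp => q Wq; apply: VWU; split => //;
  exact: nbhs_singleton.
Qed.

Lemma mobG_holomorphic g : @holomorphic R n n D D (mobG g).
Proof.
split; first exact: mobG_continuous.
move=> c d -> -> p _ _; rewrite -/(pemb p).
apply: (@near_eq_differentiable _ _ _ (fun z : 'rV[C]_n => \row_j mob (g j) (z ord0 j))).
  have : nbhs (pemb p) (chart_cod (polydisc_chart R n)).
    apply: open_nbhs_nbhs; split; first exact: chart_open_cod.
    exact: (@chart_to_cod _ _ _ (polydisc_chart R n)).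
  apply: filterS => z /polydisc_rnP z1; apply/rowP => j.
  by rewrite mxE /= -/(pemb _) -/(pret z) pemb_mobG pretK.
apply: row_differentiable => j.
rewrite (_ : (fun _ => _) = mob (g j) \o (fun z : 'rV[C]_n => z ord0 j)); last first.
  by apply/funext => z; rewrite mxE.
apply: differentiable_comp; first exact: differentiable_coord.
by apply: mob_differentiable; exact: pemb_lt1.
Qed.

Lemma mobG_biholomorphic g : @biholomorphic R n n D D (mobG g).
Proof.
split; first exact: mobG_holomorphic.
exists (mobG (ginv g)); split; first exact: mobG_holomorphic.
- by move=> p; rewrite -mobGM gVmul mobG1.
- by move=> p; rewrite -mobGM gmulV mobG1.
Qed.

Definition mobA (g : G) : Aut D := Aut_mk (mobG_biholomorphic g).

Lemma mobAM g h : mobA (gmul g h) = (mobA g * mobA h)%g.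
Proof. by apply: Aut_fun_inj; apply/funext => p; exact: mobGM. Qed.

Lemma mobA_continuous (X : topologicalType) (g : X -> G) : gcont g ->
  continuous (fun x => mobA (g x)).
Proof.
move=> /mobG_continuous2 /continuous_curry_fun gc.
apply: (@continuous_comp_initial _ _ _ (set_val : Aut D -> {compact-open, D -> D})).
exact: gc.
Qed.

End PolydiscAutomorphisms.

(** * Displacement of a point by automorphisms *)

Lemma near_pair {X Y : topologicalType} (x : X) (y : Y) (P : X -> Prop) (Q : Y -> Prop)
    (S : X -> Y -> Prop) : (\forall x' \near x, P x') -> (\forall y' \near y, Q y') ->
  (forall x' y', P x' -> Q y' -> S x' y') -> \forall x' \near x & y' \near y, S x' y'.
Proof. by move=> nP nQ PQS; exists (P, Q) => // -[x' y'] /= [Px Qy]; exact: PQS. Qed.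

Section Displacement.
Context {R : realType} {n : nat} {M : complexManifold R n}.
Local Notation C := (Cplx R).
Variables (c : chart R n M) (p : M).
Hypothesis (Ac : cm_atlas c) (cp : chart_dom c p).

Lemma Aut_fun1 (q : M) : Aut_fun (1%g : Aut M) q = q. Proof. by []. Qed.
Lemma Aut_funM (g h : Aut M) q : Aut_fun (g * h)%g q = Aut_fun g (Aut_fun h q).
Proof. by []. Qed.

(** Meaningful only while [g p] stays in [chart_dom c]; [disp_small] ensures this near the
    identity. *)
Definition disp (g : Aut M) : 'rV[C]_n := chart_to c (Aut_fun g p) - chart_to c p.

Lemma disp1 : disp 1%g = 0. Proof. by rewrite /disp Aut_fun1 subrr. Qed.

Lemma Aut_chart_differentiable (g : Aut M) z : chart_cod c z ->
  chart_dom c (Aut_fun g (chart_from c z)) ->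
  differentiable (chart_to c \o Aut_fun g \o chart_from c) z.
Proof.
move=> cz gz; have [[_ H] _] := Aut_funP g.
by have := H c c Ac Ac _ (chart_from_dom cz) gz; rewrite chart_fromK.
Qed.

(** Joint continuity of evaluation gives the bound near each single [z]; compactness of the closed
    ball makes the neighbourhood of [x0] uniform in [z]. *)
Lemma near_identity_uniform (X : topologicalType) (g : X -> Aut M) (x0 : X) (r e : R) :
  continuous g -> g x0 = 1%g -> 0 < e ->
  (forall z, rn (z - chart_to c p) <= r -> chart_cod c z) ->
  \forall x \near x0, forall z, rn (z - chart_to c p) <= r ->
    chart_dom c (Aut_fun (g x) (chart_from c z)) /\
    rn (chart_to c (Aut_fun (g x) (chart_from c z)) - z) <= e.
Proof.
move=> gc g1 e0 rP.
have := @closed_ball_compact R n (chart_to c p) r.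
move=> /compact_near_coveringP /near_covering_withinP.
apply=> z zr; have cz := rP _ zr.
have dz := chart_from_dom cz.
pose U := [set q : M | chart_dom c q /\ rn (chart_to c q - z) < e / 2].
have nU : nbhs (chart_from c z) U.
  apply/(chart_nbhs _ dz); rewrite chart_fromK //.
  have : nbhs z (chart_cod c) by apply: open_nbhs_nbhs; split; [exact: chart_open_cod|].
  move=> /nbhs_rnP[d d0 dP]; exists (Num.min d (e / 2)).
    by rewrite lt_min d0 half_gt0.
  move=> w; rewrite lt_min => /andP[/dP cw wz]; split => //.
  by split; [exact: chart_from_dom|rewrite chart_fromK].
have : nbhs (x0, chart_from c z) (fun xq : X * M => U (Aut_fun (g xq.1) xq.2)).
  have := Aut_eval_continuous gc.
  by move=> /(_ (x0, chart_from c z) U); rewrite /= g1 Aut_fun1; apply.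
move=> [[V W] /= [Vx Wz] VW].
have Wz' : nbhs z (chart_from c @^-1` W) by exact: (chart_from_cts cz Wz).
have nz : nbhs z [set w | rn (w - z) < e / 2].
  by apply/nbhs_rnP; exists (e / 2) => //; exact: half_gt0.
exists ([set w | W (chart_from c w) /\ rn (w - z) < e / 2], V).
  by split => //=; exact: filterI.
move=> [w x] /= [[Ww wz] Vx'] _.
have [/= d1 d2] := VW (x, chart_from c w) (conj Vx' Ww).
split => //; rewrite -(subrKA z); apply: le_trans (rnD _ _) _.
by rewrite rn_sub in wz; lra.
Qed.

(* By Cauchy's estimate, [C^0]-closeness to the identity gives [C^1]-closeness. *)
Lemma near_identity_lipschitz (X : topologicalType) (g : X -> Aut M) (x0 : X) (r eta : R) :
  continuous g -> g x0 = 1%g -> 0 < eta -> 0 < r ->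
  (forall z, rn (z - chart_to c p) <= r -> chart_cod c z) ->
  \forall x \near x0, forall z w, rn (z - chart_to c p) < r / 2 ->
    rn (w - chart_to c p) < r / 2 ->
    rn ((chart_to c (Aut_fun (g x) (chart_from c w)) - w) -
        (chart_to c (Aut_fun (g x) (chart_from c z)) - z)) <= eta * rn (w - z).
Proof.
(* This size is cancelled to [eta] by the constant [8 / r] of the Lipschitz estimate. *)
move=> gc g1 eta0 r0 rP; have e0 : 0 < eta * r / 8 by rewrite !divr_gt0 ?mulr_gt0.
have := near_identity_uniform gc g1 e0 rP; apply: filterS => x H z w zr wr.
pose f z := chart_to c (Aut_fun (g x) (chart_from c z)) - z.
have df y : rn (y - chart_to c p) < r -> differentiable f y.
  move=> yr; apply: differentiableB; last by [].
  apply: Aut_chart_differentiable; first by apply: rP; exact: ltW.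
  by have [] := H y (ltW yr).
have fE y : rn (y - chart_to c p) < r -> rn (f y) <= eta * r / 8.
  by move=> yr; have [] := H y (ltW yr).
have := holomorphic_lipschitz_rV r0 (ltW e0) df fE zr wr.
by have -> : 8 * (eta * r / 8) / r = eta by field; rewrite gt_eqF.
Qed.

Lemma disp_small (X : topologicalType) (g : X -> Aut M) (x0 : X) :
  continuous g -> g x0 = 1%g -> forall e, 0 < e ->
  \forall x \near x0, chart_dom c (Aut_fun (g x) p) /\ rn (disp (g x)) <= e.
Proof.
move=> gc g1 e e0; have [r r0 rP] := chart_ball cp.
have := near_identity_uniform gc g1 e0 rP; apply: filterS => x /(_ (chart_to c p)).
by rewrite subrr rn0 chart_toK // => /(_ (ltW r0)).
Qed.

(** In the chart [g z - z] is [eta]-Lipschitz near [p]; it is compared at the two points [p] and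
    [h p]. *)
Lemma disp_mul (X Y : topologicalType) (g : X -> Aut M) (h : Y -> Aut M) x0 y0 :
  continuous g -> continuous h -> g x0 = 1%g -> h y0 = 1%g -> forall eta, 0 < eta ->
  \forall x \near x0 & y \near y0,
    rn (disp (g x * h y)%g - disp (g x) - disp (h y)) <= eta * rn (disp (h y)).
Proof.
move=> gc hc g1 h1 eta eta0; have [r r0 rP] := chart_ball cp.
have r4 : 0 < r / 4 by rewrite divr_gt0.
have Ng := near_identity_lipschitz gc g1 eta0 r0 rP.
have Nh := disp_small hc h1 r4.
apply: (near_pair Ng Nh) => x y Hg [dh hr].
have := Hg (chart_to c p) (chart_to c (Aut_fun (h y) p)).
rewrite subrr rn0 half_gt0 // => /(_ isT); rewrite !chart_toK // -/(disp (h y)).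
have -> : rn (disp (h y)) < r / 2 by lra.
move=> /(_ isT); rewrite -Aut_funM; congr (rn _ <= _).
by rewrite /disp; apply/rowP => j; rewrite !mxE; ring.
Qed.

Lemma one_parameter_derivative (phi : R -> Aut M) : continuous phi ->
  (forall s t, phi (s + t) = (phi s * phi t)%g) ->
  exists v, forall e, 0 < e -> exists2 d, 0 < d &
    forall t, `|t| < d -> rn (disp (phi t) - (t%:C%C : C) *: v) <= e * `|t|.
Proof.
move=> pc padd; have p1 : phi 0 = 1%g.
  by apply: (@mulgI _ (phi 0)); rewrite -padd addr0 mulg1.
apply: (@approx_additive_derivable R n (fun t => disp (phi t))).
- by rewrite p1 disp1.
- move=> e e0; have := disp_small pc p1 e0 => /nbhs_ballP[d /= d0 dP].
  exists d => // t td; have [] := dP t => //.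
  by rewrite /ball /= sub0r normrN.
- move=> eta eta0; have := disp_mul pc pc p1 p1 eta0.
  move=> [[U V] /= [/nbhs_ballP[d1 /= d10 U1] /nbhs_ballP[d2 /= d20 V2]] UV].
  exists (Num.min d1 d2); first by rewrite lt_min d10.
  move=> s t; rewrite !lt_min => /andP[s1 s2] /andP[t1 t2]; rewrite padd.
  apply: (UV (s, t)); split => /=; [apply: U1|apply: V2];
    by rewrite /ball /= sub0r normrN.
Qed.

(* If the displacement has zero derivative at the origin it has zero derivative everywhere,
   because [phi (s + t) p = phi s (phi t p)]. *)
Lemma one_parameter_fixed (phi : R -> Aut M) : continuous phi ->
  (forall s t, phi (s + t) = (phi s * phi t)%g) ->
  (forall e, 0 < e -> exists2 d, 0 < d &
    forall t, `|t| < d -> rn (disp (phi t)) <= e * `|t|) ->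
  exists2 d, 0 < d & forall t, `|t| < d -> Aut_fun (phi t) p = p.
Proof.
move=> pc padd small; have p1 : phi 0 = 1%g.
  by apply: (@mulgI _ (phi 0)); rewrite -padd addr0 mulg1.
have [[U V] /= [/nbhs_ballP[d1 /= d10 U1] /nbhs_ballP[d2 /= d20 V2]] UV] :=
  disp_mul pc pc p1 p1 (ltr01 : 0 < 1).
have /nbhs_ballP[d3 /= d30 P3] := disp_small pc p1 (ltr01 : 0 < 1).
exists (Num.min d1 d3); first by rewrite lt_min d10.
move=> t; rewrite lt_min => /andP[td1 td3].
have [dt _] : chart_dom c (Aut_fun (phi t) p) /\ rn (disp (phi t)) <= 1.
  by apply: P3; rewrite /ball /= sub0r normrN.
suff D0 : disp (phi t) = 0.
  by rewrite -[LHS](chart_toK dt) -[RHS](chart_toK cp); congr chart_from; apply/eqP;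
     rewrite -subr_eq0; apply/eqP.
apply: rn_eq0; apply/eqP; rewrite eq_le rn_ge0 andbT.
apply/ler_addgt0Pr => e e0; rewrite add0r.
have k0 : 0 < 2 * (`|t| + 1) by rewrite mulr_gt0 // ltr_wpDl.
have [d d0 dP] := small (e / (2 * (`|t| + 1))) (divr_gt0 e0 k0).
have m0 : 0 < Num.min d d2 by rewrite lt_min d0.
(* The time [t] is cut into [N] equal steps [s], short enough for [small] and [disp_mul]. Each adds
   at most [2 |disp (phi s)|], in total at most [e |t| / (|t| + 1)]; hence the divisor [2 (|t| + 1)]
   above. *)
have [N N0 NP] : exists2 N : nat, (0 < N)%N & `|t| / N%:R < Num.min d d2.
  exists (Num.truncn (`|t| / Num.min d d2)).+1 => //.
  by rewrite ltr_pdivrMr // mulrC -ltr_pdivrMr // truncnS_gt.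
move: NP; rewrite lt_min => /andP[Nd Nd2].
have NR : 0 < N%:R :> R by rewrite ltr0n.
set s := t / N%:R.
have sE : `|s| = `|t| / N%:R by rewrite normrM normfV (gtr0_norm NR).
rewrite -sE in Nd Nd2.
have Ds : rn (disp (phi s)) <= e / (2 * (`|t| + 1)) * `|s| by exact: dP.
have mult k : (k <= N)%N -> rn (disp (phi (k%:R * s))) <= k%:R * (2 * rn (disp (phi s))).
  elim: k => [|k IH] kN; first by rewrite !mul0r p1 disp1 rn0.
  rewrite -natr1 !mulrDl !mul1r padd; have := IH (ltnW kN).
  have ks : `|k%:R * s| < d1.
    rewrite normrM ger0_norm // sE; apply: le_lt_trans td1.
    rewrite mulrCA ler_piMr // ler_pdivrMr // mul1r ler_nat; exact: ltnW.
  have := UV (k%:R * s, s); rewrite /= mul1r => H.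
  have u1 : U (k%:R * s) by apply: U1; rewrite /ball /= sub0r normrN.
  have v1 : V s by apply: V2; rewrite /ball /= sub0r normrN.
  have {}H := H (conj u1 v1).
  set A := disp _ in H *; set B := disp _ in H *; set E := disp _ in H * => hB.
  have -> : A = (A - B - E) + (B + E) by rewrite -[A - B - E]addrA -opprD subrK.
  apply: le_trans (rnD _ _) _; have := rnD B E; clear -H hB; lra.
have tE : t = N%:R * s by rewrite /s mulrC divfK // gt_eqF.
rewrite tE; apply: le_trans (mult N (leqnn N)) _.
have h1 : N%:R * (2 * rn (disp (phi s))) <= N%:R * (2 * (e / (2 * (`|t| + 1)) * `|s|)).
  by apply: ler_wpM2l; [exact: ltW|apply: ler_wpM2l].
apply: le_trans h1 _; rewrite sE.
have -> : N%:R * (2 * (e / (2 * (`|t| + 1)) * (`|t| / N%:R))) = e * (`|t| / (`|t| + 1)).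
  by field; rewrite gt_eqF //= gt_eqF // ltr_wpDl.
apply: ler_piMr; first exact: ltW.
by rewrite ler_pdivrMr ?ltr_wpDl // mul1r lerDl.
Qed.

End Displacement.

(** * First-order expansions of displacements *)

Section Expansion.
Context {R : realType} {n : nat} {M : complexManifold R n}.
Local Notation C := (Cplx R).
Variables (X : topologicalType) (x0 : X) (N : X -> R).
Hypothesis N_ge0 : forall x, 0 <= N x.
Hypothesis N_small : forall e, 0 < e -> \forall x \near x0, N x <= e.

(** [B] is a principal part of [f] relative to the gauge [N], which will be [|t|] along a
    one-parameter group and the norm on the polydisc. *)
Definition expands (f B : X -> 'rV[C]_n) :=
  (exists k, forall x, rn (B x) <= k * N x) /\
  forall e, 0 < e -> \forall x \near x0, rn (f x - B x) <= e * N x.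

Lemma near_diag (P : X -> X -> Prop) :
  (\forall x \near x0 & y \near x0, P x y) -> \forall x \near x0, P x x.
Proof.
move=> [[U V] [/= Ux Vx] UV]; apply: filterS2 Ux Vx => x Ux Vx.
exact: (UV (x, x) (conj Ux Vx)).
Qed.

Lemma expands_near f B k : (forall x, rn (B x) <= k * N x) -> expands f B ->
  \forall x \near x0, rn (f x) <= (k + 1) * N x.
Proof.
move=> Bk [_ /(_ 1 ltr01)]; apply: filterS => x fB.
have := Bk x; have := rnD (f x - B x) (B x); rewrite subrK; lra.
Qed.

(** The error in [disp_mul] is relative to the displacement by [h], which its own expansion bounds
    by a multiple of [N]. *)
Lemma expands_disp_mul (c : chart R n M) (p : M) (Ac : cm_atlas c) (cp : chart_dom c p)
    (g h : X -> Aut M) (B E : X -> 'rV[C]_n) :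
  continuous g -> continuous h -> g x0 = 1%g -> h x0 = 1%g ->
  expands (fun x => disp c p (g x)) B -> expands (fun x => disp c p (h x)) E ->
  expands (fun x => disp c p (g x * h x)%g) (fun x => B x + E x).
Proof.
move=> gc hc g1 h1 eB eE; have [[k kB] HB] := eB; have [[l lE] HE] := eE; split.
  by exists (k + l) => x; apply: le_trans (rnD _ _) _; have := kB x; have := lE x; lra.
move=> e e0; have e3 : 0 < e / 3 by rewrite divr_gt0.
pose m := `|l| + 1; have m0 : 0 < m by rewrite ltr_wpDl.
have lE' x : rn (E x) <= m * N x.
  apply: le_trans (lE x) _; rewrite ler_wpM2r //.
  by apply: le_trans (ler_norm l) _; rewrite lerDl.
have eta0 : 0 < e / 3 / (m + 1) by rewrite divr_gt0 // addr_gt0.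
have D := near_diag (disp_mul Ac cp gc hc g1 h1 eta0).
near=> x.
have d : rn (disp c p (g x * h x)%g - disp c p (g x) - disp c p (h x)) <=
  e / 3 / (m + 1) * rn (disp c p (h x)) by near: x.
have hx : rn (disp c p (h x)) <= (m + 1) * N x by near: x; apply: expands_near eE.
have b : rn (disp c p (g x) - B x) <= e / 3 * N x by near: x; exact: HB.
have f : rn (disp c p (h x) - E x) <= e / 3 * N x by near: x; exact: HE.
have d' : rn (disp c p (g x * h x)%g - disp c p (g x) - disp c p (h x)) <= e / 3 * N x.
  apply: le_trans d _; have -> : e / 3 * N x = e / 3 / (m + 1) * ((m + 1) * N x).
    by field; rewrite gt_eqF // addr_gt0.
  by rewrite ler_wpM2l // ltW.
set P := disp c p (g x * h x)%g in d' *; set Q := disp _ _ _ in b d' *.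
set S := disp _ _ _ in f d' *.
have -> : P - (B x + E x) = (P - Q - S) + ((Q - B x) + (S - E x)).
  by apply/rowP => j; rewrite !mxE; ring.
apply: le_trans (rnD _ _) _; have := rnD (Q - B x) (S - E x); clear -d' b f; lra.
Unshelve. all: by end_near. Qed.

(** A chain rule: in the time of a one-parameter group, [s] may be replaced by its principal part
    [l]. *)
Lemma expands_one_parameter (c : chart R n M) (p : M) (phi : R -> Aut M) (v : 'rV[C]_n)
    (s l : X -> R) k :
  (forall e, 0 < e -> exists2 d, 0 < d &
    forall t, `|t| < d -> rn (disp c p (phi t) - (t%:C%C : C) *: v) <= e * `|t|) ->
  (forall x, `|l x| <= k * N x) ->
  (forall e, 0 < e -> \forall x \near x0, `|s x - l x| <= e * N x) ->
  expands (fun x => disp c p (phi (s x))) (fun x => ((l x)%:C%C : C) *: v).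
Proof.
move=> dphi lk sl; split.
  exists (k * rn v) => x; rewrite rnZ rn_real mulrAC.
  by rewrite ler_wpM2r // rn_ge0.
move=> e e0; pose m := `|k| + 1; have m0 : 0 < m by rewrite ltr_wpDl.
have lk' x : `|l x| <= m * N x.
  apply: le_trans (lk x) _; rewrite ler_wpM2r //.
  by apply: le_trans (ler_norm k) _; rewrite lerDl.
have v0 : 0 < rn v + 1 by rewrite ltr_wpDl // rn_ge0.
have m1 : 0 < m + 1 by rewrite addr_gt0.
have e2 := half_gt0 e0.
have [d d0 dP] := dphi _ (divr_gt0 e2 m1).
near=> x.
have s1 : `|s x - l x| <= 1 * N x by near: x; exact: sl.
have s2 : `|s x - l x| <= e / 2 / (rn v + 1) * N x.
  by near: x; apply: sl; rewrite divr_gt0.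
have Nd : N x <= d / 2 / (m + 1).
  by near: x; apply: N_small; rewrite !divr_gt0.
have sm : `|s x| <= (m + 1) * N x.
  rewrite -(subrK (l x) (s x)); apply: le_trans (ler_normD _ _) _.
  by have := lk' x; lra.
have sd : `|s x| < d.
  apply: le_lt_trans sm _; rewrite mulrC; move: Nd; rewrite ler_pdivlMr //; lra.
have := dP _ sd => h1.
have h2 : e / 2 / (m + 1) * `|s x| <= e / 2 * N x.
  have -> : e / 2 * N x = e / 2 / (m + 1) * ((m + 1) * N x) by field; rewrite gt_eqF.
  by rewrite ler_wpM2l // ltW // divr_gt0.
have h3 : rn (((s x - l x)%:C%C : C) *: v) <= e / 2 * N x.
  rewrite rnZ rn_real; have -> : e / 2 * N x = e / 2 / (rn v + 1) * N x * (rn v + 1).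
    by field; rewrite gt_eqF.
  by apply: ler_pM => //; rewrite ?rn_ge0 ?lerDl ?ler01.
have -> : disp c p (phi (s x)) - ((l x)%:C%C : C) *: v =
  (disp c p (phi (s x)) - ((s x)%:C%C : C) *: v) + ((s x - l x)%:C%C : C) *: v.
  by apply/rowP => j; rewrite rmorphB !mxE; ring.
apply: le_trans (rnD _ _) _; lra.
Unshelve. all: by end_near. Qed.

End Expansion.

(** * Linear parts of the AN coordinates at the origin *)

Section ANCoordinates.
Context {R : realType}.
Local Notation C := (Cplx R).

Lemma rn_sub1 (w : C) : rn (1 - w) ^+ 2 = 1 - 2 * complex.Re w + rn w ^+ 2.
Proof. by rewrite !rn_sqr; case: w => x y /=; ring. Qed.

Lemma an_u_expand (e : R) : 0 < e -> exists2 d, 0 < d & forall w : C, rn w < d ->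
  `|an_u w - - 2 * complex.Im w| <= e * rn w.
Proof.
(* On this ball [|1 - w|^2 >= 1/4], so the error is at most [4 * 2 |w| * 3 |w| = 24 |w|^2]. *)
move=> e0; pose d := Num.min (1 / 4) (e / 24).
have d0 : 0 < d by rewrite lt_min !divr_gt0.
exists d => // w; rewrite lt_min => /andP[w4 we].
have W0 := rn_ge0 w; have Re := rn_Re w; have Im := rn_Im w.
have m2 : 1 / 4 <= rn (1 - w) ^+ 2.
  rewrite rn_sub1; move: Re; rewrite ler_norml => /andP[_ h].
  by have := sqr_ge0 (rn w); lra.
have m0 : 0 < rn (1 - w) ^+ 2 by lra.
have -> : an_u w - - 2 * complex.Im w =
   2 * complex.Im w * (rn (1 - w) ^+ 2 - 1) / rn (1 - w) ^+ 2.
  by rewrite /an_u; set m := rn (1 - w) ^+ 2 in m0 *; field; rewrite gt_eqF.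
rewrite !normrM normfV [`|_ ^+ 2 : R|]gtr0_norm // ler_pdivrMr // (gtr0_norm (ltr0n _ 2)).
have : `|rn (1 - w) ^+ 2 - 1| <= 3 * rn w.
  rewrite rn_sub1; have w2 : rn w ^+ 2 <= 1 * rn w by rewrite expr2 ler_wpM2r //; lra.
  have := sqr_ge0 (rn w); move: Re; rewrite !ler_norml => /andP[? ?] ?.
  by apply/andP; split; lra.
move=> h; have h1 : 2 * `|complex.Im w| * `|rn (1 - w) ^+ 2 - 1| <= 2 * rn w * (3 * rn w).
  by rewrite ler_pM // ?mulr_ge0 // ler_wpM2l.
apply: le_trans h1 _.
have h2 : rn w * (24 * rn w) <= rn w * e by rewrite ler_wpM2l //; lra.
have h3 : e * rn w * (1 / 4) <= e * rn w * rn (1 - w) ^+ 2.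
  by rewrite ler_wpM2l // mulr_ge0 // ltW.
lra.
Qed.

Lemma an_s_expand (e : R) : 0 < e -> exists2 d, 0 < d & forall w : C, rn w < d ->
  `|an_s w - 2 * complex.Re w| <= e * rn w.
Proof.
(* The precision is [e / 32]: the increment [h] of the logarithm's argument is at most [16 |w|],
   which leaves [e / 2] for the error of [h] itself. *)
move=> e0; have [r r0 rP] := is_derive_approx (@is_derive1_ln R 1 ltr01) (half_gt0 (half_gt0 (half_gt0 (half_gt0 (half_gt0 e0))))).
have [d1 d10 d1P] : exists2 d : R, 0 < d & [/\ d <= 1 / 4, d <= r / 16 & d <= e / 80].
  exists (Num.min (1 / 4) (Num.min (r / 16) (e / 80))); first by rewrite !lt_min !divr_gt0.
  by split; rewrite !ge_min lexx ?orbT.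
case: d1P => d14 d1r d1e; exists d1 => // w wd.
have W0 := rn_ge0 w; have Re := rn_Re w.
have m2 : 1 / 4 <= rn (1 - w) ^+ 2.
  rewrite rn_sub1; move: Re; rewrite ler_norml => /andP[_ h].
  by have := sqr_ge0 (rn w); lra.
have m0 : 0 < rn (1 - w) ^+ 2 by lra.
set h := (2 * complex.Re w - 2 * rn w ^+ 2) / rn (1 - w) ^+ 2.
have sE : an_s w = ln (1 + h).
  by congr ln; rewrite /h rn_sub1 in m0 *; field; rewrite gt_eqF.
have w2 : rn w ^+ 2 <= 1 * rn w by rewrite expr2 ler_wpM2r //; lra.
have w20 := sqr_ge0 (rn w).
have hb : `|h| <= 16 * rn w.
  rewrite /h normrM normfV (gtr0_norm m0) ler_pdivrMr //.
  have h1 : `|2 * complex.Re w - 2 * rn w ^+ 2| <= 4 * rn w.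
    by move: Re; rewrite !ler_norml => /andP[? ?]; apply/andP; split; lra.
  have h2 : 16 * rn w * (1 / 4) <= 16 * rn w * rn (1 - w) ^+ 2.
    by rewrite ler_wpM2l // mulr_ge0.
  lra.
have hr : `|h| < r by lra.
have := rP h hr; rewrite ln1 invr1 mul1r subr0 -sE => h1.
have h2 : `|h - 2 * complex.Re w| <= 40 * (rn w * rn w).
  have -> : h - 2 * complex.Re w =
      (2 * complex.Re w * (1 - rn (1 - w) ^+ 2) - 2 * rn w ^+ 2) / rn (1 - w) ^+ 2.
    by rewrite /h; set m := rn (1 - w) ^+ 2 in m0 *; field; rewrite gt_eqF.
  rewrite normrM normfV (gtr0_norm m0) ler_pdivrMr //.
  have h3 : `|1 - rn (1 - w) ^+ 2| <= 3 * rn w.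
    rewrite rn_sub1; move: Re; rewrite !ler_norml => /andP[? ?].
    by apply/andP; split; lra.
  have h4 : `|2 * complex.Re w * (1 - rn (1 - w) ^+ 2)| <= 2 * rn w * (3 * rn w).
    by rewrite !normrM (gtr0_norm (ltr0n _ 2)) ler_pM // ?mulr_ge0 // ler_wpM2l.
  have h5 : 40 * (rn w * rn w) * (1 / 4) <= 40 * (rn w * rn w) * rn (1 - w) ^+ 2.
    by rewrite ler_wpM2l // !mulr_ge0.
  apply: le_trans (ler_normB _ _) _; rewrite [`|2 * rn w ^+ 2|]ger0_norm ?mulr_ge0 //.
  by rewrite expr2 in w20 *; lra.
have h6 : 40 * (rn w * rn w) <= e / 2 * rn w.
  by rewrite mulrA ler_wpM2r //; lra.
have h7 : e / 2 / 2 / 2 / 2 / 2 * `|h| <= e / 2 / 2 / 2 / 2 / 2 * (16 * rn w).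
  by rewrite ler_wpM2l // !divr_ge0 // ltW.
rewrite -(subrKA h); apply: le_trans (ler_normD _ _) _; lra.
Qed.

End ANCoordinates.

Lemma cst_for_continuous (X T : topologicalType) (k : T) (x : X) : {for x, continuous (fun _ : X => k)}.
Proof. exact: cst_continuous. Qed.

Lemma continuous_for (X T : topologicalType) (f : X -> T) (x : X) :
  continuous f -> {for x, continuous f}.
Proof. by move=> cf; exact: cf. Qed.
Arguments continuous_for {X T f} x _.
Arguments cst_for_continuous {X T} k x.

Lemma continuous_of_for (X T : topologicalType) (f : X -> T) :
  (forall x, {for x, continuous f}) -> continuous f.
Proof. by move=> cf x; exact: cf. Qed.

Lemma continuous_left (X Y T : topologicalType) (f : X * Y -> T) (y : Y) :
  continuous f -> continuous (fun x => f (x, y)).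
Proof.
move=> cf x U fU; have [[V W] /= [Vx Wy] VWU] := cf (x, y) U fU.
have Vx' : nbhs x V := Vx; apply: filterS Vx' => x' Vx'; apply: (VWU (x', y)).
by split => //; exact: nbhs_singleton.
Qed.

(** * Continuous families in SU(1,1)^n and the parametrization of AN^n by the polydisc *)

Section ContinuousFamilies.
Context {R : realType} {n : nat}.
Local Notation C := (Cplx R).
Local Notation D := (polydisc R n).
Local Notation G := ('I_n -> su (R := R)).
Implicit Types X : topologicalType.

Lemma Complex_continuous2 X (f g : X -> R) : continuous f -> continuous g ->
  continuous (fun x => Complex (f x) (g x) : C).
Proof.
move=> cf cg x; apply: (@continuous_comp _ _ _ (fun x => (f x, g x))
  (fun p : R * R => Complex p.1 p.2 : C)); last exact: complex_continuous.
move=> U [[V W] /= [Vx Wx] VWU].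
have h1 : nbhs x (f @^-1` V) by exact: cf.
have h2 : nbhs x (g @^-1` W) by exact: cg.
by apply: filterS2 h1 h2 => y Vy Wy; exact: (VWU (f y, g y)).
Qed.

Definition su_cont X (h : X -> su (R := R)) :=
  continuous (fun x => sa (h x)) /\ continuous (fun x => sb (h x)).

Lemma su_cont_mul X (g h : X -> su (R := R)) : su_cont g -> su_cont h ->
  su_cont (fun x => sumul (g x) (h x)).
Proof.
have cc (f : X -> C) : continuous f -> continuous (fun y => cj (f y)).
  by move=> cf; apply: continuous_of_for => x; apply: (continuous_comp (continuous_for x cf)); exact: cj_continuous.
move=> [ga gb] [ha hb]; split; apply: continuous_of_for => x.
  exact: (continuousD (continuousM (continuous_for x ga) (continuous_for x ha)) (continuousM (continuous_for x gb) (continuous_for x (cc _ hb)))).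
exact: (continuousD (continuousM (continuous_for x ga) (continuous_for x hb)) (continuousM (continuous_for x gb) (continuous_for x (cc _ ha)))).
Qed.

Lemma su_cont_cst X (h : su) : su_cont (fun _ : X => h).
Proof. by split=> x; exact: cst_continuous. Qed.

Lemma su_cont_Tm X (u : X -> R) : continuous u -> su_cont (fun x => Tm (u x)).
Proof.
move=> cu; have cu2 : continuous (fun x => u x / 2).
  by apply: continuous_of_for => x; exact: (continuousM (continuous_for x cu) (cst_for_continuous _ _)).
split.
  rewrite (_ : (fun _ => _) = fun x => Complex 1 (u x / 2)); last first.
    by apply/funext => x; have [] := TmE (u x).
  by apply: Complex_continuous2 => //; apply: continuous_of_for => x; exact: cst_continuous.
rewrite (_ : (fun _ => _) = fun x => Complex 0 (- (u x / 2))); last first.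
  by apply/funext => x; have [] := TmE (u x).
apply: Complex_continuous2; apply: continuous_of_for => x; first exact: cst_continuous.
exact: (continuousN (continuous_for x cu2)).
Qed.

Lemma su_cont_Sm X (s : X -> R) : continuous s -> su_cont (fun x => Sm (s x)).
Proof.
move=> cs; have cs2 : continuous (fun x => s x / 2).
  by apply: continuous_of_for => x; exact: (continuousM (continuous_for x cs) (cst_for_continuous _ _)).
have ce : continuous (fun x => expR (s x / 2)).
  by apply: continuous_of_for => x; apply: (continuous_comp (continuous_for x cs2)); exact: continuous_expR.
have cf : continuous (fun x => expR (- (s x / 2))).
  apply: continuous_of_for => x; apply: (@continuous_comp _ _ _ (fun x => - (s x / 2)) expR).
    exact: (continuousN (continuous_for x cs2)).
  exact: continuous_expR.
split.
  rewrite (_ : (fun _ => _) = fun x => Complex ((expR (s x / 2) + expR (- (s x / 2))) / 2) 0);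
    last by apply/funext => x; have [] := SmE (s x).
  apply: Complex_continuous2; apply: continuous_of_for => x; last exact: cst_continuous.
  exact: (continuousM (continuousD (continuous_for x ce) (continuous_for x cf)) (cst_for_continuous _ _)).
rewrite (_ : (fun _ => _) = fun x => Complex ((expR (s x / 2) - expR (- (s x / 2))) / 2) 0);
  last by apply/funext => x; have [] := SmE (s x).
apply: Complex_continuous2; apply: continuous_of_for => x; last exact: cst_continuous.
exact: (continuousM (continuousB (continuous_for x ce) (continuous_for x cf)) (cst_for_continuous _ _)).
Qed.

Lemma gcont_mul X (g h : X -> G) : gcont g -> gcont h -> gcont (fun x => gmul (g x) (h x)).
Proof. by move=> cg ch j; exact: su_cont_mul. Qed.

Lemma gcont_cst X (h : G) : gcont (fun _ : X => h).
Proof. by move=> j; exact: su_cont_cst. Qed.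

Definition single (j : 'I_n) (x : su (R := R)) : G := fun i => if i == j then x else suone.

Lemma gcont_single X j (h : X -> su) : su_cont h -> gcont (fun x => single j (h x)).
Proof.
by move=> ch i; rewrite /single; case: (i == j); [exact: ch|exact: su_cont_cst].
Qed.

Lemma singleM j x y : single j (sumul x y) = gmul (single j x) (single j y).
Proof. by apply/funext => i; rewrite /single /gmul; case: eqP => // _; rewrite sumul1. Qed.

(* The element of AN^n with second-kind coordinates [(u, s)], restricted to the indices in [r]. *)
Definition TS (u s : 'I_n -> R) (r : seq 'I_n) : G :=
  foldr (fun j g => gmul (gmul (single j (Tm (u j))) (single j (Sm (s j)))) g) gone r.

Lemma TSE u s r i : uniq r ->
  TS u s r i = if i \in r then sumul (Tm (u i)) (Sm (s i)) else suone.
Proof.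
elim: r => //= j r IH /andP[jr ur]; rewrite /gmul IH // in_cons /single.
case: eqP => [->|_] /=; first by rewrite (negbTE jr) sumul1.
by rewrite !su1mul.
Qed.

Lemma gcont_TS X (u s : 'I_n -> X -> R) r : (forall j, continuous (u j)) ->
  (forall j, continuous (s j)) -> gcont (fun x => TS (u^~ x) (s^~ x) r).
Proof.
move=> cu cs; elim: r => [|j r IH]; first exact: gcont_cst.
exact: (gcont_mul (gcont_mul (gcont_single j (su_cont_Tm (cu j)))
  (gcont_single j (su_cont_Sm (cs j)))) IH).
Qed.

Lemma TS0 r : TS (fun=> 0) (fun=> 0) r = gone.
Proof.
elim: r => //= j r ->; rewrite gmul1 Tm0 Sm0 -singleM sumul1.
by apply/funext => i; rewrite /single; case: eqP.
Qed.

Definition anG (p : D) : G := fun j => an (pemb p ord0 j).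

Definition orig : D := pret 0.

Lemma pemb_orig : pemb orig = 0.
Proof. by rewrite pretK // => j; rewrite mxE rn0 ltr01. Qed.

Lemma anG_TS p : anG p = TS (fun j => an_u (pemb p ord0 j)) (fun j => an_s (pemb p ord0 j))
   (enum 'I_n).
Proof.
apply/funext => i; rewrite TSE ?enum_uniq // mem_enum /=.
exact: an_decomp (pemb_lt1 _ _).
Qed.

Lemma Im_continuous : continuous (fun z : C => complex.Im z).
Proof.
move=> a U /nbhs_ballP[e /= e0 eU]; apply/(@nbhs_rnP R C); exists e => // b ba.
by apply: eU; rewrite /ball /= -cImB; apply: le_lt_trans (rn_Im _) _; rewrite rn_sub.
Qed.

Lemma rn_sub1_continuous j : continuous (fun p : D => rn (1 - pemb p ord0 j) ^+ 2).
Proof.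
apply: continuous_of_for => p; have c1 : {for p, continuous (fun p : D => rn (1 - pemb p ord0 j))}.
  apply: (@continuous_comp _ _ _ (fun p : D => 1 - pemb p ord0 j) (@rn R C)).
    exact: (continuousB (cst_for_continuous _ _) (continuous_for p (@pemb_coord_continuous _ _ j))).
  exact: rn_continuous.
exact: (continuousM c1 c1).
Qed.

Lemma an_u_continuous j : continuous (fun p : D => an_u (pemb p ord0 j)).
Proof.
apply: continuous_of_for => p; have ci : {for p, continuous (fun p : D => complex.Im (pemb p ord0 j))}.
  apply: (@continuous_comp _ _ _ (fun p : D => pemb p ord0 j) (fun z : C => complex.Im z)).
    exact: pemb_coord_continuous.
  exact: Im_continuous.
have n0 : rn (1 - pemb p ord0 j) ^+ 2 != 0.
  by have [_ h] := disc_facts (pemb_lt1 p j); rewrite sqrf_eq0 gt_eqF.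
have c2 := continuousV (n0 : (fun p : D => rn (1 - pemb p ord0 j) ^+ 2) p != 0)
  (continuous_for p (@rn_sub1_continuous j)).
exact: (continuousM (continuousN (continuousM (cst_for_continuous (2 : R) p) ci)) c2).
Qed.

Lemma an_s_continuous j : continuous (fun p : D => an_s (pemb p ord0 j)).
Proof.
apply: continuous_of_for => p; have [h1 h2] := disc_facts (pemb_lt1 p j).
have c0 : {for p, continuous (fun p : D => rn (pemb p ord0 j))}.
  apply: (@continuous_comp _ _ _ (fun p : D => pemb p ord0 j) (@rn R C)).
    exact: pemb_coord_continuous.
  exact: rn_continuous.
apply: (@continuous_comp _ _ _
  (fun p : D => (1 - rn (pemb p ord0 j) ^+ 2) / rn (1 - pemb p ord0 j) ^+ 2) (@ln R)).
  have n0 : rn (1 - pemb p ord0 j) ^+ 2 != 0 by rewrite sqrf_eq0 gt_eqF.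
  have c2 := continuousV (n0 : (fun p : D => rn (1 - pemb p ord0 j) ^+ 2) p != 0)
    (continuous_for p (@rn_sub1_continuous j)).
  exact: (continuousM (continuousB (cst_for_continuous (1 : R) p) (continuousM c0 c0)) c2).
by apply: continuous_ln; rewrite divr_gt0 // exprn_gt0.
Qed.

Lemma anG_cont : gcont anG.
Proof.
rewrite (_ : anG = fun p => TS (fun j => an_u (pemb p ord0 j)) (fun j => an_s (pemb p ord0 j))
   (enum 'I_n)); last by apply/funext => p; exact: anG_TS.
by apply: gcont_TS; [exact: an_u_continuous|exact: an_s_continuous].
Qed.

Definition isANG (g : G) := forall j, isAN (g j).

Lemma anG_AN p : isANG (anG p).
Proof. by move=> j; apply: an_AN; exact: pemb_lt1. Qed.

Lemma mobG_orig g j : pemb (mobG g orig) ord0 j = w0 (g j).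
Proof. by rewrite pemb_mobG pemb_orig mxE mob_0. Qed.

Lemma anG_orig p : mobG (anG p) orig = p.
Proof.
apply: (can_inj pembK); apply/rowP => j.
by rewrite mobG_orig w0_an // pemb_lt1.
Qed.

Lemma anG_of g : isANG g -> anG (mobG g orig) = g.
Proof. by move=> ANg; apply/funext => j; rewrite /anG mobG_orig an_w0. Qed.

(** Both sides lie in AN^n and send the origin to the same point. *)
Lemma anG_mul w v : gmul (anG w) (anG v) = anG (mobG (anG w) v).
Proof.
have AN2 : isANG (gmul (anG w) (anG v)) by move=> j; apply: AN_mul; exact: anG_AN.
by rewrite -[LHS]anG_of // mobGM anG_orig.
Qed.

Lemma anG_o : anG orig = gone.
Proof. by apply/funext => j; rewrite /anG pemb_orig mxE an0. Qed.

Lemma anG_inv w : isANG (ginv (anG w)).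
Proof. by move=> j; apply: AN_inv; exact: anG_AN. Qed.

End ContinuousFamilies.

(** * The action transported to M *)

Section Action.
Context {R : realType} {n : nat} {M : complexManifold R n}.
Local Notation C := (Cplx R).
Local Notation D := (polydisc R n).
Local Notation G := ('I_n -> su (R := R)).
Variables (phi : Aut M -> Aut D) (psi : Aut D -> Aut M).
Hypotheses (phiM : {morph phi : g h / (g * h)%g}) (phiK : cancel phi psi)
  (psiK : cancel psi phi) (phi_cont : continuous phi) (psi_cont : continuous psi).
Hypothesis M_isotropy : forall p : M, compact (isotropy p).

(* The action of [SU(1,1)^n] on the polydisc, transported to [M]. *)
Definition rho (g : G) : Aut M := psi (mobA g).

Lemma rhoM g h : rho (gmul g h) = (rho g * rho h)%g.
Proof. by apply: (can_inj phiK); rewrite phiM !psiK mobAM. Qed.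

Lemma rho1 : rho gone = 1%g.
Proof. by apply: (@mulgI _ (rho gone)); rewrite -rhoM gmul1 mulg1. Qed.

Lemma rho_cont (X : topologicalType) (g : X -> G) : gcont g -> continuous (fun x => rho (g x)).
Proof.
move=> /mobA_continuous gc; apply: continuous_of_for => x.
exact: continuous_comp (continuous_for x gc) (continuous_for _ psi_cont).
Qed.

Lemma rho_inv g p q : Aut_fun (rho g) p = q -> p = Aut_fun (rho (ginv g)) q.
Proof. by move=> <-; rewrite -Aut_funM -rhoM gVmul rho1. Qed.

Lemma rho_act g h p : Aut_fun (rho (gmul g h)) p = Aut_fun (rho g) (Aut_fun (rho h) p).
Proof. by rewrite rhoM. Qed.

Definition gpow (g : G) k : G := fun j => supow (g j) k.

Lemma gpow_fix g p k : Aut_fun (rho g) p = p -> Aut_fun (rho (gpow g k)) p = p.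
Proof.
move=> gp; elim: k => [|k IH].
  by rewrite (_ : gpow g 0 = gone) // rho1.
by rewrite (_ : gpow g k.+1 = gmul (gpow g k) g) // rho_act gp.
Qed.

(** The norm of the image of the origin under [phi a] is continuous in [a], so it attains a maximum
    on the compact isotropy group, and every value is below 1. *)
Lemma isotropy_bounded p : exists2 r : R, r < 1 &
  forall g, Aut_fun (rho g) p = p -> forall j, rn (w0 (g j)) <= r.
Proof.
pose ev (a : Aut M) : R := rn (pemb (Aut_fun (phi a) orig)).
have evc : continuous ev.
  have c1 := continuous_left (y := orig) (@Aut_eval_continuous R n D _ _ phi_cont).
  apply: continuous_of_for => a; have c2 := continuous_comp (continuous_for a c1) (continuous_for _ (@pemb_continuous R n)).
  exact: continuous_comp c2 (continuous_for _ (@rn_continuous R 'rV[C]_n)).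
have i0 : isotropy p !=set0 by exists 1%g.
have [a _ aP] := compact_EVT_max i0 (@M_isotropy p) (continuous_subspaceT evc).
exists (ev a).
  by apply/rn_rV_lt => // j; exact: pemb_lt1.
move=> g gp j; have := aP (rho g) (mem_set gp); rewrite /ev /rho psiK => h.
apply: le_trans h; rewrite -mobG_orig; exact: rn_coord.
Qed.

(** All powers of [g] fix [p], so they move the origin within one ball of radius below 1. *)
Lemma isotropy_elliptic p g : Aut_fun (rho g) p = p ->
  forall j, pm_one (g j) \/ complex.Re (sa (g j)) ^+ 2 < 1.
Proof.
move=> gp j; have [r r1 rP] := isotropy_bounded p.
by apply: (bounded_powers r1) => k; apply: (rP (gpow g k)); exact: gpow_fix.
Qed.

Lemma AN_free p g : isANG g -> Aut_fun (rho g) p = p -> g = gone.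
Proof.
move=> ANg gp; apply/funext => j.
have [|lt1] := isotropy_elliptic gp j; first exact: AN_pm_one.
by exfalso; have := AN_not_elliptic (ANg j); lra.
Qed.

Section Displacements.
Variables (c : chart R n M) (p : M) (Ac : cm_atlas c) (cp : chart_dom c p).

Definition derivative_at0 (f : R -> Aut M) (v : 'rV[C]_n) := forall e, 0 < e ->
  exists2 d, 0 < d & forall t, `|t| < d -> rn (disp c p (f t) - (t%:C%C : C) *: v) <= e * `|t|.

(** The parameter space is arbitrary because the expansion serves twice: along one-parameter groups
    of AN^n, and for the orbit map on the polydisc. *)
Lemma TS_expands (vT vS : 'I_n -> 'rV[C]_n) (X : topologicalType) (x0 : X) (N : X -> R)
    (u s lu ls : 'I_n -> X -> R) (k : R) (r : seq 'I_n) :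
  (forall j, derivative_at0 (fun t => rho (single j (Tm t))) (vT j)) ->
  (forall j, derivative_at0 (fun t => rho (single j (Sm t))) (vS j)) ->
  (forall x, 0 <= N x) -> (forall e, 0 < e -> \forall x \near x0, N x <= e) ->
  (forall j, continuous (u j)) -> (forall j, continuous (s j)) ->
  (forall j, u j x0 = 0) -> (forall j, s j x0 = 0) ->
  (forall j x, `|lu j x| <= k * N x) -> (forall j x, `|ls j x| <= k * N x) ->
  (forall j e, 0 < e -> \forall x \near x0, `|u j x - lu j x| <= e * N x) ->
  (forall j e, 0 < e -> \forall x \near x0, `|s j x - ls j x| <= e * N x) ->
  expands x0 N (fun x => disp c p (rho (TS (u^~ x) (s^~ x) r)))
    (fun x => \sum_(j <- r) (((lu j x)%:C%C : C) *: vT j + ((ls j x)%:C%C : C) *: vS j)).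
Proof.
move=> dT dS N0 Ns cu cs u0 s0 luN lsN ulu sls.
elim: r => [|j r IH].
  split; [exists 0|move=> e e0; near=> x]; first by move=> x; rewrite big_nil rn0 mul0r.
  by rewrite big_nil subr0 rho1 disp1 rn0 mulr_ge0 // ltW.
pose Tj x := rho (single j (Tm (u j x))); pose Sj x := rho (single j (Sm (s j x))).
pose Bj x := ((lu j x)%:C%C : C) *: vT j + ((ls j x)%:C%C : C) *: vS j.
rewrite [X in expands _ _ _ X](_ : _ = fun x => Bj x +
  \sum_(i <- r) (((lu i x)%:C%C : C) *: vT i + ((ls i x)%:C%C : C) *: vS i)); last first.
  by apply/funext => x; rewrite big_cons.
rewrite [X in expands _ _ X _](_ : _ = fun x =>
  disp c p (Tj x * Sj x * rho (TS (u^~ x) (s^~ x) r))%g); last first.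
  by apply/funext => x; rewrite /= !rhoM.
apply: expands_disp_mul => //.
- rewrite (_ : (fun _ => _) = fun x => rho (gmul (single j (Tm (u j x))) (single j (Sm (s j x))))).
    apply: rho_cont; apply: gcont_mul; apply: gcont_single;
      [exact: su_cont_Tm|exact: su_cont_Sm].
  by apply/funext => x; rewrite rhoM.
- by apply: rho_cont; exact: gcont_TS.
- by rewrite /Tj /Sj u0 s0 -rhoM Tm0 Sm0 -singleM sumul1 (_ : single _ _ = gone) ?rho1 //;
    apply/funext => i; rewrite /single; case: eqP.
- have -> : u^~ x0 = fun=> 0 by apply/funext => i; exact: u0.
  have -> : s^~ x0 = fun=> 0 by apply/funext => i; exact: s0.
  by rewrite TS0 rho1.
- have one (i : 'I_n) : single i suone = gone :> G.
    by apply/funext => l; rewrite /single; case: eqP.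
  apply: expands_disp_mul => //.
  + by apply: rho_cont; apply: gcont_single; exact: su_cont_Tm.
  + by apply: rho_cont; apply: gcont_single; exact: su_cont_Sm.
  + by rewrite /Tj u0 Tm0 one rho1.
  + by rewrite /Sj s0 Sm0 one rho1.
  + by apply: (expands_one_parameter N0 Ns (dT j) (luN j)) => e e0; exact: ulu.
  + by apply: (expands_one_parameter N0 Ns (dS j) (lsN j)) => e e0; exact: sls.
Unshelve. all: by end_near. Qed.

Lemma single_derivative j (f : R -> su) : su_cont f -> (forall s t, f (s + t) = sumul (f s) (f t)) ->
  exists v, derivative_at0 (fun t => rho (single j (f t))) v.
Proof.
move=> fc fM; apply: one_parameter_derivative => //.
  by apply: rho_cont; exact: gcont_single.
by move=> s t; rewrite fM singleM rhoM.
Qed.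

End Displacements.

(* [t |-> T (y k(t)) S (x t)] is the one-parameter group of AN with tangent vector [(y, x)]. *)
Definition an_time (x t : R) : R := if x == 0 then t else (expR (x * t) - 1) / x.

Lemma an_timeD x s t : an_time x (s + t) = an_time x s + expR (x * s) * an_time x t.
Proof.
rewrite /an_time; case: eqP => [->|/eqP x0]; first by rewrite mul0r expR0 mul1r.
by rewrite mulrDr expRD; field.
Qed.

Lemma an_time_cont x : continuous (an_time x).
Proof.
rewrite /an_time; case: (x == 0); first by move=> t; exact: id.
have cm : continuous (fun t => x * t) by exact: mulrl_continuous.
apply: continuous_of_for => t; have ce := continuous_comp (continuous_for t cm) (continuous_for _ (@continuous_expR R)).
exact: (continuousM (continuousB ce (cst_for_continuous (1 : R) t)) (cst_for_continuous (x^-1) t)).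
Qed.

Lemma an_time_expand x e : 0 < e -> exists2 d, 0 < d & forall t, `|t| < d ->
  `|an_time x t - t| <= e * `|t|.
Proof.
move=> e0; rewrite /an_time; case: eqP => [_|/eqP x0].
  by exists 1 => // t _; rewrite subrr normr0 mulr_ge0 // ltW.
have [d d0 dP] := is_derive_approx (is_derive_expR (0 : R)) e0.
have xp : 0 < `|x| by rewrite normr_gt0.
exists (d / `|x|); first exact: divr_gt0.
move=> t; rewrite ltr_pdivlMr // mulrC -normrM => /dP.
rewrite add0r expR0 mul1r => h.
have -> : (expR (x * t) - 1) / x - t = (expR (x * t) - 1 - x * t) / x by field.
by rewrite normrM normfV ler_pdivrMr // -mulrA -normrM [t * x]mulrC.
Qed.

(** If [A z = 0], the one-parameter group of AN^n tangent to [z] has zero velocity at [p]. It then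
    fixes [p] for short times, and freeness makes it trivial, so [z = 0]. *)
Lemma orbit_derivative (c : chart R n M) (p : M) : cm_atlas c -> chart_dom c p ->
  exists A : 'rV[C]_n -> 'rV[C]_n,
  [/\ forall x y, A (x + y) = A x + A y,
      forall (t : R) x, A ((t%:C%C : C) *: x) = (t%:C%C : C) *: A x,
      forall x, A x = 0 -> x = 0 &
      expands orig (fun w : D => rn (pemb w)) (fun w => disp c p (rho (anG w))) (fun w => A (pemb w))].
Proof.
move=> Ac cp.
have cid : continuous (fun t : R => t) by move=> t U.
have /choice[vT vTP] j := single_derivative Ac cp j (su_cont_Tm cid) (@TmD R).
have /choice[vS vSP] j := single_derivative Ac cp j (su_cont_Sm cid) (@SmD R).
(* The coefficients are the linear parts of [an_u] and [an_s] at the origin. *)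
pose A (z : 'rV[C]_n) := \sum_(j <- enum 'I_n)
  (((- 2 * complex.Im (z ord0 j))%:C%C : C) *: vT j + ((2 * complex.Re (z ord0 j))%:C%C : C) *: vS j).
exists A; split.
- move=> x y; rewrite /A -big_split; apply: eq_bigr => j _ /=.
  rewrite mxE addrACA -!scalerDl -!rmorphD /=.
  by case: (x ord0 j) (y ord0 j) => a b [a' b'] /=; rewrite !mulrDr.
- move=> t x; rewrite /A scaler_sumr; apply: eq_bigr => j _ /=.
  rewrite mxE scalerDr !scalerA -!rmorphM /=.
  by case: (x ord0 j) => a b /=; rewrite !mul0r subr0 addr0 ![t * (_ * _)]mulrCA.
- move=> z Az; pose a j := 2 * complex.Re (z ord0 j); pose y j := - 2 * complex.Im (z ord0 j).
  pose u j t := y j * an_time (a j) t; pose s j t := a j * t.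
  pose gam t : G := TS (u^~ t) (s^~ t) (enum 'I_n).
  have cs j : continuous (s j) by exact: mulrl_continuous.
  have cu j : continuous (u j).
    have cm : continuous (fun t => y j * t) by exact: mulrl_continuous.
    by apply: continuous_of_for => t; exact: continuous_comp (continuous_for t (@an_time_cont (a j))) (continuous_for _ cm).
  have gamE t j : gam t j = sumul (Tm (u j t)) (Sm (s j t)).
    by rewrite /gam TSE ?enum_uniq // mem_enum.
  have gamD t t' : rho (gam (t + t')) = (rho (gam t) * rho (gam t'))%g.
    rewrite -rhoM; congr rho; apply/funext => j; rewrite /gmul !gamE.
    rewrite /u /s an_timeD !mulrDr TmD SmD mulrCA -!sumulA; congr sumul.
    by rewrite !sumulA; congr sumul; rewrite Sm_Tm.
  have gamc : continuous (fun t => rho (gam t)) by apply: rho_cont; exact: gcont_TS.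
  pose k := \sum_j (`|y j| + `|a j|).
  have yk j : `|y j| + `|a j| <= k.
    by rewrite /k (bigD1 j) //= lerDl sumr_ge0 // => i _; rewrite addr_ge0.
  have ex : expands (0 : R) (fun t => `|t|) (fun t => disp c p (rho (gam t)))
    (fun t => \sum_(j <- enum 'I_n) (((y j * t)%:C%C : C) *: vT j + ((s j t)%:C%C : C) *: vS j)).
    apply: (@TS_expands c p Ac cp vT vS R 0 _ u s (fun j t => y j * t) s k) => //.
    + move=> e e0; apply/nbhs_ballP; exists e => // t.
      by rewrite /ball /= sub0r normrN => /ltW.
    + by move=> j; rewrite /u /an_time; case: eqP => _; rewrite ?mulr0 ?expR0 ?subrr ?mul0r ?mulr0.
    + by move=> j; rewrite /s mulr0.
    + by move=> j t; rewrite normrM ler_wpM2r // (le_trans _ (yk j)) // lerDl.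
    + by move=> j t; rewrite normrM ler_wpM2r // (le_trans _ (yk j)) // lerDr.
    + move=> j e e0; have y1 : 0 < `|y j| + 1 by rewrite ltr_wpDl.
      have [d d0 dP] := an_time_expand (a j) (divr_gt0 e0 y1).
      apply/nbhs_ballP; exists d => // t; rewrite /ball /= sub0r normrN => /dP h.
      rewrite /u -mulrBr normrM.
      have -> : e * `|t| = (`|y j| + 1) * (e / (`|y j| + 1) * `|t|) by field; rewrite gt_eqF.
      by apply: ler_pM => //; rewrite lerDl.
    + by move=> j e e0; near=> t; rewrite subrr normr0 mulr_ge0 // ltW.
  have [d d0 dP] : exists2 d, 0 < d & forall t, `|t| < d -> Aut_fun (rho (gam t)) p = p.
    apply: (one_parameter_fixed Ac cp gamc gamD) => e e0.
    have [_ /(_ e e0) /nbhs_ballP[d /= d0 dP]] := ex; exists d => // t td.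
    have := dP t; rewrite /ball /= sub0r normrN => /(_ td).
    have -> : \sum_(j <- enum 'I_n) (((y j * t)%:C%C : C) *: vT j + ((s j t)%:C%C : C) *: vS j) =
        (t%:C%C : C) *: A z.
      rewrite /A scaler_sumr; apply: eq_bigr => j _ /=.
      by rewrite scalerDr !scalerA -!rmorphM /= ![t * _]mulrC.
    by rewrite Az scaler0 subr0.
  have t0 : 0 < d / 2 by exact: half_gt0.
  have gam1 : gam (d / 2) = gone.
    apply: (@AN_free p); first by move=> j; rewrite gamE; apply: AN_mul; [exact: Tm_AN|exact: Sm_AN].
    by apply: dP; rewrite gtr0_norm //; lra.
  apply/rowP => j; rewrite mxE.
  have := congr1 (fun g : G => g j) gam1; rewrite gamE /gone => E.
  have [a2 b2] := TmE (u j (d / 2)); have [a3 b3] := SmE (s j (d / 2)).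
  have E1 := congr1 sa E; have E2 := congr1 sb E; move: E1 E2.
  rewrite /= a2 b2 a3 b3 !cjE /=; set e := expR _; set f := expR _ => E1 E2.
  have e1 : e = 1.
    have := congr1 (@complex.Re R) E1; have := congr1 (@complex.Re R) E2.
    by rewrite /=; lra.
  have f1 : f = 1.
    have := congr1 (@complex.Re R) E1; have := congr1 (@complex.Re R) E2.
    by rewrite /=; lra.
  have s0 : a j = 0.
    have : s j (d / 2) / 2 = 0 by apply: expR_inj; rewrite -/e e1 expR0.
    rewrite /s => h; have {}h : a j * (d / 2) = 0 by lra.
    by move/eqP: h; rewrite mulf_eq0 (gt_eqF t0) orbF => /eqP.
  have u0 : y j = 0.
    have := congr1 (@complex.Im R) E1; rewrite /= e1 f1 /u /an_time s0 eqxx => h.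
    have {}h : y j * (d / 2) = 0 by lra.
    by move/eqP: h; rewrite mulf_eq0 (gt_eqF t0) orbF => /eqP.
  apply: cplx_eq => /=; move: s0 u0; rewrite /a /y; lra.
- rewrite (_ : (fun w => disp c p _) = fun w => disp c p (rho (TS (fun j => an_u (pemb w ord0 j))
    (fun j => an_s (pemb w ord0 j)) (enum 'I_n)))); last by apply/funext => w; rewrite anG_TS.
  have near_w (P : C -> Prop) (j : 'I_n) (d : R) : 0 < d -> (forall w, rn w < d -> P w) ->
      \forall w \near orig, P (pemb w ord0 j).
    move=> d0 dP; have := @pemb_coord_continuous R n j orig [set w | rn w < d].
    rewrite /= pemb_orig mxE => H; have {H} : nbhs orig ((fun p0 : D => pemb p0 ord0 j) @^-1` [set w | rn w < d]).
      by apply: H; apply/(@nbhs_rnP R C); exists d => // w; rewrite subr0.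
    by apply: filterS => w /dP.
  have c2 (w : D) j : rn (pemb w ord0 j) <= rn (pemb w) by exact: rn_coord.
  apply: (@TS_expands c p Ac cp vT vS D orig (fun w => rn (pemb w)) (fun j w => an_u (pemb w ord0 j))
    (fun j w => an_s (pemb w ord0 j)) (fun j w => - 2 * complex.Im (pemb w ord0 j))
    (fun j w => 2 * complex.Re (pemb w ord0 j)) 2) => //.
  + by move=> w; exact: rn_ge0.
  + move=> e e0; pose S := [set z : 'rV[C]_n | rn z < e].
    have nS : nbhs (pemb orig : 'rV[C]_n) S.
      by rewrite pemb_orig; apply/nbhs_rnP; exists e => // z; rewrite subr0.
    have h : nbhs orig (pemb @^-1` S) by exact: (pemb_continuous nS).
    by apply: filterS h => w /ltW.
  + exact: an_u_continuous.
  + exact: an_s_continuous.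
  + by move=> j; rewrite pemb_orig mxE /an_u /= mulr0 oppr0 mul0r.
  + by move=> j; rewrite pemb_orig mxE /an_s subr0 rn0 rn1 expr0n expr1n subr0 divr1 ln1.
  + move=> j w; rewrite normrM normrN (gtr0_norm (ltr0n _ 2)) ler_wpM2l //.
    exact: le_trans (rn_Im _) (rn_coord _ _).
  + move=> j w; rewrite normrM (gtr0_norm (ltr0n _ 2)) ler_wpM2l //.
    exact: le_trans (rn_Re _) (rn_coord _ _).
  + move=> j e e0; have [d d0 dP] := @an_u_expand R e e0.
    have := near_w (fun w => `|an_u w - - 2 * complex.Im w| <= e * rn w) j d d0 dP.
    apply: filterS => w h; apply: le_trans h _; apply: ler_wpM2l; [exact: ltW|exact: rn_coord].
  + move=> j e e0; have [d d0 dP] := @an_s_expand R e e0.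
    have := near_w (fun w => `|an_s w - 2 * complex.Re w| <= e * rn w) j d d0 dP.
    apply: filterS => w h; apply: le_trans h _; apply: ler_wpM2l; [exact: ltW|exact: rn_coord].
Unshelve. all: by end_near. Qed.

End Action.

Section RealLinear.
Context {R : realType} {n : nat}.
Local Notation C := (Cplx R).
Variable A : 'rV[C]_n -> 'rV[C]_n.
Hypotheses (AD : forall x y, A (x + y) = A x + A y)
  (AZ : forall (t : R) x, A ((t%:C%C : C) *: x) = (t%:C%C : C) *: A x).

Lemma real_linear_sum (I : Type) (r : seq I) (F : I -> 'rV[C]_n) :
  A (\sum_(i <- r) F i) = \sum_(i <- r) A (F i).
Proof.
apply: (big_morph A AD); have := AZ 0 0.
by rewrite rmorph0 !scale0r.
Qed.

(** [A] is only real linear, so dimensions are counted over [R]: splitting into real and imaginary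
    parts gives a square real matrix with zero kernel. *)
Lemma real_linear_surjective : (forall x, A x = 0 -> x = 0) -> forall y, exists x, A x = y.
Proof.
move=> A0.
pose tor (z : 'rV[C]_n) : 'rV[R]_(n + n) :=
  row_mx (\row_j complex.Re (z ord0 j)) (\row_j complex.Im (z ord0 j)).
pose ofr (v : 'rV[R]_(n + n)) : 'rV[C]_n :=
  \row_j (Complex (v ord0 (lshift n j)) (v ord0 (rshift n j)) : C).
have torK z : ofr (tor z) = z.
  by apply/rowP => j; rewrite mxE /tor row_mxEl row_mxEr !mxE; case: (z ord0 j).
have ofrK v : tor (ofr v) = v.
  by apply/rowP => j; case: (split_ordP j) => k ->; rewrite /tor ?row_mxEl ?row_mxEr !mxE.
have torD x y : tor (x + y) = tor x + tor y.
  by rewrite /tor add_row_mx; congr row_mx; apply/rowP => j; rewrite !mxE;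
     case: (x ord0 j) (y ord0 j) => ? ? [].
have torZ (t : R) x : tor ((t%:C%C : C) *: x) = t *: tor x.
  rewrite /tor scale_row_mx; congr row_mx; apply/rowP => j; rewrite !mxE;
     case: (x ord0 j) => a b /=; ring.
have ofrD x y : ofr (x + y) = ofr x + ofr y by rewrite -[RHS]torK torD !ofrK.
have ofrZ (t : R) x : ofr (t *: x) = (t%:C%C : C) *: ofr x.
  by rewrite -[RHS]torK torZ !ofrK.
pose L v := tor (A (ofr v)).
have L0 : L 0 = 0.
  have := AZ 0 0; rewrite rmorph0 !scale0r => AA0.
  have o0 : ofr 0 = 0 by apply/rowP => j; rewrite !mxE.
  by rewrite /L o0 AA0 -o0 ofrK.
have LD x y : L (x + y) = L x + L y by rewrite /L ofrD AD torD.
have LZ t x : L (t *: x) = t *: L x by rewrite /L ofrZ AZ torZ.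
pose B := \matrix_i L (delta_mx 0 i).
have LB v : L v = v *m B.
  rewrite {1}[v]row_sum_delta (big_morph L LD L0) mulmx_sum_row; apply: eq_bigr => i _.
  by rewrite LZ rowK.
have Bu : B \in unitmx.
  rewrite -row_free_unit -kermx_eq0; apply/eqP/row_matrixP => i; rewrite row0.
  have : L (row i (kermx B)) = 0 by rewrite LB -row_mul mulmx_ker row0.
  rewrite /L => h; have : A (ofr (row i (kermx B))) = 0.
    by rewrite -[LHS]torK h; apply/rowP => j; rewrite !mxE.
  move=> /A0 h2; rewrite -[LHS]ofrK h2; apply/rowP => j.
  by case: (split_ordP j) => k ->; rewrite /tor ?row_mxEl ?row_mxEr !mxE.
move=> y; exists (ofr (tor y *m invmx B)).
by rewrite -[LHS]torK -/(L _) LB mulmxKV // torK.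
Qed.

End RealLinear.

(** * Openness of the AN^n-orbits and transitivity *)

Section Orbits.
Context {R : realType} {n : nat} {M : complexManifold R n}.
Local Notation C := (Cplx R).
Local Notation D := (polydisc R n).
Local Notation G := ('I_n -> su (R := R)).
Variables (phi : Aut M -> Aut D) (psi : Aut D -> Aut M).
Hypotheses (phiM : {morph phi : g h / (g * h)%g}) (phiK : cancel phi psi)
  (psiK : cancel psi phi) (phi_cont : continuous phi) (psi_cont : continuous psi).
Hypothesis M_isotropy : forall p : M, compact (isotropy p).
Local Notation rho := (rho psi).

Lemma polydisc_nbhs (a : D) (U : set D) :
  nbhs a U <-> exists2 e : R, 0 < e & forall w, rn (pemb w - pemb a) < e -> U w.
Proof.
have H := @chart_nbhs R n D (polydisc_chart R n) a U I; split.
  move=> /H[e e0 eU]; exists e => // w wa; rewrite -[w]pembK.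
  by have [] := eU (pemb w) wa.
move=> [e e0 eU]; apply/H.
have : nbhs (pemb a) (chart_cod (polydisc_chart R n)).
  apply: open_nbhs_nbhs; split; first exact: chart_open_cod.
  exact: (@chart_to_cod _ _ _ (polydisc_chart R n)).
move=> /nbhs_rnP[d d0 dP]; exists (Num.min e d); first by rewrite lt_min e0.
move=> z; rewrite lt_min => /andP[ze /dP zc]; split => //.
by apply: eU; rewrite -/(pret z) pretK //; exact/polydisc_rnP.
Qed.

Lemma orbit_map_continuous p : continuous (fun w : D => Aut_fun (rho (anG w)) p).
Proof.
have rc := rho_cont psi_cont (@anG_cont R n).
exact: (continuous_left (y := p) (Aut_eval_continuous rc)).
Qed.

(* For [y] near [p], an orbit point closest to [y] within a small compact ball is interior to
   that ball, so if it missed [y] the injective derivative would allow a step towards [y]. *)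
Lemma orbit_nbhs p (U : set D) : nbhs orig U ->
  nbhs p [set q | exists2 w, U w & Aut_fun (rho (anG w)) p = q].
Proof.
move=> nU; have [c Ac cp] := cm_cover p; have [r r0 rP] := chart_ball cp.
pose E w := Aut_fun (rho (anG w)) p.
have Ec : continuous E := @orbit_map_continuous p.
have E0 : E orig = p by rewrite /E anG_o (rho1 phiM phiK psiK).
have nd : nbhs orig (E @^-1` chart_dom c).
  apply: Ec; rewrite E0; apply: open_nbhs_nbhs; split => //; exact: chart_open_dom.
have [d d0 dP] := (polydisc_nbhs _ _).1 (filterI nU nd).
have [s s0 [s1 sd]] : exists2 s, 0 < s & s < 1 /\ s < d.
  have m0 : 0 < Num.min 1 d by rewrite lt_min ltr01.
  exists (Num.min 1 d / 2); first exact: half_gt0.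
  by apply/andP; rewrite -lt_min; lra.
pose K := [set w : D | rn (pemb w) <= s].
have KU w : K w -> U w /\ chart_dom c (E w).
  by move=> Kw; apply: dP; rewrite pemb_orig subr0; apply: le_lt_trans sd.
have Kc : compact K.
  have -> : K = pret @` [set z : 'rV[C]_n | rn (z - 0) <= s].
    apply/seteqP; split => [w Kw|_ [z zs <-]].
      by exists (pemb w); rewrite /= ?subr0 ?pembK.
    rewrite /K /= subr0 in zs *; rewrite pretK // => j.
    by apply: le_lt_trans (rn_coord _ _) _; apply: le_lt_trans s1.
  apply: continuous_compact; last exact: closed_ball_compact.
  apply: continuous_in_subspaceT => z; rewrite inE /= subr0 => zs.
  apply: pret_continuous => j.
  by apply: le_lt_trans (rn_coord _ _) _; apply: le_lt_trans s1.
have nEc (y : 'rV[C]_n) w : K w -> {for w, continuous (fun w => rn (chart_to c (E w) - y))}.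
  move=> /KU[_ dw]; have c1 := continuous_comp (continuous_for w Ec) (chart_to_cts dw).
  have c2 := continuousB c1 (cst_for_continuous y w).
  exact: continuous_comp c2 (continuous_for _ (@rn_continuous R 'rV[C]_n)).
pose S := K `&` [set w : D | s <= rn (pemb w)].
have Sc : compact S.
  apply: compact_closedI => //.
  apply: (@preimage_closed _ _ (fun w : D => rn (pemb w)) [set x : R | s <= x]);
    last exact: closed_ge.
  move=> w _; exact: continuous_comp (continuous_for w (@pemb_continuous R n)) (continuous_for _ (@rn_continuous R 'rV[C]_n)).
(* By freeness [E w] differs from [p] on the sphere [S]. A [y] within [m / 2] of [p] in the chart is
   closer to [E orig] than to any point of [E S], so the minimizer is not on [S]. *)
have [m m0 mP] : exists2 m, 0 < m & forall w, S w -> m <= rn (chart_to c (E w) - chart_to c p).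
  have [Sn|S0] := pselect (S !=set0); last first.
    by exists 1 => // w Sw; case: S0; exists w.
  have [|w wS wP] := compact_EVT_min Sn Sc (f := fun w => rn (chart_to c (E w) - chart_to c p)).
    apply: continuous_in_subspaceT => w; rewrite inE => -[Kw _]; exact: nEc.
  exists (rn (chart_to c (E w) - chart_to c p)); last first.
    by move=> v Sv; apply: wP; rewrite inE.
  apply: rn_gt0; rewrite subr_eq0; apply/eqP => h.
  move: wS; rewrite inE => -[Kw sw]; have [_ dw] := KU w Kw.
  have Ep : E w = p by rewrite -(chart_toK dw) h chart_toK.
  have := AN_free phiM phiK psiK phi_cont M_isotropy (@anG_AN R n w) Ep => w1.
  have : pemb w = 0 by rewrite -(anG_orig w) w1 mobG1 pemb_orig.
  by move=> pw; move: sw; rewrite /= pw rn0; lra.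
apply/(chart_nbhs _ cp); exists (Num.min (m / 2) r); first by rewrite lt_min half_gt0.
move=> y; rewrite lt_min => /andP[ym yr]; have cy : chart_cod c y by apply: rP; exact: ltW.
split => //; have Kn : K !=set0 by exists orig; rewrite /K /= pemb_orig rn0 ltW.
have [|w wK wP] := compact_EVT_min Kn Kc (f := fun w => rn (chart_to c (E w) - y)).
  by apply: continuous_in_subspaceT => w; rewrite inE; exact: nEc.
rewrite inE in wK; have [Uw dw] := KU w wK.
exists w => //; suff d0' : chart_to c (E w) - y = 0.
  by rewrite -/(E w) -(chart_toK dw); congr chart_from; apply/eqP; rewrite -subr_eq0 d0'.
have Nw : rn (chart_to c (E w) - y) < m / 2.
  have : rn (chart_to c (E w) - y) <= rn (chart_to c (E orig) - y).
    by apply: wP; rewrite inE /K /= pemb_orig rn0 ltW.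
  by rewrite E0 => /le_lt_trans; apply; rewrite rn_sub.
have ws : rn (pemb w) < s.
  rewrite ltNge; apply/negP => sw; have := mP w (conj wK sw).
  have := rnD (chart_to c (E w) - y) (y - chart_to c p); rewrite subrKA.
  by clear -ym Nw; lra.
have [A [AD AZ A0 [_ Aexp]]] := orbit_derivative phiM phiK psiK phi_cont psi_cont M_isotropy Ac dw.
apply: contrapT => /eqP dN; set dd := chart_to c (E w) - y in dN Nw.
have dp := rn_gt0 dN.
(* To first order the group element with parameter [t v] moves [E w] by [- t dd]. The distance to
   [y] drops to at most [(1 - t) |dd|] plus an error [t |dd| / 2], against minimality. *)
have [v vE] := real_linear_surjective AD AZ A0 (- dd).
have v1 : 0 < rn v + 1 by rewrite ltr_wpDl // rn_ge0.
have e0 : 0 < rn dd / (2 * (rn v + 1)) by rewrite divr_gt0 // mulr_gt0.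
have mc : continuous (fun w' : D => mobG (anG w') w).
  exact: (continuous_left (y := w) (mobG_continuous2 (@anG_cont R n))).
have nK : \forall w' \near orig, K (mobG (anG w') w).
  have : nbhs (mobG (anG orig) w) K.
    rewrite anG_o mobG1; apply/polydisc_nbhs; exists (s - rn (pemb w)); first by rewrite subr_gt0.
    by move=> w' h; have := rn_dist (pemb w') (pemb w); rewrite /K /=; lra.
  by move=> /mc.
have [k k0 kP] := (polydisc_nbhs _ _).1 (filterI (Aexp _ e0) nK).
pose t := Num.min 1 k / (2 * (rn v + 1)).
have mk0 : 0 < Num.min 1 k by rewrite lt_min ltr01.
have t0 : 0 < t by rewrite divr_gt0 // mulr_gt0.
have tv : t * rn v < Num.min 1 k.
  have -> : t * rn v = Num.min 1 k * (rn v / (2 * (rn v + 1))).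
    by rewrite /t mulrAC -mulrA.
  rewrite gtr_pMr // ltr_pdivrMr ?mulr_gt0 //; have := rn_ge0 v; lra.
have t1 : t < 1.
  apply: (@lt_le_trans _ _ (Num.min 1 k)); last by rewrite ge_min lexx.
  rewrite /t ltr_pdivrMr ?mulr_gt0 // ltr_pMr //; have := rn_ge0 v; lra.
move: tv; rewrite lt_min => /andP[tv1 tvk].
pose w' : D := pret ((t%:C%C : C) *: v).
have pw' : pemb w' = (t%:C%C : C) *: v.
  apply: pretK => j; apply: le_lt_trans (rn_coord _ _) _.
  by rewrite rnZ rn_real gtr0_norm.
have rw' : rn (pemb w') = t * rn v by rewrite pw' rnZ rn_real gtr0_norm.
have [|h1 h2] := kP w'; first by rewrite pemb_orig subr0 rw'.
have EE : Aut_fun (rho (anG w')) (E w) = E (mobG (anG w') w).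
  by rewrite /E -anG_mul (rho_act phiM phiK psiK).
have := wP (mobG (anG w') w) (mem_set h2); rewrite -/dd -EE.
have -> : chart_to c (Aut_fun (rho (anG w')) (E w)) - y =
   (disp c (E w) (rho (anG w')) - A (pemb w')) + ((1 - t)%:C%C : C) *: dd.
  rewrite pw' AZ vE rmorphB rmorph1 /disp /dd.
  by apply/rowP => j; rewrite !mxE; ring.
move=> /le_trans -/(_ _ (rnD _ _)); have t2 : 0 <= 1 - t by rewrite subr_ge0 ltW.
rewrite rnZ rn_real (ger0_norm t2).
have h3 : rn dd / (2 * (rn v + 1)) * rn (pemb w') <= rn dd / 2 * t.
  rewrite rw'; have -> : rn dd / 2 * t = rn dd / (2 * (rn v + 1)) * (t * (rn v + 1)).
    by field; rewrite gt_eqF.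
  by apply: ler_wpM2l; [exact: ltW|apply: ler_wpM2l; [exact: ltW|rewrite lerDl]].
have td : 0 < t * rn dd by rewrite mulr_gt0.
have := le_trans h1 h3; set a := rn (disp _ _ _ - _); clear -td; lra.
Qed.

(** Orbits are open by [orbit_nbhs], and the complement of one is a union of others, so
    connectedness leaves a single orbit. *)
Lemma AN_transitive p q : connected [set: M] -> exists w, Aut_fun (rho (anG w)) p = q.
Proof.
pose O (a : M) := [set b : M | exists w, Aut_fun (rho (anG w)) a = b].
have Onb (a : M) : nbhs a (O a).
  have h : nbhs a [set q | exists2 w, [set: D] w & Aut_fun (rho (anG w)) a = q].
    by apply: orbit_nbhs; exact: filterT.
  by move: h; apply: filterS => b [w _ wb]; exists w.
have Otr a b b' : O a b -> O b b' -> O a b'.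
  move=> [w <-] [w' <-]; exists (mobG (anG w') w).
  by rewrite -anG_mul (rho_act phiM phiK psiK).
have Osym a b : O a b -> O b a.
  move=> [w /(rho_inv phiM phiK psiK) ->]; exists (mobG (ginv (anG w)) orig).
  by rewrite anG_of //; exact: anG_inv.
have Oopen a : open (O a).
  by rewrite openE => b Ob; apply: filterS (Onb b) => b'; exact: Otr.
move=> Mc; suff : O p = [set: M] by move=> Op; have : O p q by rewrite Op.
apply: Mc; first by exists p; exists orig; rewrite anG_o (rho1 phiM phiK psiK).
  by exists (O p); rewrite ?setTI.
exists (O p); rewrite ?setTI // -openC openE => b nOb.
by apply: filterS (Onb b) => b' Ob' Opb'; apply: nOb; exact: Otr Opb' (Osym _ _ Ob').
Qed.

End Orbits.

(** * A point fixed by the torus *)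

Section TorusFixedPoint.
Context {R : realType} {n : nat} {M : complexManifold R n}.
Local Notation C := (Cplx R).
Local Notation D := (polydisc R n).
Local Notation G := ('I_n -> su (R := R)).
Variables (phi : Aut M -> Aut D) (psi : Aut D -> Aut M).
Hypotheses (phiM : {morph phi : g h / (g * h)%g}) (phiK : cancel phi psi)
  (psiK : cancel psi phi) (phi_cont : continuous phi) (psi_cont : continuous psi).
Hypothesis M_isotropy : forall p : M, compact (isotropy p).
Hypothesis M_connected : connected [set: M].
Local Notation rho := (rho psi).

Let fixM g h p : Aut_fun (rho g) p = p -> Aut_fun (rho h) p = p ->
  Aut_fun (rho (gmul g h)) p = p.
Proof. by move=> gp hp; rewrite (rho_act phiM phiK psiK) hp gp. Qed.

Let fixV g p : Aut_fun (rho g) p = p -> Aut_fun (rho (ginv g)) p = p.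
Proof. by move=> /(rho_inv phiM phiK psiK) /esym. Qed.

Let quotient_fix g h p : Aut_fun (rho g) p = Aut_fun (rho h) p ->
  Aut_fun (rho (gmul (ginv g) h)) p = p.
Proof.
by move=> gh; rewrite (rho_act phiM phiK psiK) -gh -(rho_act phiM phiK psiK) gVmul
  (rho1 phiM phiK psiK).
Qed.

(** Transitivity writes the image of [p] under a rotation of coordinate [j] as [a p] with [a] in
    AN^n, so [a^-1] times the rotation fixes [p]. Its other components lie in AN, which has no
    elliptic elements, hence are 1. The [j]-th is not 1 or -1, as the rotation is not in AN up to
    sign. *)
Lemma elliptic_in_isotropy p (j : 'I_n) : exists h : G,
  [/\ Aut_fun (rho h) p = p, forall k, k != j -> h k = suone &
      complex.Re (sa (h j)) ^+ 2 < 1].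
Proof.
pose i : C := Complex 0 1.
have id : i * cj i - 0 * cj 0 = 1.
  by rewrite mul0r subr0 cjE; apply: cplx_eq => /=; ring.
have [ia ib] := mksuE id.
have [w wE] := AN_transitive phiM phiK psiK phi_cont psi_cont M_isotropy p
  (Aut_fun (rho (single j (mksu i 0))) p) M_connected.
exists (gmul (ginv (anG w)) (single j (mksu i 0))).
have fixp := quotient_fix wE; have ell := isotropy_elliptic phiM phiK psiK phi_cont M_isotropy fixp.
split => //.
  move=> k kj; rewrite /gmul /single (negbTE kj) sumul1.
  have ANk := AN_inv (@anG_AN R n w k).
  have := ell k; rewrite /gmul /single (negbTE kj) sumul1 => -[|lt1]; first exact: AN_pm_one.
  by exfalso; have := AN_not_elliptic ANk; rewrite /ginv in lt1 *; lra.
have := ell j; rewrite /gmul /single eqxx => -[[b0 a0]|//].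
exfalso; move: b0 a0; rewrite /= ia ib mulr0 add0r cj0 mulr0 addr0 => b0 a0.
have i0 : cj i != 0 by rewrite cj_eq0; apply/eqP => /(congr1 (@complex.Im R)) /=; lra.
have {}b0 : sb (anG w j) = 0.
  by apply/eqP; rewrite -oppr_eq0; apply/eqP; apply: (mulIf i0); rewrite b0 mul0r.
have [l l0 lE] := @anG_AN R n w j; rewrite b0 addr0 in lE.
rewrite lE cj_real in a0.
by case: a0 => /(congr1 (@complex.Re R)) /=; lra.
Qed.

(* The isotropy group of a suitable [p] contains, for each [j], a nontrivial rotation [d j] of
   the [j]-th coordinate. For [k] in this isotropy group so is the commutator of [d j] and [k],
   which would be hyperbolic in the [j]-th coordinate unless [k] is a rotation there too. *)
Lemma torus_fixed_point (p0 : M) : exists p, forall g : G, (forall j, sb (g j) = 0) ->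
  Aut_fun (rho g) p = p.
Proof.
have /choice[h hP] := elliptic_in_isotropy p0.
have /choice[q qP] (j : 'I_n) : exists q : C, rn q < 1 /\ mob (h j j) q = q.
  by have [_ _ /elliptic_fixpoint[q q1 qE]] := hP j; exists q.
pose Q : D := pret (\row_j q j).
have pQ j : pemb Q ord0 j = q j.
  by rewrite pretK ?mxE // => k; rewrite mxE; have [] := qP k.
(* [b] carries the origin to [Q], whose [j]-th coordinate is fixed by [h j j]; conjugating by [b]
   turns these components into rotations about the origin. *)
pose b := anG Q; pose p := Aut_fun (rho (ginv b)) p0; exists p.
pose d j : G := gmul (ginv b) (gmul (h j) b).
have bp : Aut_fun (rho b) p = p0 by rewrite -(rho_act phiM phiK psiK) gmulV (rho1 phiM phiK psiK).
have dp j : Aut_fun (rho (d j)) p = p.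
  have [hp _ _] := hP j; rewrite /d (rho_act phiM phiK psiK (ginv b)).
  by rewrite (rho_act phiM phiK psiK (h j)) bp hp.
have dj0 j : sb (d j j) = 0.
  have : w0 (d j j) = 0.
    have [q1 qE] := qP j; have bj : b j = an (q j) by rewrite /b /anG pQ.
    rewrite /d /gmul w0M w0M /ginv bj w0_an // qE.
    have -> : mob (suinv (an (q j))) (q j) = w0 (sumul (suinv (an (q j))) (an (q j))).
      by rewrite w0M w0_an.
    by rewrite suVmul /w0 /= mul0r.
  by move=> w; rewrite w0_b w mul0r.
have dj1 j : sa (d j j) ^+ 2 != 1.
  have [_ _ lt1] := hP j; rewrite sqrf_eq1; apply/negP => s1.
  have hE : h j j = sumul (b j) (sumul (d j j) (suinv (b j))).
    by rewrite /d /gmul /ginv !sumulA sumulV su1mul -sumulA sumulV sumul1.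
  have : sa (h j j) = sa (d j j).
    rewrite hE; move: (d j j) (b j) (dj0 j) s1 => x y x0 s1; rewrite /= x0.
    have xc : cj (sa x) = sa x by case/orP: s1 => /eqP ->; rewrite ?cjN cj1.
    transitivity (sa x * (sa y * cj (sa y) - sb y * cj (sb y))); last by rewrite su_det mulr1.
    by rewrite !cjD !cjM !cjN cj0 xc; ring.
  move=> saE; move: lt1; rewrite saE; case/orP: s1 => /eqP -> /=; rewrite ?sqrrN expr1n ltxx //.
move=> g g0.
(* [g p] equals [anG w p] for some [w]; it remains to show that [w] is the origin. *)
have [w wE] := AN_transitive phiM phiK psiK phi_cont psi_cont M_isotropy p
  (Aut_fun (rho g) p) M_connected.
pose k := gmul (ginv (anG w)) g; have kp : Aut_fun (rho k) p = p by exact: quotient_fix.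
have w00 j : pemb w ord0 j = 0.
  have cp := fixM (fixM (dp j) kp) (fixM (fixV (dp j)) (fixV kp)).
  have := isotropy_elliptic phiM phiK psiK phi_cont M_isotropy cp j.
  move=> /(commutator_rotation (dj0 j) (dj1 j)).
  rewrite /k /gmul /ginv /= g0 mulr0 add0r => /eqP.
  rewrite mulf_eq0 cj_eq0 (negbTE (su_a_neq0 _)) orbF oppr_eq0 => /eqP sb0.
  by rewrite -(w0_an (pemb_lt1 w j)) /w0 -/(anG w j) sb0 mul0r.
rewrite -wE (_ : w = orig) ?anG_o ?(rho1 phiM phiK psiK) //.
by apply: (can_inj pembK); apply/rowP => j; rewrite w00 pemb_orig mxE.
Qed.

(** The element [(anG v)^-1 g (anG w)] with [v = g w] fixes the origin, so it belongs to the torus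
    and fixes [p]. *)
Lemma orbit_equivariant p : (forall g : G, (forall j, sb (g j) = 0) -> Aut_fun (rho g) p = p) ->
  forall g w, Aut_fun (rho g) (Aut_fun (rho (anG w)) p) = Aut_fun (rho (anG (mobG g w))) p.
Proof.
move=> tor g w; set v := mobG g w.
pose k := gmul (ginv (anG v)) (gmul g (anG w)).
have kp : Aut_fun (rho k) p = p.
  apply: tor => j; rewrite w0_b -mobG_orig /k !mobGM anG_orig -/v.
  by rewrite -{2}(anG_orig v) -mobGM gVmul mobG1 pemb_orig mxE mul0r.
by rewrite -(rho_act phiM phiK psiK) -[in RHS]kp -(rho_act phiM phiK psiK) /k gmulA gmulV g1mul.
Qed.

End TorusFixedPoint.

Section HolomorphicAt.
Context {R : realType}.

(** Holomorphy is isolated at one point, because the orbit map is differentiated at the origin only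
    and equivariance carries the result elsewhere. *)
Definition hol_at m n (M : complexManifold R m) (N : complexManifold R n) (f : M -> N) (p : M) :=
  forall c d, cm_atlas c -> cm_atlas d -> chart_dom c p -> chart_dom d (f p) ->
    differentiable (chart_to d \o f \o chart_from c) (chart_to c p).

Lemma holomorphic_at m n (M : complexManifold R m) (N : complexManifold R n) (f : M -> N) :
  holomorphic f -> forall p, hol_at f p.
Proof. by move=> [_ fh] p c d Ac Ad; exact: fh. Qed.

Lemma hol_at_comp m n k (M : complexManifold R m) (N : complexManifold R n)
    (P : complexManifold R k) (f : M -> N) (g : N -> P) (p : M) :
  continuous f -> hol_at f p -> hol_at g (f p) -> hol_at (g \o f) p.
Proof.
move=> fc fh gh c e Ac Ae cp ep.
have [d Ad dfp] := cm_cover (f p).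
have cpE : chart_from c (chart_to c p) = p by exact: chart_toK.
apply: (@near_eq_differentiable _ _ _
  ((chart_to e \o g \o chart_from d) \o (chart_to d \o f \o chart_from c))).
  have /continuous_comp := @chart_from_cts _ _ _ c _ (chart_to_cod cp).
  move=> /(_ _ f (fc _)) fcts.
  have : nbhs (f (chart_from c (chart_to c p))) (chart_dom d).
    rewrite cpE; exact: (open_nbhs_nbhs (conj (chart_open_dom d) dfp)).
  by move=> /fcts dz; near=> z; rewrite /= chart_toK //; near: z; exact: dz.
apply: differentiable_comp; first exact: fh.
by rewrite /= cpE; exact: gh.
Unshelve. all: by end_near. Qed.

Lemma hol_at_chart m n (M : complexManifold R m) (N : complexManifold R n) (f : M -> N) (p : M)
    c d : continuous f -> cm_atlas c -> cm_atlas d -> chart_dom c p -> chart_dom d (f p) ->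
  differentiable (chart_to d \o f \o chart_from c) (chart_to c p) -> hol_at f p.
Proof.
move=> fc Ac Ad cp dp H c' d' Ac' Ad' cp' dp'.
have cpE : chart_from c' (chart_to c' p) = p by exact: chart_toK.
apply: (@near_eq_differentiable _ _ _
  ((chart_to d' \o chart_from d) \o (chart_to d \o f \o chart_from c) \o
   (chart_to c \o chart_from c'))).
  have n1 : nbhs p (chart_dom c `&` f @^-1` chart_dom d).
    apply: filterI; first exact: (open_nbhs_nbhs (conj (chart_open_dom c) cp)).
    exact: (fc p _ (open_nbhs_nbhs (conj (chart_open_dom d) dp))).
  have [e e0 eP] := (chart_nbhs _ cp').1 n1.
  apply/nbhs_rnP; exists e => // z /eP[cz [cd dd]] /=.
  by rewrite (chart_toK cd) (chart_toK dd).
apply: differentiable_comp; first exact: cm_compatible.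
rewrite /= cpE; apply: differentiable_comp; first exact: H.
rewrite /= chart_toK //; exact: cm_compatible.
Qed.

End HolomorphicAt.

(** * Holomorphy of the orbit map *)

Section CommutingComplexStructure.
Context {R : realType} {n : nat}.
Local Notation C := (Cplx R).

Definition scale_coord (j : 'I_n) (z : C) (v : 'rV[C]_n) : 'rV[C]_n :=
  \row_k (if k == j then z * v ord0 k else v ord0 k).

Definition flip (s : 'I_n -> bool) (v : 'rV[C]_n) : 'rV[C]_n :=
  \row_j (if s j then v ord0 j else cj (v ord0 j)).

Lemma flipK s : involutive (flip s).
Proof.
by move=> v; apply/rowP => j; rewrite !mxE; case: (s j) => //; rewrite cjK.
Qed.

Lemma rn_flip s v : rn (flip s v) = rn v.
Proof.
have le v' : rn (flip s v') <= rn v'.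
  apply/rn_rV_le => [|j]; first exact: rn_ge0.
  by rewrite mxE; case: (s j); rewrite ?rn_cj; exact: rn_coord.
by apply/eqP; rewrite eq_le le -{1}(flipK s v) le.
Qed.

Variable A : 'rV[C]_n -> 'rV[C]_n.
Hypotheses (AD : forall x y, A (x + y) = A x + A y)
  (AZ : forall (t : R) x, A ((t%:C%C : C) *: x) = (t%:C%C : C) *: A x)
  (A0 : forall x, A x = 0 -> x = 0).
(** [z0] will be the factor of a coordinate rotation, and [L j] the derivative at the fixed point of
    the corresponding automorphism of the manifold. *)
Variables (z0 : C) (L : 'I_n -> {linear 'rV[C]_n -> 'rV[C]_n}).
Hypotheses (z0_im : complex.Im z0 != 0)
  (AL : forall j v, A (scale_coord j z0 v) = L j (A v)).

Let e j : 'rV[C]_n := delta_mx ord0 j.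
Let i : C := Complex 0 1.

Let ii : i * i = -1. Proof. by apply: cplx_eq => /=; ring. Qed.

Let AN x : A (- x) = - A x.
Proof.
have := AZ (-1) x; rewrite rmorphN rmorph1 !scaleN1r; exact.
Qed.

Let A_inj x y : A x = A y -> x = y.
Proof.
by move=> xy; apply/eqP; rewrite -subr_eq0; apply/eqP/A0; rewrite AD AN xy subrr.
Qed.

Let A_split (a : C) x : A (a *: x) =
  ((complex.Re a)%:C%C : C) *: A x + ((complex.Im a)%:C%C : C) *: A (i *: x).
Proof.
rewrite -!AZ -AD scalerA -scalerDl; congr (A (_ *: _)).
by apply: cplx_eq; case: a => ? ? /=; ring.
Qed.

Let scaleAC (a b : C) (v : 'rV[C]_n) : a *: (b *: v) = b *: (a *: v).
Proof. by rewrite !scalerA mulrC. Qed.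

Let scale_e_neq k j : k != j -> scale_coord k z0 (e j) = e j.
Proof.
move=> kj; apply/rowP => l; rewrite !mxE /=; case: eqP => // ->.
by rewrite (negbTE kj) mulr0.
Qed.

Let scale_e j a : scale_coord j z0 (a *: e j) = (z0 * a) *: e j.
Proof.
apply/rowP => l; rewrite !mxE /=; case: eqP => _; first by rewrite !mulr1.
by rewrite !mulr0.
Qed.

(* The complex structure pulled back by [A] commutes with the rotations, so it preserves
   each coordinate line and acts on it as [i] or [-i]. *)
Lemma pulled_back_structure j : exists b : bool,
  i *: A (e j) = (-1) ^+ (~~ b) *: A (i *: e j).
Proof.
(* [u] is the image of [e j] under the pulled back complex structure [A^-1 i A]. *)
have [u uE] := real_linear_surjective AD AZ A0 (i *: A (e j)).
have uk k : k != j -> u ord0 k = 0.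
  move=> kj; have : scale_coord k z0 u = u.
    by apply: A_inj; rewrite AL uE linearZZ -AL scale_e_neq.
  move=> /rowP /(_ k); rewrite mxE eqxx => h.
  have : (z0 - 1) * u ord0 k = 0 by rewrite mulrBl h mul1r subrr.
  move/eqP; rewrite mulf_eq0 subr_eq0 => /orP[/eqP z1|/eqP //].
  by move: z0_im; rewrite z1 /= eqxx.
have [l uE'] : exists l, u = l *: e j.
  exists (u ord0 j); apply/rowP => k; rewrite !mxE /=; have [->|kj] := eqVneq k j; first by rewrite mulr1.
  by rewrite mulr0 uk.
rewrite uE' in uE.
(* Complex linearity of [L j] equates [A (z0 l e_j)] and [i A (z0 e_j)]. Expanding both over the
   real and imaginary parts of [z0] leaves this identity times [Im z0]. *)
have E1 : A ((i * l) *: e j) = i *: A (i *: e j).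
  have := AL j (l *: e j); rewrite scale_e uE linearZZ.
  have := AL j (1 *: e j); rewrite scale_e mulr1 scale1r => <-.
  pose x : C := (complex.Re z0)%:C%C; pose y : C := (complex.Im z0)%:C%C.
  have P1 : A ((z0 * l) *: e j) = x *: (i *: A (e j)) + y *: A ((i * l) *: e j).
    by rewrite -[(z0 * l) *: _]scalerA A_split uE [i *: (l *: _)]scalerA.
  have P2 : i *: A (z0 *: e j) = x *: (i *: A (e j)) + y *: (i *: A (i *: e j)).
    by rewrite (A_split z0 (e j)) scalerDr (scaleAC i x) (scaleAC i y).
  rewrite P1 P2 => /addrI h.
  have : y *: (A ((i * l) *: e j) - i *: A (i *: e j)) = 0 by rewrite scalerBr h subrr.
  move/eqP; rewrite scaler_eq0 subr_eq0 => /orP[/eqP/complexI/eqP|/eqP //].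
  by rewrite (negbTE z0_im).
(* On the [j]-th line the structure is multiplication by [l], and its square is -1. *)
have E2 : l * l = -1.
  have : A ((l * l) *: e j) = A ((-1) *: e j).
    rewrite [(-1) *: _]scaleN1r AN.
    have -> : A ((l * l) *: e j) = i *: A (l *: e j).
      rewrite -[(l * l) *: _]scalerA [LHS]A_split [in LHS]uE [i *: (l *: _)]scalerA E1.
      by rewrite (A_split l (e j)) scalerDr (scaleAC i (complex.Re l)%:C%C)
        (scaleAC i (complex.Im l)%:C%C).
    by rewrite uE scalerA ii scaleN1r.
  move=> /A_inj /rowP /(_ j); rewrite !mxE !eqxx !mulr1; exact.
have : l = i \/ l = - i.
  have : (l - i) * (l + i) = 0.
    by transitivity (l * l - i * i); [ring|rewrite E2 ii subrr].
  by move/eqP; rewrite mulf_eq0 subr_eq0 addr_eq0 => /orP[/eqP|/eqP]; [left|right].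
case=> lE; rewrite lE in uE; first by exists true; rewrite expr0 scale1r.
by exists false; rewrite expr1 scaleN1r -uE scaleNr AN.
Qed.

Lemma flip_complex_linear : exists s : 'I_n -> bool,
  forall v, A (flip s v) = v *m (\matrix_j A (e j)).
Proof.
have /choice[s sP] := pulled_back_structure; exists s => v.
rewrite mulmx_sum_row {1}[flip s v]row_sum_delta (real_linear_sum AD AZ).
apply: eq_bigr => j _; rewrite rowK mxE -/(e j).
rewrite A_split; have iA : A (i *: e j) = (-1) ^+ (~~ s j) *: (i *: A (e j)).
  by rewrite sP scalerA -expr2 sqrr_sign scale1r.
rewrite iA !scalerA -scalerDl; congr (_ *: _).
by case: (s j); rewrite /= ?cjE; apply: cplx_eq; case: (v ord0 j) => a b /=; ring.
Qed.

End CommutingComplexStructure.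

(** * Conjugating some coordinates of the polydisc *)

Section FlippedPolydisc.
Context {R : realType} {n : nat}.
Local Notation C := (Cplx R).
Local Notation D := (polydisc R n).
Local Notation G := ('I_n -> su (R := R)).

Lemma rn_sum (V : normedModType C) (I : Type) (r : seq I) (F : I -> V) :
  rn (\sum_(i <- r) F i) <= \sum_(i <- r) rn (F i).
Proof.
elim: r => [|i r IH]; first by rewrite !big_nil rn0.
by rewrite !big_cons; apply: le_trans (rnD _ _) _; rewrite lerD2l.
Qed.

Lemma mulmx_bounded (B : 'M[C]_n) : exists2 k, 0 < k & forall v : 'rV[C]_n,
  rn (v *m B) <= k * rn v.
Proof.
have k0 : 0 <= \sum_i rn (row i B) by apply: sumr_ge0 => i _; exact: rn_ge0.
exists (\sum_i rn (row i B) + 1); first by rewrite ltr_wpDl.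
move=> v; rewrite mulmx_sum_row; apply: le_trans (rn_sum _ _) _.
have : \sum_i rn (v ord0 i *: row i B) <= \sum_i rn (row i B) * rn v.
  apply: ler_sum => i _; rewrite rnZ mulrC; apply: ler_wpM2l; first exact: rn_ge0.
  exact: rn_coord.
by rewrite -mulr_suml => /le_trans; apply; apply: ler_wpM2r; rewrite ?rn_ge0 // lerDl.
Qed.

Lemma suconj_subproof (x : su (R := R)) :
  cj (sa x) * cj (cj (sa x)) - cj (sb x) * cj (cj (sb x)) = 1.
Proof. by rewrite -!cjM -cjB su_det cj1. Qed.
Definition suconj x := SU (suconj_subproof x).

Lemma mob_suconj x z : mob (suconj x) (cj z) = cj (mob x z).
Proof. by rewrite /mob /mobden /= !cjM cjV !cjD !cjM. Qed.

Variable s : 'I_n -> bool.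

Definition flipD (w : D) : D := pret (flip s (pemb w)).

Lemma pemb_flipD w : pemb (flipD w) = flip s (pemb w).
Proof.
apply: pretK => j; apply: le_lt_trans (rn_coord _ _) _; rewrite rn_flip.
by apply/rn_rV_lt => // k; exact: pemb_lt1.
Qed.

Lemma flipDK : involutive flipD.
Proof. by move=> w; apply: (can_inj pembK); rewrite !pemb_flipD flipK. Qed.

Lemma flipD_orig : flipD orig = orig.
Proof.
apply: (can_inj pembK); rewrite pemb_flipD pemb_orig.
by apply/rowP => j; rewrite !mxE; case: (s j); rewrite ?cj0.
Qed.

Lemma flipD_continuous : continuous flipD.
Proof.
move=> a U /(polydisc_nbhs _ _).1[e e0 eU]; apply/(polydisc_nbhs _ _).2.
exists e => // w wa; apply: eU; rewrite !pemb_flipD.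
suff -> : flip s (pemb w) - flip s (pemb a) = flip s (pemb w - pemb a) by rewrite rn_flip.
by apply/rowP => j; rewrite !mxE; case: (s j) => //; rewrite cjB.
Qed.

(** Conjugation intertwines a Moebius map with the one having conjugate entries, so flips normalize
    the group. *)
Definition gflip (g : G) : G := fun j => if s j then g j else suconj (g j).

Lemma mobG_flip g w : mobG (gflip g) (flipD w) = flipD (mobG g w).
Proof.
apply: (can_inj pembK); apply/rowP => j.
rewrite pemb_mobG !pemb_flipD !mxE pemb_mobG /gflip.
by case: (s j) => //; rewrite mob_suconj.
Qed.

End FlippedPolydisc.

(** * The equivariant biholomorphism *)

Section Conclusion.
Context {R : realType} {n : nat} {M : complexManifold R n}.
Local Notation C := (Cplx R).
Local Notation D := (polydisc R n).
Local Notation G := ('I_n -> su (R := R)).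
Variables (phi : Aut M -> Aut D) (psi : Aut D -> Aut M).
Hypotheses (phiM : {morph phi : g h / (g * h)%g}) (phiK : cancel phi psi)
  (psiK : cancel psi phi) (phi_cont : continuous phi) (psi_cont : continuous psi).
Hypothesis M_isotropy : forall p : M, compact (isotropy p).
Hypothesis M_connected : connected [set: M].
Local Notation rho := (rho psi).

Variable p : M.
Hypothesis torus_fix : forall g : G, (forall j, sb (g j) = 0) -> Aut_fun (rho g) p = p.

Let Phi (w : D) : M := Aut_fun (rho (anG w)) p.

Let PhiE g w : Aut_fun (rho g) (Phi w) = Phi (mobG g w).
Proof. exact: (orbit_equivariant phiM phiK psiK torus_fix). Qed.

Let Phi_orig : Phi orig = p.
Proof. by rewrite /Phi anG_o (rho1 phiM phiK psiK). Qed.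

Let Phi_inj : injective Phi.
Proof.
move=> w v wv; pose g := gmul (ginv (anG w)) (anG v).
have gp : Aut_fun (rho g) p = p.
  rewrite /g (rho_act phiM phiK psiK) -/(Phi v) -wv /Phi -(rho_act phiM phiK psiK) gVmul.
  by rewrite (rho1 phiM phiK psiK).
have ANg : isANG g by move=> j; apply: AN_mul; [exact: anG_inv|exact: anG_AN].
have g1 := AN_free phiM phiK psiK phi_cont M_isotropy ANg gp.
have : gmul (anG w) g = anG w by rewrite g1 gmul1.
rewrite /g gmulA gmulV g1mul => h.
by rewrite -(anG_orig w) -(anG_orig v) h.
Qed.

Let Phi_nbhs a (V : set D) : nbhs a V -> nbhs (Phi a) (Phi @` V).
Proof.
move=> aV; have nU : nbhs orig [set w | V (mobG (anG w) a)].
  have mc := continuous_left (y := a) (mobG_continuous2 (@anG_cont R n)).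
  by apply: (mc orig V); rewrite /= anG_o mobG1.
have := orbit_nbhs phiM phiK psiK phi_cont psi_cont M_isotropy (Phi a) nU.
by apply: filterS => q [w Vw <-]; exists (mobG (anG w) a); rewrite ?PhiE.
Qed.

Let small_multiple (x : 'rV[C]_n) : (forall e, 0 < e -> exists2 d, 0 < d &
  forall t, 0 < t < d -> rn ((t%:C%C : C) *: x) <= e * t) -> x = 0.
Proof.
move=> H; apply/eqP/negPn/negP => /rn_gt0 x0.
have [d d0 Hd] := H _ (half_gt0 x0); have d2 := half_gt0 d0.
have : 0 < d / 2 < d by apply/andP; split; lra.
move=> /Hd; rewrite rnZ rn_real gtr0_norm // mulrC ler_pM2r //; lra.
Qed.

(** First-order parts of [rho g (Phi w) = Phi (mobG g w)] are compared at the fixed point [p]; [L]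
    is the complex derivative of [rho g] there. *)
Lemma derivative_equivariant (c : chart R n M) (A : 'rV[C]_n -> 'rV[C]_n) (g : G)
    (S : 'rV[C]_n -> 'rV[C]_n) : cm_atlas c -> chart_dom c p ->
  (forall x y, A (x + y) = A x + A y) ->
  (forall (t : R) x, A ((t%:C%C : C) *: x) = (t%:C%C : C) *: A x) ->
  expands orig (fun w : D => rn (pemb w)) (fun w => disp c p (rho (anG w)))
    (fun w => A (pemb w)) ->
  (forall w, pemb (mobG g w) = S (pemb w)) ->
  (forall (t : R) x, S ((t%:C%C : C) *: x) = (t%:C%C : C) *: S x) ->
  Aut_fun (rho g) p = p ->
  exists L : {linear 'rV[C]_n -> 'rV[C]_n}, forall v, A (S v) = L (A v).
Proof.
move=> Ac cp AD AZ [[kA kAP] Aexp] gS SZ gp.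
have dF : differentiable (chart_to c \o Aut_fun (rho g) \o chart_from c) (chart_to c p).
  apply: Aut_chart_differentiable => //; first exact: chart_to_cod.
  by rewrite chart_toK // gp.
have [L [[kL kL0 kLP] LP]] := differentiable_rnP dF; exists L => v.
apply/eqP; rewrite -subr_eq0; apply/eqP; apply: small_multiple => e e0.
(* [K] dominates the sum of the coefficients of [t] in the error terms, so precision [e / K]
   suffices; [t * K < m] also keeps all points in the required balls. *)
pose K := rn (S v) + (`|kA| + 1) * rn v + kL * rn v + 1.
have v0 := rn_ge0 v; have Sv0 := rn_ge0 (S v).
have kA0 : 0 <= `|kA| + 1 by rewrite addr_ge0.
have K0 : 0 < K by rewrite ltr_wpDl // !addr_ge0 // mulr_ge0 // ltW.
have eK : 0 < e / K by exact: divr_gt0.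
have [d1 d10 P1] := LP _ eK.
have [d2 d20 P2] := (polydisc_nbhs _ _).1 (Aexp _ eK).
have [d3 d30 P3] := (polydisc_nbhs _ _).1 (Aexp _ ltr01).
have domc : nbhs orig (Phi @^-1` chart_dom c).
  have Pc : continuous Phi := @orbit_map_continuous _ _ _ _ psi_cont p.
  by apply: Pc; rewrite Phi_orig; apply: open_nbhs_nbhs; split => //; exact: chart_open_dom.
have [d4 d40 P4] := (polydisc_nbhs _ _).1 domc.
pose m := Num.min (Num.min d2 (Num.min d3 d4)) (Num.min 1 d1).
have m0 : 0 < m by rewrite !lt_min d20 d30 d40 ltr01.
exists (m / K); first exact: divr_gt0.
move=> t /andP[t0]; rewrite ltr_pdivlMr // => tK.
have tm a : a <= K -> t * a < m.
  by move=> aK; apply: le_lt_trans tK; apply: ler_wpM2l => //; exact: ltW.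
have A1 : rn v <= (`|kA| + 1) * rn v by rewrite ler_peMl // lerDr.
have B1 : 0 <= kL * rn v by rewrite mulr_ge0 // ltW.
have K1 : rn (S v) <= K by rewrite /K -!addrA lerDl !addr_ge0 // mulr_ge0.
have K3 : (`|kA| + 1) * rn v <= K.
  by rewrite /K [rn (S v) + _]addrC -!addrA lerDl !addr_ge0.
have K2 : rn v <= K := le_trans A1 K3.
have := tm _ K1; have := tm _ K2; have := tm _ K3; rewrite !lt_min.
move=> /andP[/and3P[_ _ _] /andP[_ t4]] /andP[/and3P[t5 t6 t7] /andP[t8 t9]].
move=> /andP[/and3P[t10 t11 t12] /andP[t13 t14]].
pose w : D := pret ((t%:C%C : C) *: v).
have pw : pemb w = (t%:C%C : C) *: v.
  apply: pretK => j; apply: le_lt_trans (rn_coord _ _) _.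
  by rewrite rnZ rn_real gtr0_norm.
have rw : rn (pemb w) = t * rn v by rewrite pw rnZ rn_real gtr0_norm.
pose w' := mobG g w.
have pw' : pemb w' = (t%:C%C : C) *: S v by rewrite gS pw SZ.
have rw' : rn (pemb w') = t * rn (S v) by rewrite pw' rnZ rn_real gtr0_norm.
have dw : chart_dom c (Phi w) by apply: P4; rewrite pemb_orig subr0 rw.
have h1 : rn (disp c p (rho (anG w)) - A (pemb w)) <= e / K * rn (pemb w).
  by apply: P2; rewrite pemb_orig subr0 rw.
have h2 : rn (disp c p (rho (anG w')) - A (pemb w')) <= e / K * rn (pemb w').
  by apply: P2; rewrite pemb_orig subr0 rw'.
have h3 : rn (disp c p (rho (anG w))) <= (`|kA| + 1) * (t * rn v).
  have h : rn (disp c p (rho (anG w)) - A (pemb w)) <= 1 * rn (pemb w).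
    by apply: P3; rewrite pemb_orig subr0 rw.
  have := rnD (disp c p (rho (anG w)) - A (pemb w)) (A (pemb w)); rewrite subrK.
  move=> /le_trans; apply; apply: le_trans (lerD h (kAP w)) _.
  rewrite rw -mulrDl [1 + _]addrC; apply: ler_wpM2r; first by rewrite mulr_ge0 // ltW.
  by rewrite lerD2r ler_norm.
set x := disp c p (rho (anG w)) in h1 h3; set y := disp c p (rho (anG w')) in h2.
have h4 : rn (y - L x) <= e / K * rn x.
  have xd : rn x < d1 by apply: le_lt_trans h3 _; rewrite mulrCA.
  have := P1 x xd; rewrite /= /x /disp [chart_to c p + _]addrC subrK -/(Phi w) chart_toK //.
  by rewrite chart_toK // gp PhiE.
have -> : (t%:C%C : C) *: (A (S v) - L (A v)) = (y - L x) - (y - A (pemb w')) + L (x - A (pemb w)).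
  have LE : L (x - A (pemb w)) = L x - (t%:C%C : C) *: L (A v).
    by rewrite pw AZ linearB; congr (_ - _); exact: linearZZ.
  rewrite LE pw' AZ scalerBr.
  by apply/rowP => j; rewrite !mxE; ring.
have h5 := kLP (x - A (pemb w)).
have h8 := rnB (y - L x) (y - A (pemb w')); apply: le_trans (rnD _ _) _.
have h6 : kL * rn (x - A (pemb w)) <= kL * (e / K * rn (pemb w)).
  by apply: ler_wpM2l => //; exact: ltW.
have h7 : e / K * rn x <= e / K * ((`|kA| + 1) * (t * rn v)).
  by apply: ler_wpM2l => //; exact: ltW.
rewrite rw in h6; rewrite rw' in h2.
have -> : e * t = e / K * (t * K) by field; rewrite gt_eqF.
have -> : e / K * (t * K) = e / K * (t * rn (S v)) + e / K * ((`|kA| + 1) * (t * rn v)) +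
   kL * (e / K * (t * rn v)) + e / K * t by rewrite {2}/K; ring.
apply: le_trans (lerD (le_trans h8 (lerD (le_trans h4 h7) h2)) (le_trans h5 h6)) _.
by rewrite [_ * (_ * rn (S v)) + _]addrC lerDl ltW // mulr_gt0.
Qed.

(** A unit number with rational parts whose square, the factor by which the disc is rotated, is not
    real. *)
Let rot : C := Complex (3 / 5) (4 / 5).

Lemma rot_det : rot * cj rot - 0 * cj 0 = 1.
Proof. by rewrite mul0r subr0 cjE; apply: cplx_eq => /=; field. Qed.

Lemma mobG_rot j (w : D) : pemb (mobG (single j (mksu rot 0)) w) = scale_coord j (rot * rot) (pemb w).
Proof.
have [ra rb] := mksuE rot_det.
apply/rowP => k; rewrite pemb_mobG mxE /single; case: eqP => _; last exact: mob1.
rewrite /mob /mobden ra rb cj0 mul0r add0r addr0.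
have r0 : cj rot != 0 by rewrite cj_eq0; apply/eqP => /(congr1 (@complex.Re R)) /=; lra.
apply: (mulIf r0); rewrite divfK //.
have : rot * cj rot = 1 by have := rot_det; rewrite mul0r subr0.
by move=> rr; rewrite mulrAC -[rot * rot * _]mulrA rr mulr1.
Qed.

(** [A] intertwines the coordinate rotations with their complex linear derivatives at [p], so it
    becomes complex linear after a flip [s]; injectivity of [A] makes the matrix invertible. *)
Lemma flipped_derivative (c : chart R n M) : cm_atlas c -> chart_dom c p ->
  exists s : 'I_n -> bool, exists2 B : 'M[C]_n, B \in unitmx &
    forall e, 0 < e -> \forall w \near (orig : D),
      rn (disp c p (rho (anG (flipD s w))) - pemb w *m B) <= e * rn (pemb w).
Proof.
move=> Ac cp.
have [A [AD AZ A0 Aexp]] := orbit_derivative phiM phiK psiK phi_cont psi_cont M_isotropy Ac cp.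
have /choice[L LP] (j : 'I_n) : exists L : {linear 'rV[C]_n -> 'rV[C]_n},
    forall v, A (scale_coord j (rot * rot) v) = L (A v).
  apply: (derivative_equivariant Ac cp AD AZ Aexp (mobG_rot j)).
    move=> t x; apply/rowP => k; rewrite !mxE; case: eqP => // _; exact: mulrCA.
  apply: torus_fix => k; have [_ rb] := mksuE rot_det.
  by rewrite /single; case: eqP.
have im0 : complex.Im (rot * rot : C) != 0.
  by apply/eqP => /=; lra.
have [s sE] := flip_complex_linear AD AZ A0 im0 LP.
exists s, (\matrix_j A (delta_mx ord0 j)).
  rewrite -row_free_unit -kermx_eq0; apply/eqP/row_matrixP => k; rewrite row0.
  rewrite -[LHS](flipK s); have /A0 -> : A (flip s (row k (kermx (\matrix_j A (delta_mx ord0 j))))) = 0.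
    by rewrite sE -row_mul mulmx_ker row0.
  by apply/rowP => j; rewrite !mxE; case: (s j); rewrite ?cj0.
move=> e e0; have [_ /(_ e e0) H] := Aexp.
have H2 : nbhs (flipD s orig) [set w : D | rn (disp c p (rho (anG w)) - A (pemb w)) <= e * rn (pemb w)].
  by rewrite flipD_orig.
have H3 : nbhs (orig : D) (flipD s @^-1` _) := @flipD_continuous R n s orig _ H2.
by move: H3; apply: filterS => w /=; rewrite pemb_flipD sE rn_flip.
Qed.

Lemma equivalent_to_polydisc : holomorphically_equivalent M D.
Proof.
have [c Ac cp] := cm_cover p.
have [s [B Bu dB]] := flipped_derivative Ac cp.
(* With the flip built in, the derivative at the origin is the complex matrix [B]; equivariance
   survives with [gflip s g] acting on [M]. *)
pose Psi w := Phi (flipD s w).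
have PsiE g w : Aut_fun (rho (gflip s g)) (Psi w) = Psi (mobG g w).
  by rewrite /Psi PhiE mobG_flip.
have Psi_orig : Psi orig = p by rewrite /Psi flipD_orig Phi_orig.
have Psi_inj : injective Psi.
  by move=> w v /Phi_inj /(congr1 (flipD s)); rewrite !flipDK.
have /choice[f fP] q : exists w, Psi w = q.
  have [w wE] := AN_transitive phiM phiK psiK phi_cont psi_cont M_isotropy p q M_connected.
  by exists (flipD s w); rewrite /Psi flipDK.
have Psif : cancel f Psi by [].
have fPsi : cancel Psi f by move=> w; apply: Psi_inj; rewrite fP.
have Psic : continuous Psi.
  apply: continuous_of_for => w.
  exact: continuous_comp (continuous_for w (@flipD_continuous R n s)) (continuous_for _ (@orbit_map_continuous _ _ _ _ psi_cont p)).
(* Continuity of the inverse is openness of the orbit map. *)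
have fc : continuous f.
  move=> q U nU; have nU2 : nbhs (flipD s (f q)) (flipD s @^-1` U).
    by apply: flipD_continuous; rewrite flipDK.
  have := Phi_nbhs nU2; rewrite -/(Psi (f q)) fP.
  apply: filterS => _ [w Uw <-]; rewrite /= -[w](flipDK s) -/(Psi _) fPsi.
  exact: Uw.
have fp : f p = orig by rewrite -Psi_orig fPsi.
have hPsi0 : hol_at (M := D) (N := M) Psi orig.
  apply: (@hol_at_chart _ _ _ D M Psi orig (polydisc_chart R n) c) => //.
    by rewrite Psi_orig.
  have [k k0 kB] := mulmx_bounded B.
  apply: (@rn_differentiable _ _ _ _ _ (mulmxr B) k); first by move=> h /=; exact: kB.
  move=> e e0; have [d d0 dP] := (polydisc_nbhs _ _).1 (dB e e0).
  exists (Num.min 1 d); first by rewrite lt_min ltr01.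
  move=> h; rewrite lt_min => /andP[h1 hd].
  have ph : pemb (pret h : D) = h.
    by apply: pretK => j; apply: le_lt_trans (rn_coord _ _) _.
  have := dP (pret h); rewrite pemb_orig subr0 ph => /(_ hd).
  have -> : chart_to (polydisc_chart R n) orig = 0 := pemb_orig.
  rewrite add0r; change ((chart_to c \o Psi \o chart_from (polydisc_chart R n)) h) with
    (chart_to c (Psi (pret h))).
  change ((chart_to c \o Psi \o chart_from (polydisc_chart R n)) 0) with
    (chart_to c (Psi orig)).
  by rewrite Psi_orig.
have hf0 : hol_at (M := M) (N := D) f p.
  apply: (@hol_at_chart _ _ _ M D f p c (polydisc_chart R n)) => //.
  have [k k0 kB] := mulmx_bounded (invmx B).
  apply: (@rn_differentiable _ _ _ _ _ (mulmxr (invmx B)) k); first by move=> h /=; exact: kB.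
  move=> e e0.
  (* The error [k t |w|] is measured by the image [w] instead of the increment [x]: the first bound
     absorbs it into [|w| <= 2 k |x|], and the second then makes it at most [e |x|]. *)
  have [t t0 [t1 t2]] : exists2 t : R, 0 < t & k * t <= 1 / 2 /\ 2 * k * (k * t) <= e.
    have k2 : 0 < 2 * k * k by rewrite !mulr_gt0.
    exists (Num.min (1 / 2 / k) (e / (2 * k * k))).
      by rewrite lt_min !divr_gt0.
    split; first by rewrite -ler_pdivlMl // mulrC ge_min lexx.
    by rewrite mulrA -ler_pdivlMl // [_^-1 * _]mulrC ge_min lexx orbT.
  have [d d0 dP] := (polydisc_nbhs _ _).1 (dB t t0).
  have fd : nbhs p (f @^-1` [set w : D | rn (pemb w - pemb (orig : D)) < d]).
    by apply: fc; rewrite fp; apply/(polydisc_nbhs _ _).2; exists d.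
  have [r r0 rP] := (chart_nbhs _ cp).1 fd.
  exists r => // x xr; have [|cz fz] := rP (chart_to c p + x).
    by rewrite addrAC subrr add0r.
  change (rn (pemb (f (chart_from c (chart_to c p + x))) -
    pemb (f (chart_from c (chart_to c p))) - x *m invmx B) <= e * rn x).
  rewrite chart_toK // fp pemb_orig subr0.
  move: fz; rewrite /preimage /=; set w := f _ => fz.
  have := dP w fz; have -> : disp c p (rho (anG (flipD s w))) = x.
    by rewrite /disp -/(Phi _) -/(Psi w) Psif chart_fromK // addrAC subrr add0r.
  move=> h1; have wE : pemb w - x *m invmx B = - ((x - pemb w *m B) *m invmx B).
    by rewrite mulmxBl mulmxK // opprB.
  have h2 : rn (pemb w - x *m invmx B) <= k * t * rn (pemb w).
    rewrite wE rnN -mulrA; apply: le_trans (kB _) _.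
    by apply: ler_wpM2l => //; exact: ltW.
  have := rnD (pemb w - x *m invmx B) (x *m invmx B); rewrite subrK => h3.
  have h4 := kB x; have h5 : k * t * rn (pemb w) <= 1 / 2 * rn (pemb w).
    by apply: ler_wpM2r => //; exact: rn_ge0.
  have h6 : rn (pemb w) <= 2 * k * rn x by lra.
  apply: le_trans h2 _; apply: (@le_trans _ _ (k * t * (2 * k * rn x))).
    by apply: ler_wpM2l => //; rewrite mulr_ge0 // ltW.
  have -> : k * t * (2 * k * rn x) = 2 * k * (k * t) * rn x by ring.
  by apply: ler_wpM2r => //; exact: rn_ge0.
(* Near [v] both maps are those near the origin composed with automorphisms of [D] and [M]. *)
have hol_all v : hol_at (M := D) (N := M) Psi v /\ hol_at (M := M) (N := D) f (Psi v).
  pose g := anG v; have gv : mobG (ginv g) v = orig.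
    by rewrite -[X in mobG _ X](anG_orig v) -mobGM gVmul mobG1.
  have gPsi w : Aut_fun (rho (gflip s g)) (Psi (mobG (ginv g) w)) = Psi w.
    by rewrite PsiE -mobGM gmulV mobG1.
  have gVPsi w : Aut_fun (rho (ginv (gflip s g))) (Psi w) = Psi (mobG (ginv g) w).
    by apply/esym/(rho_inv phiM phiK psiK).
  split.
    have -> : Psi = (Aut_fun (rho (gflip s g)) \o Psi) \o mobG (ginv g).
      by apply/funext => w /=; rewrite gPsi.
    apply: (hol_at_comp (M := D) (N := D) (P := M)).
    - exact: mobG_continuous.
    - exact: holomorphic_at (mobG_holomorphic _) _.
    - rewrite gv; apply: (hol_at_comp (M := D) (N := M) (P := M)) => //.
      exact: holomorphic_at (Aut_funP _).1 _.
  have -> : f = (mobG g \o f) \o Aut_fun (rho (ginv (gflip s g))).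
    apply/funext => q /=; rewrite -[in RHS](fP q) gVPsi fPsi -mobGM gmulV mobG1 //.
  apply: (hol_at_comp (M := M) (N := M) (P := D)).
  - exact: (Aut_funP _).1.1.
  - exact: holomorphic_at (Aut_funP _).1 _.
  - rewrite gVPsi gv Psi_orig; apply: (hol_at_comp (M := M) (N := D) (P := D)) => //.
    exact: holomorphic_at (mobG_holomorphic _) _.
exists f; split.
  split => // c1 d1 Ac1 Ad1 q; rewrite -{1}(fP q).
  by have [_ H] := hol_all (f q); rewrite fP in H *; exact: H.
exists Psi; split => //; split => // c1 d1 Ac1 Ad1 q.
by have [H _] := hol_all q; exact: H.
Qed.

End Conclusion.

Theorem theorem1p2 (R : realType) (n : nat) (M : complexManifold R n)
    (M_nonempty : [set: M] !=set0)
    (M_connected : connected [set: M])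
    (M_isotropy : forall p : M, compact (isotropy p))
    (M_Aut : Aut_isomorphic M (polydisc R n)) :
  holomorphically_equivalent M (polydisc R n).
Proof.
have [phi [psi [phiM phiK psiK phi_cont psi_cont]]] := M_Aut; have [p0 _] := M_nonempty.
have [p pP] := torus_fixed_point phiM phiK psiK phi_cont psi_cont M_isotropy M_connected p0.
exact: equivalent_to_polydisc phiM phiK psiK phi_cont psi_cont M_isotropy M_connected p pP.
Qed.
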